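(* Let $\mathcal{H}$ be an irreducible $\overline{\mathbb{Q}_\ell}$-hypergeometric sheaf on $\mathbb{G}_m/\overline{\mathbb{F}_p}$, $p\neq\ell$, of type $(D,m)$ with $W:=D-m\ge 2$. Let $G_{\mathrm{geom}}$ be its geometric monodromy group and denote by $G_0$ the Zariski closure inside $G_{\mathrm{geom}}$ of the normal subgroup generated by all $G_{\mathrm{geom}}$-conjugates of the image of $I(0)$. Then $G_0=G_{\mathrm{geom}}$. In particular, if $G_{\mathrm{geom}}$ is finite, then it is generated by all $G_{\mathrm{geom}}$-conjugates of the image of $I(0)$, and $G_{\mathrm{geom}}=\mathbf{O}^p(G_{\mathrm{geom}})$.
   Context: Hypergeometric sheaf of type $(D,m)$, $D>m\ge0$: Katz's $\mathcal{H}yp_\psi(\chi_1,\ldots,\chi_D;\rho_1,\ldots,\rho_m)$ for multiplicative characters of a finite field $\mathbb{F}_q^\times\subset\overline{\mathbb{F}_p}$ and a nontrivial additive character $\psi$ of $\mathbb{F}_p$; it is lisse of rank $D$ on $\mathbb{G}_m$, tame at $0$, and at $\infty$ is the sum of a tame part of rank $m$ and a totally wild part of rank $D-m$ with all breaks $1/(D-m)$; it is geometrically irreducible iff no $\chi_i$ equals any $\rho_j$. The geometric monodromy group $G_{\mathrm{geom}}$ is the Zariski closure of the image of $\pi_1(\mathbb{G}_m/\overline{\mathbb{F}_p})$ acting on the sheaf. $I(0)$, $I(\infty)$ denote inertia groups at $0,\infty$. For a finite group $X$, $\mathbf{O}^p(X)$ is the subgroup generated by all $p'$-elements of $X$. 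*)

(* Defs.v *)
From HB Require Import structures.
From mathcomp Require Import all_boot all_order all_algebra all_field.
From mathcomp Require Import mpoly.

Set Implicit Arguments.
Unset Strict Implicit.
Unset Printing Implicit Defensive.

Import Order.TTheory GRing.Theory Num.Theory.
Local Open Scope ring_scope.

(** * Rank one valuations

    Valuations take values in [rat]; the value at 0 is irrelevant, since 0 is
    treated as having valuation +oo by [val_ge] and [val_gt]. *)

Definition val_ge (K : fieldType) (v : K -> rat) (c : rat) (x : K) : bool :=
  (x == 0) || (c <= v x).

Definition val_gt (K : fieldType) (v : K -> rat) (c : rat) (x : K) : bool :=
  (x == 0) || (c < v x).

Record valuation (K : fieldType) (v : K -> rat) : Prop := Valuation {
  valuationM : forall x y, x != 0 -> y != 0 -> v (x * y) = v x + v y;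
  valuationD : forall c x y,
    val_ge v c x -> val_ge v c y -> val_ge v c (x + y) }.

(** * The field of l-adic algebraic numbers *)

(* Q_l, as the closure of Q in a valued field of characteristic 0. *)
Definition in_Ql (F : fieldType) (w : F -> rat) (x : F) : Prop :=
  forall N : nat, exists r : rat, val_ge w N%:R (x - ratr r).

(* [(F, w)] is an algebraic closure of Q_l with the l-adic valuation
   normalised by w(l) = 1; these axioms determine it up to isomorphism. *)
Record is_Qlbar (l : nat) (F : closedFieldType) (w : F -> rat) : Prop :=
  IsQlbar {
  Qlbar_pchar : [pchar F] =i pred0;
  Qlbar_val : valuation w;
  Qlbar_norm : w l%:R = 1;
  Qlbar_complete : forall u : nat -> rat,
    (forall N : nat, exists M : nat, forall i j : nat,
       (M <= i)%N -> (M <= j)%N -> val_ge w N%:R (ratr (u i) - ratr (u j))) ->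
    exists x : F, forall N : nat, exists M : nat, forall i : nat,
       (M <= i)%N -> val_ge w N%:R (x - ratr (u i));
  Qlbar_algebraic : forall x : F, exists f : {poly F},
    [/\ f != 0, root f x & forall i, in_Ql w f`_i] }.

(** * Galois groups and fundamental groups of open parts of the line

    Everything takes place in a separable closure [Om] of F_p(t).  It contains
    an algebraic closure of F_p and it is also a separable closure of F_q(t)
    and of Fpbar(t).  A lisse sheaf on G_m is identified with a continuous
    representation of the absolute Galois group of the function field that is
    trivial on the inertia groups of all places other than 0 and oo. *)

(* The polynomial over F_p(t) with coefficients in F_p[t] given by [f]. *)
Definition eval_at (Om : fieldType) (t : Om) (f : {poly {poly int}}) :
  {poly Om} := map_poly (fun c : {poly int} => (map_poly intr c).[t]) f.

Record is_sepclosure_Fpt (p : nat) (Om : fieldType) (t : Om) : Prop :=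
  IsSepClosureFpt {
  Om_pchar : p \in [pchar Om];
  Om_transc : forall c : {poly int},
    root (map_poly intr c) t -> map_poly intr c = 0 :> {poly Om};
  Om_separable : forall x : Om, exists f : {poly {poly int}},
    separable_poly (eval_at t f) /\ root (eval_at t f) x;
  Om_closed : forall g : {poly Om},
    separable_poly g -> (1 < size g)%N -> exists x, root g x }.

Definition Fq (p f : nat) (Om : fieldType) (x : Om) : Prop :=
  x ^+ (p ^ f) = x.

Definition Fpbar (p : nat) (Om : fieldType) (x : Om) : Prop :=
  exists2 f : nat, (0 < f)%N & Fq p f x.

(* The Galois group of [Om] over k(t); since [Om] is algebraic over k(t), such
   endomorphisms are automatically bijective. *)
Definition gal (Om : fieldType) (t : Om) (k : Om -> Prop)
    (s : {rmorphism Om -> Om}) : Prop :=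
  s t = t /\ forall x, k x -> s x = x.

(* [v] is a valuation of [Om] above the place of P^1 with uniformizer [u],
   normalised so that v(u) = 1.  The uniformizer is t - a at the finite point
   a, and 1/t at oo. *)
Definition place_over (Om : fieldType) (u : Om) (v : Om -> rat) : Prop :=
  valuation v /\ v u = 1.

Definition inertia (Om : fieldType) (v : Om -> rat)
    (s : {rmorphism Om -> Om}) : Prop :=
  forall x, val_ge v 0 x -> val_gt v 0 (s x - x).

Definition wild_inertia (Om : fieldType) (v : Om -> rat)
    (s : {rmorphism Om -> Om}) : Prop :=
  forall x, x != 0 -> val_gt v 0 (s x / x - 1).

(* [s] preserves the valuation ring of [v] and the inverse of [s] induces
   x |-> x ^ Q on the residue field. *)
Definition geom_Frobenius (Om : fieldType) (v : Om -> rat) (Q : nat)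
    (s : {rmorphism Om -> Om}) : Prop :=
  forall x, val_ge v 0 x -> val_gt v 0 (s x ^+ Q - x).

(** * Upper numbering *)

(* The finite Galois extension L = Fpbar(t)(ys) of Fpbar(t), where [ys] is
   Galois stable; representatives [tau] of the local Galois group
   I(v) / (I(v) :&: Gal(Om / L)) of L / Fpbar(t) at [v], of order [n]; and a
   uniformizer [pi] of L at [v].  The residue field being algebraically closed,
   the local extension is totally ramified of index [n], and the normalised
   valuation of L is n * v. *)
Record galois_layer (p : nat) (Om : fieldType) (t : Om) (v : Om -> rat)
    (ys : seq Om) (n : nat) (tau : 'I_n -> {rmorphism Om -> Om}) (pi : Om) :
  Prop := GaloisLayer {
  layer_stable : forall s : {rmorphism Om -> Om}, gal t (@Fpbar p Om) s ->
    {in ys, forall y, s y \in ys};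
  layer_inertia : forall i, gal t (@Fpbar p Om) (tau i) /\ inertia v (tau i);
  layer_repr : forall s : {rmorphism Om -> Om},
    gal t (@Fpbar p Om) s -> inertia v s ->
    exists! i : 'I_n, {in ys, s =1 tau i};
  layer_pi : forall s : {rmorphism Om -> Om}, gal t (@Fpbar p Om) s ->
    {in ys, forall y, s y = y} -> s pi = pi;
  layer_pi_neq0 : pi != 0;
  layer_pi_unif : n%:R * v pi = 1 }.

(* Serre's formula phi(c) = (1 / g_0) sum_s min(i_G(s), c + 1) - 1 for the
   Herbrand function, where i_G(s) = v_L(s pi - pi). *)
Definition herbrand (Om : fieldType) (v : Om -> rat) (n : nat)
    (tau : 'I_n -> {rmorphism Om -> Om}) (pi : Om) (c : rat) : rat :=
  n%:R^-1 * (\sum_(i < n)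
     (if tau i pi == pi then c + 1
      else Num.min (n%:R * v (tau i pi - pi)) (c + 1))) - 1.

(* The subgroup I^(u) of the inertia group, u >= 0: by definition of the upper
   numbering, its image in each finite layer is the lower numbering group G_c
   with phi(c) = u, and G_c is defined by v_L(s pi - pi) >= c + 1. *)
Definition upper_ramification (p : nat) (Om : fieldType) (t : Om)
    (v : Om -> rat) (u : rat) (s : {rmorphism Om -> Om}) : Prop :=
  [/\ gal t (@Fpbar p Om) s, inertia v s &
      forall ys n (tau : 'I_n -> {rmorphism Om -> Om}) pi,
        galois_layer p t v ys tau pi ->
        forall c : rat, 0 <= c -> herbrand v tau pi c = u ->
        val_ge v ((c + 1) / n%:R) (s pi - pi)].

(** * Lisse sheaves on G_m

    [r s] acts on column vectors.  Subspaces are row spaces of matrices, on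
    which [s] therefore acts by right multiplication by [(r s)^T]. *)

Record lisse_Gm (p : nat) (Om : fieldType) (t : Om) (k : Om -> Prop)
    (F : closedFieldType) (w : F -> rat) (D : nat)
    (r : {rmorphism Om -> Om} -> 'M[F]_D) : Prop := LisseGm {
  lisse_unit : forall s, gal t k s -> r s \in unitmx;
  lisse_mul : forall s1 s2 s3, gal t k s1 -> gal t k s2 -> gal t k s3 ->
    s3 =1 s1 \o s2 -> r s3 = r s1 *m r s2;
  (* defined over a finite extension of Q_l *)
  lisse_finite : exists b : seq F, forall s, gal t k s -> forall i j,
    exists c : nat -> F, (forall a, in_Ql w (c a)) /\
      r s i j = \sum_(a < size b) c a * b`_a;
  lisse_continuous : forall N : nat, exists ys : seq Om, forall s, gal t k s ->
    {in ys, forall y, s y = y} ->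
    forall i j, val_ge w N%:R ((r s - 1%:M) i j);
  lisse_unramified : forall a, Fpbar p a -> a != 0 ->
    forall v, place_over (t - a) v ->
    forall s, gal t k s -> inertia v s -> r s = 1%:M }.

Definition irreducible (Om : fieldType) (t : Om) (k : Om -> Prop)
    (F : closedFieldType) (D : nat) (r : {rmorphism Om -> Om} -> 'M[F]_D) :
  Prop :=
  (0 < D)%N /\ forall U : 'M[F]_D,
    (forall s, gal t k s -> stablemx U (r s)^T) -> U = 0 \/ row_full U.

Definition tame_at (Om : fieldType) (t : Om) (k : Om -> Prop) (u : Om)
    (F : closedFieldType) (D : nat) (r : {rmorphism Om -> Om} -> 'M[F]_D) :
  Prop :=
  forall v, place_over u v ->
  forall s, gal t k s -> wild_inertia v s -> r s = 1%:M.

(* At the place with uniformizer [u], the sheaf is the direct sum of a tame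
   part [T] of rank [m] and a part [W] of rank [D - m] all of whose breaks are
   equal to [b] (which is totally wild when b > 0). *)
Definition tame_plus_breaks (p : nat) (Om : fieldType) (t : Om) (u : Om)
    (F : closedFieldType) (D m : nat) (b : rat)
    (r : {rmorphism Om -> Om} -> 'M[F]_D) : Prop :=
  forall v, place_over u v -> exists T W : 'M[F]_D,
  [/\ [/\ \rank T = m, \rank W = (D - m)%N & row_full (T + W)%MS],
      forall s, gal t (@Fpbar p Om) s -> inertia v s ->
        stablemx T (r s)^T /\ stablemx W (r s)^T,
      forall s, gal t (@Fpbar p Om) s -> wild_inertia v s -> T *m (r s)^T = T,
      forall c s, b < c -> upper_ramification p t v c s -> W *m (r s)^T = W &
      forall x : 'rV[F]_D, (x <= W)%MS ->
        (forall s, upper_ramification p t v b s -> x *m (r s)^T = x) -> x = 0].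

(** * Hypergeometric sheaves *)

(* Characters are functions on [Om] of which only the restriction to the
   relevant finite subfield matters. *)
Definition additive_char (p : nat) (Om F : fieldType) (psi : Om -> F) : Prop :=
  psi 0 = 1 /\
  forall x y, Fq p 1 x -> Fq p 1 y -> psi (x + y) = psi x * psi y.

Definition nontrivial_additive (p : nat) (Om F : fieldType) (psi : Om -> F) :
  Prop := exists2 x, Fq p 1 x & psi x <> 1.

Definition mult_char (p f : nat) (Om F : fieldType) (chi : Om -> F) : Prop :=
  chi 1 = 1 /\
  forall x y, Fq p f x -> Fq p f y -> x != 0 -> y != 0 ->
    chi (x * y) = chi x * chi y.

(* Trace and norm from the field with q ^ n elements to the field with q
   elements. *)
Definition fin_trace (K : fieldType) (q n : nat) (x : K) : K :=
  \sum_(i < n) x ^+ (q ^ i).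

Definition fin_norm (K : fieldType) (q n : nat) (x : K) : K :=
  \prod_(i < n) x ^+ (q ^ i).

(* The hypergeometric sum over an extension E of degree n of F_(p ^ f),
   embedded by [j] in [Om]: (-1)^(D+m-1) times the sum over
   x_1 ... x_D = a y_1 ... y_m, all x_i and y_j nonzero, of
   psi_E(sum x - sum y) prod chi_i(N x_i) prod rho_j^-1(N y_j). *)
Definition hyp_sum (p f n : nat) (Om : fieldType) (F : fieldType) (D m : nat)
    (psi : Om -> F) (chi : 'I_D -> Om -> F) (rho : 'I_m -> Om -> F)
    (E : finFieldType) (j : {rmorphism E -> Om}) (a : E) : F :=
  (-1) ^+ (D + m - 1) *
  \sum_(x : {ffun 'I_D -> E}) \sum_(y : {ffun 'I_m -> E} |
      [&& [forall i, x i != 0], [forall i, y i != 0] &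
          \prod_i x i == a * \prod_i y i])
    (psi (fin_trace p (f * n) (j (\sum_i x i - \sum_i y i))) *
     \prod_i chi i (fin_norm (p ^ f) n (j (x i))) *
     \prod_i (rho i (fin_norm (p ^ f) n (j (y i))))^-1).

(* [R] is Katz's sheaf Hyp_psi(chi_1, ..., chi_D; rho_1, ..., rho_m) on
   G_m / F_(p ^ f): the sheaf with the hypergeometric sums as Frobenius traces
   (which by Chebotarev determine it when it is irreducible), together with its
   local monodromy at 0 and oo. *)
Record is_Hyp (p f : nat) (Om : fieldType) (t : Om) (F : closedFieldType)
    (w : F -> rat) (D m : nat) (psi : Om -> F) (chi : 'I_D -> Om -> F)
    (rho : 'I_m -> Om -> F) (R : {rmorphism Om -> Om} -> 'M[F]_D) : Prop :=
  IsHyp {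
  Hyp_lisse : lisse_Gm p t (@Fq p f Om) w R;
  Hyp_trace : forall (n : nat) (E : finFieldType) (j : {rmorphism E -> Om}),
    #|E| = (p ^ (f * n))%N ->
    forall a : E, a != 0 -> forall v, place_over (t - j a) v ->
    forall s, gal t (@Fq p f Om) s -> geom_Frobenius v #|E| s ->
    \tr (R s) = hyp_sum p f n psi chi rho j a;
  Hyp_tame0 : tame_at t (@Fq p f Om) t R;
  Hyp_infty : tame_plus_breaks p t t^-1 m ((D - m)%:R^-1) R }.

(* [r] is, on the geometric fundamental group, the pullback to G_m / Fpbar of
   some Hyp_psi(chi; rho) with characters of some finite field. *)
Definition hypergeometric (p : nat) (Om : fieldType) (t : Om)
    (F : closedFieldType) (w : F -> rat) (D m : nat)
    (r : {rmorphism Om -> Om} -> 'M[F]_D) : Prop :=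
  exists (f : nat) (psi : Om -> F) (chi : 'I_D -> Om -> F)
    (rho : 'I_m -> Om -> F) (R : {rmorphism Om -> Om} -> 'M[F]_D),
  [/\ (0 < f)%N,
      additive_char p psi /\ nontrivial_additive p psi,
      (forall i, mult_char p f (chi i)) /\ (forall i, mult_char p f (rho i)),
      is_Hyp p f t w psi chi rho R &
      forall s, gal t (@Fpbar p Om) s -> r s = R s].

(** * Monodromy groups, as subsets of GL_D *)

Definition zariski_closure (F : fieldType) (D : nat) (S : 'M[F]_D -> Prop)
    (M : 'M[F]_D) : Prop :=
  M \in unitmx /\
  forall P : {mpoly F[D * D]},
    (forall N, S N -> P.@[fun i => mxvec N 0 i] = 0) ->
    P.@[fun i => mxvec M 0 i] = 0.

Inductive generated (F : fieldType) (D : nat) (S : 'M[F]_D -> Prop) :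
  'M[F]_D -> Prop :=
| generated_one : generated S 1%:M
| generated_mem M : S M -> generated S M
| generated_mul M N : generated S M -> generated S N -> generated S (M *m N)
| generated_inv M : generated S M -> generated S (invmx M).

Definition conjugates (F : fieldType) (D : nat) (G S : 'M[F]_D -> Prop)
    (M : 'M[F]_D) : Prop :=
  exists g x, [/\ G g, S x & M = g *m x *m invmx g].

Definition finite_set (F : fieldType) (D : nat) (G : 'M[F]_D -> Prop) : Prop :=
  exists l : seq 'M[F]_D, forall M, G M -> M \in l.

(* O^p(G), for finite G: an element has order prime to p exactly when it is
   killed by an exponent prime to p. *)
Definition Op_residual (p : nat) (F : fieldType) (D : nat)
    (G : 'M[F]_D -> Prop) : 'M[F]_D -> Prop :=
  generated (fun M => G M /\ exists2 n : nat, coprime p n & M ^+ n = 1%:M).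

Definition Ggeom (p : nat) (Om : fieldType) (t : Om) (F : fieldType) (D : nat)
    (r : {rmorphism Om -> Om} -> 'M[F]_D) : 'M[F]_D -> Prop :=
  zariski_closure (fun M => exists2 s, gal t (@Fpbar p Om) s & M = r s).

Definition inertia_image (p : nat) (Om : fieldType) (t : Om) (v : Om -> rat)
    (F : fieldType) (D : nat) (r : {rmorphism Om -> Om} -> 'M[F]_D)
    (M : 'M[F]_D) : Prop :=
  exists s, [/\ gal t (@Fpbar p Om) s, inertia v s & M = r s].

(* The subgroup generated by the G_geom-conjugates of the image of the inertia
   group at [v]. *)
Definition inertia_normal_closure (p : nat) (Om : fieldType) (t : Om)
    (v : Om -> rat) (F : fieldType) (D : nat)
    (r : {rmorphism Om -> Om} -> 'M[F]_D) : 'M[F]_D -> Prop :=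
  generated (conjugates (Ggeom p t r) (inertia_image p t v r)).

(* Main.v *)
(* Let [N] be the normal closure of the image of I(0), let [Delta] be an open
   normal subgroup of the Galois group of Fpbar(t), and let [H] be the group
   of the [s] with r(s) in N r(Delta). The cover of P^1 attached to [H] is
   unramified at all finite places, since the sheaf is lisse away from 0, and
   its upper ramification breaks at oo are less than 1, since the breaks of
   the sheaf there are at most 1/W <= 1/2. Such a cover is trivial. If it were
   not, consider a function [y] on it, integral at all finite places, not in
   Fpbar(t), and of least pole order at oo. As the different at oo is small,
   differentiation with respect to t lowers the pole order, so that dy/dt is a
   polynomial [h] by minimality. Subtracting an antiderivative of [h] leaves a
   p-th power, and minimality shows that the conjugates of its p-th root
   differ by constants. A trace turns it into a generator of an Artin-Schreier
   extension y^p - y = G(t) of Fpbar(t) with deg G positive and prime to p,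
   which has upper break at least 1 at oo: a contradiction. Hence [H] is the
   whole Galois group, for all [Delta], so that [N] is l-adically, and a
   fortiori Zariski, dense in G_geom. In the finite case [N] is closed, and it
   is generated by elements of order prime to p because the sheaf is tame at
   0. *)

Require Import Defs.
From HB Require Import structures.
From mathcomp Require Import all_boot all_order all_algebra all_field.
From mathcomp Require Import mpoly.
From mathcomp Require cyclic boolp classical_sets filter.
From mathcomp Require Import ring lra zify.

Set Implicit Arguments.
Unset Strict Implicit.
Unset Printing Implicit Defensive.

Import Order.TTheory GRing.Theory Num.Theory.
Local Open Scope ring_scope.

(** The threshold 1 is sharp: y^p - y = t has upper break 1 at oo. Below it, the different at oo is
    at most 2e - 2 in a layer of ramification index e, so that by Riemann-Hurwitz a connected cover
    would be a line with one point above oo, and the function of least pole order its coordinate.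
    Differentiation reaches the same end with valuations alone. Completions are avoided in the same
    way: the elements fixed by the inertia group at a place act as the completed base field, because
    rational functions approximate them.

    The ramification bound concerns subgroups I^(U) of an infinite Galois group, whereas the
    different is computed in a finite layer. Herbrand's theorem and compactness bridge the gap, by
    lifting an element of upper number U in a layer to an element of I^(U).

    [N] is generated as an abstract group and need not be closed; this is why r(Delta) is adjoined,
    to get an open group, and why density is all that results in general. One place above 0 is
    given; places above the other points are obtained from it by substitutions. *)

Fixpoint forall_in (I : Type) (P : I -> Prop) (l : seq I) : Prop :=
  if l is i :: l' then P i /\ forall_in P l' else True.

Lemma forall_in_cat (I : Type) (P : I -> Prop) l1 l2 :
  forall_in P (l1 ++ l2) <-> forall_in P l1 /\ forall_in P l2.
Proof.
elim: l1 => [|i l1 IH] /=; first by split=> // -[].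
by rewrite IH; split=> [[? [? ?]]|[[? ?] ?]].
Qed.

Lemma forall_in_mem (I : eqType) (P : I -> Prop) l :
  (forall i, i \in l -> P i) <-> forall_in P l.
Proof.
elim: l => [|i l IH] //=; split=> [h|[h1 /IH h2] j].
  by split; [apply: h; rewrite mem_head|apply/IH => j jl; apply: h; rewrite inE jl orbT].
by rewrite inE => /orP[/eqP->//|/h2].
Qed.

(** Limits along ultrafilters stand in for a topology on the Galois group: [gal_compact] uses this
    with [T] the type of its elements. *)
Lemma ultrafilter_exists (T I : Type) (C : I -> T -> Prop) :
  (forall l : seq I, exists x, forall_in (C^~ x) l) ->
  exists U : (T -> Prop) -> Prop,
    [/\ forall i, U (C i), forall A B, U A -> U B -> U (fun x => A x /\ B x),
        forall A B : T -> Prop, (forall x, A x -> B x) -> U A -> U B,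
        forall A, U A -> exists x, A x
      & forall A, U A \/ U (fun x => ~ A x)].
Proof.
move=> fip.
pose F (A : classical_sets.set T) := exists l, forall x, forall_in (C^~ x) l -> A x.
have PF : filter.ProperFilter F.
  split; first by case=> l hl; have [x /hl] := fip l.
  split; first by exists [::].
    move=> A B [l1 h1] [l2 h2]; exists (l1 ++ l2) => x.
    by move=> /forall_in_cat[/h1 ? /h2 ?].
  by move=> A B AB [l h]; exists l => x /h /AB.
have [U [UU FU]] := filter.ultraFilterLemma PF.
have PU : filter.ProperFilter U := @filter.ultra_proper _ _ UU.
have FilU : filter.Filter U := @filter.filter_filter _ _ PU.
have nU : ~ U classical_sets.set0 := @filter.filter_not_empty _ U PU.
exists U; split.
- by move=> i; apply: FU; exists [:: i] => x /= [].
- by move=> A B UA UB; apply: filter.filterI.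
- by move=> A B AB; apply: filter.filterS.
- move=> A UA; apply: boolp.contrapT => nA.
  apply: nU.
  by apply: filter.filterS UA => x Ax; apply: nA; exists x.
- by move=> A; have [] := filter.in_ultra_setVsetC A UU; [left|right].
Qed.

Lemma exists_rmorphism (R S : nzRingType) (f : R -> S) :
  f 1 = 1 -> (forall x y, f (x - y) = f x - f y) ->
  (forall x y, f (x * y) = f x * f y) ->
  exists g : {rmorphism R -> S}, g =1 f.
Proof.
move=> f1 fB fM.
pose fz := GRing.isZmodMorphism.Build _ _ f fB.
pose fm := GRing.isMonoidMorphism.Build _ _ f (conj f1 fM).
pose g : {rmorphism R -> S} := HB.pack f fz fm.
by exists g.
Qed.

(** * Subfields given by predicates *)

Record is_subfield (L : fieldType) (S : L -> Prop) : Prop := IsSubfield {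
  subfield1 : S 1;
  subfieldB : forall x y, S x -> S y -> S (x - y);
  subfieldM : forall x y, S x -> S y -> S (x * y);
  subfieldV : forall x, S x -> S x^-1 }.

Section SubfieldType.
Variables (L : fieldType) (S : L -> Prop) (hS : is_subfield S).

Definition in_subfield : {pred L} := fun x => boolp.asbool (S x).

Fact in_subfieldP x : reflect (S x) (x \in in_subfield).
Proof. exact: boolp.asboolP. Qed.

Fact in_subfield_divring : divring_closed in_subfield.
Proof.
split; first by apply/in_subfieldP; exact: subfield1 hS.
  move=> x y /in_subfieldP Sx /in_subfieldP Sy; apply/in_subfieldP.
  exact: subfieldB hS _ _ Sx Sy.
move=> x y /in_subfieldP Sx /in_subfieldP Sy; apply/in_subfieldP.
exact: subfieldM hS _ _ Sx (subfieldV hS Sy).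
Qed.

HB.instance Definition _ := GRing.isDivringClosed.Build L in_subfield in_subfield_divring.

Definition subfield_sort := {x : L | x \in in_subfield}.

HB.instance Definition _ := SubChoice.on subfield_sort.
HB.instance Definition _ := [SubChoice_isSubIntegralDomain of subfield_sort by <:].
HB.instance Definition _ := [SubIntegralDomain_isSubField of subfield_sort by <:].

(** Fixed fields and fields of rational functions arise as propositions on [L]. Division and gcds of
    polynomials over them need a field type, which classical decidability of membership provides. *)
Lemma subfield_type :
  exists (K : fieldType) (i : {rmorphism K -> L}),
    forall x, S x <-> exists y, i y = x.
Proof.
exists (subfield_sort : fieldType), (val : {rmorphism subfield_sort -> L}) => x.
split=> [/in_subfieldP Sx|[y <-]]; first by exists (exist _ x Sx).
by apply/in_subfieldP; apply: valP.
Qed.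

End SubfieldType.

(** * Valuations *)

Section Valuation.
Variables (K : fieldType) (v : K -> rat) (hv : valuation v).
Implicit Types x y : K.

Lemma val_ge0 c : val_ge v c 0. Proof. by rewrite /val_ge eqxx. Qed.
Lemma val_gt0 c : val_gt v c 0. Proof. by rewrite /val_gt eqxx. Qed.

Lemma val_geN0 c x : x != 0 -> val_ge v c x = (c <= v x).
Proof. by rewrite /val_ge => /negPf->. Qed.

Lemma val_gtN0 c x : x != 0 -> val_gt v c x = (c < v x).
Proof. by rewrite /val_gt => /negPf->. Qed.

Lemma valM x y : x != 0 -> y != 0 -> v (x * y) = v x + v y.
Proof. exact: valuationM. Qed.

Lemma val1 : v 1 = 0.
Proof.
have := @valM 1 1 (oner_neq0 _) (oner_neq0 _); rewrite mulr1 => h.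
by apply: (@addrI _ (v 1)); rewrite addr0.
Qed.

Lemma valX x n : x != 0 -> v (x ^+ n) = n%:R * v x.
Proof.
move=> x0; elim: n => [|n IH]; first by rewrite expr0 val1 mul0r.
by rewrite exprS valM ?expf_neq0 // IH -natr1 mulrDl mul1r addrC.
Qed.

Lemma valN1 : v (-1) = 0.
Proof.
have := @valX (-1) 2; rewrite sqrrN expr1n val1 oppr_eq0 oner_eq0 => /(_ isT) h.
by lra.
Qed.

Lemma valN x : v (- x) = v x.
Proof.
have [->|x0] := eqVneq x 0; first by rewrite oppr0.
by rewrite -mulN1r valM ?oppr_eq0 ?oner_eq0 // valN1 add0r.
Qed.

Lemma valV x : x != 0 -> v x^-1 = - v x.
Proof.
move=> x0; have := @valM x x^-1 x0; rewrite invr_eq0 => /(_ x0).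
by rewrite divff // val1 => h; lra.
Qed.

Lemma val_div x y : x != 0 -> y != 0 -> v (x / y) = v x - v y.
Proof. by move=> x0 y0; rewrite valM ?invr_eq0 // valV. Qed.

Lemma valZ x (m : int) : x != 0 -> v (x ^ m) = m%:~R * v x.
Proof.
move=> x0; case: m => n; first by rewrite -exprnP valX.
by rewrite NegzE -exprnN valV ?expf_neq0 // valX // mulrNz mulNr.
Qed.

Lemma val_prod (I : eqType) (r : seq I) (f : I -> K) :
  (forall i, i \in r -> f i != 0) ->
  v (\prod_(i <- r) f i) = \sum_(i <- r) v (f i).
Proof.
elim: r => [|i r IH] h; first by rewrite !big_nil val1.
have h' j : j \in r -> f j != 0 by move=> jr; rewrite h // inE jr orbT.
rewrite !big_cons valM ?h ?mem_head ?IH // prodf_seq_neq0.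
by apply/allP => j jr; apply/implyP => _; apply: h'.
Qed.

Lemma val_ge_le c d x : c <= d -> val_ge v d x -> val_ge v c x.
Proof. by rewrite /val_ge => cd /orP[->//|h]; rewrite (le_trans cd h) orbT. Qed.

Lemma val_gt_ge c x : val_gt v c x -> val_ge v c x.
Proof. by rewrite /val_ge /val_gt => /orP[->//|/ltW->]; rewrite orbT. Qed.

Lemma val_ge_gt c d x : c < d -> val_ge v d x -> val_gt v c x.
Proof. by rewrite /val_ge /val_gt => cd /orP[->//|/(lt_le_trans cd)->]; rewrite orbT. Qed.

Lemma val_gt_le c d x : c <= d -> val_gt v d x -> val_gt v c x.
Proof. by rewrite /val_gt => cd /orP[->//|h]; rewrite (le_lt_trans cd h) orbT. Qed.

Lemma val_geD c x y : val_ge v c x -> val_ge v c y -> val_ge v c (x + y).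
Proof. exact: valuationD. Qed.

Lemma val_geN c x : val_ge v c (- x) = val_ge v c x.
Proof. by rewrite /val_ge oppr_eq0 valN. Qed.

Lemma val_gtN c x : val_gt v c (- x) = val_gt v c x.
Proof. by rewrite /val_gt oppr_eq0 valN. Qed.

Lemma val_geB c x y : val_ge v c x -> val_ge v c y -> val_ge v c (x - y).
Proof. by move=> hx hy; apply: val_geD; rewrite ?val_geN. Qed.

Lemma val_gtP c x : val_gt v c x <-> exists2 d, c < d & val_ge v d x.
Proof.
split=> [|[d cd h]]; last exact: (val_ge_gt cd h).
have [->|x0] := eqVneq x 0; first by exists (c + 1); rewrite ?val_ge0 //; lra.
by rewrite val_gtN0 // => h; exists (v x); rewrite ?val_geN0.
Qed.

Lemma val_gtD c x y : val_gt v c x -> val_gt v c y -> val_gt v c (x + y).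
Proof.
move=> /val_gtP[d cd hx] /val_gtP[e ce hy]; apply/val_gtP.
exists (Num.min d e); first by rewrite lt_min cd.
by apply: val_geD; [apply: (val_ge_le _ hx)|apply: (val_ge_le _ hy)]; rewrite ge_min lexx ?orbT.
Qed.

Lemma val_gtB c x y : val_gt v c x -> val_gt v c y -> val_gt v c (x - y).
Proof. by move=> hx hy; apply: val_gtD; rewrite ?val_gtN. Qed.

Lemma val_geM c d x y : val_ge v c x -> val_ge v d y -> val_ge v (c + d) (x * y).
Proof.
have [->|x0] := eqVneq x 0; first by rewrite mul0r => *; apply: val_ge0.
have [->|y0] := eqVneq y 0; first by rewrite mulr0 => *; apply: val_ge0.
by rewrite !val_geN0 ?mulf_neq0 // valM //; lra.
Qed.

Lemma val_gtM c d x y : val_gt v c x -> val_ge v d y -> val_gt v (c + d) (x * y).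
Proof.
move=> /val_gtP[e ce hx] hy; apply/val_gtP; exists (e + d); first by lra.
exact: val_geM.
Qed.

Lemma val_ge_sum (I : Type) (r : seq I) (P : pred I) (f : I -> K) c :
  (forall i, P i -> val_ge v c (f i)) -> val_ge v c (\sum_(i <- r | P i) f i).
Proof.
move=> h; elim/big_rec: _ => [|i x Pi hx]; first exact: val_ge0.
by apply: val_geD => //; apply: h.
Qed.

Lemma val_gt_sum (I : Type) (r : seq I) (P : pred I) (f : I -> K) c :
  (forall i, P i -> val_gt v c (f i)) -> val_gt v c (\sum_(i <- r | P i) f i).
Proof.
move=> h; elim/big_rec: _ => [|i x Pi hx]; first exact: val_gt0.
by apply: val_gtD => //; apply: h.
Qed.

Lemma val_ge_prod (I : Type) (r : seq I) (P : pred I) (f : I -> K) :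
  (forall i, P i -> val_ge v 0 (f i)) -> val_ge v 0 (\prod_(i <- r | P i) f i).
Proof.
move=> h; elim/big_rec: _ => [|i x Pi hx]; first by rewrite /val_ge val1 lexx orbT.
by rewrite -[0]addr0; apply: val_geM => //; apply: h.
Qed.

Lemma val_geX c x n : val_ge v c x -> val_ge v (n%:R * c) (x ^+ n).
Proof.
have [->|x0] := eqVneq x 0.
  move=> _; case: n => [|n]; last by rewrite expr0n val_ge0.
  by rewrite expr0 mul0r /val_ge val1 lexx orbT.
by rewrite !val_geN0 ?expf_neq0 // valX // => h; rewrite ler_wpM2l.
Qed.

Lemma val_ge_id x : val_ge v (v x) x.
Proof. by rewrite /val_ge lexx orbT. Qed.

Lemma valD_eq x y : x != 0 -> val_gt v (v x) y -> x + y != 0 /\ v (x + y) = v x.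
Proof.
move=> x0 hy.
have xy0 : x + y != 0.
  apply/eqP => /eqP; rewrite addr_eq0 => /eqP xy; move: hy.
  by rewrite xy /val_gt valN ltxx orbF -oppr_eq0 -xy (negPf x0).
split=> //; apply/eqP; rewrite eq_le; apply/andP; split; last first.
  rewrite -val_geN0 //; apply: val_geD; first exact: val_ge_id.
  exact: val_gt_ge.
rewrite leNgt; apply/negP => h.
have : val_gt v (v x) (x + y - y).
  by apply: val_gtB => //; rewrite val_gtN0.
by rewrite addrK val_gtN0 // ltxx.
Qed.

Lemma valD_eqr x y : x != 0 -> val_gt v (v x) (y - x) -> y != 0 /\ v y = v x.
Proof. by move=> x0 h; have := valD_eq x0 h; rewrite addrC subrK. Qed.

Lemma val_sum_eq (I : finType) (f : I -> K) i0 :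
  f i0 != 0 -> (forall i, i != i0 -> val_gt v (v (f i0)) (f i)) ->
  \sum_i f i != 0 /\ v (\sum_i f i) = v (f i0).
Proof.
move=> f0 h; rewrite (bigD1 i0) //=; apply: valD_eq => //.
exact: val_gt_sum.
Qed.

Lemma val_unit_eq x c : c != 0 -> v c = 0 -> val_gt v 0 (x - c) -> x != 0 /\ v x = 0.
Proof. by move=> c0 vc h; have := @valD_eqr c x c0; rewrite vc; apply. Qed.

Lemma val_small_eq0 x : (forall n : nat, val_ge v n%:R x) -> x = 0.
Proof.
move=> h; apply/eqP; apply: contraT => x0.
have := h (Num.truncn `|v x|).+1; rewrite val_geN0 //.
have := Num.Theory.truncnS_gt `|v x|; have := ler_norm (v x) => *; lra.
Qed.

End Valuation.
Arguments val_ge0 {K} v c.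
Arguments val_gt0 {K} v c.

Lemma valuation_comp (K L : fieldType) (v : L -> rat) (f : {rmorphism K -> L}) :
  valuation v -> valuation (v \o f).
Proof.
move=> hv; split=> [x y x0 y0|c x y] /=.
  by rewrite rmorphM valM ?fmorph_eq0.
have e z : val_ge (v \o f) c z = val_ge v c (f z) by rewrite /val_ge fmorph_eq0.
by rewrite !e rmorphD; apply: val_geD.
Qed.

(** * Extension of embeddings *)

Section MinimalPolynomial.
Variables (K L : fieldType) (i : {rmorphism K -> L}) (x : L).

(** [P] has least size among the nonzero polynomials over [K] that vanish at [x], and is separable
    as a divisor of [q0]. The last clause is irreducibility, in the form used to invert elements of
    K(x). *)
Lemma minimal_poly_exists (q0 : {poly K}) :
  separable_poly (map_poly i q0) -> root (map_poly i q0) x ->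
  exists P : {poly K}, [/\ separable_poly P, (1 < size P)%N,
    forall q, root (map_poly i q) x = (P %| q) &
    forall q, ~~ (P %| q) -> coprimep P q].
Proof.
rewrite separable_map => sq0 rq0.
pose A n := boolp.asbool (exists q : {poly K},
  [/\ q != 0, root (map_poly i q) x & size q = n]).
have exA : exists n, A n.
  exists (size q0); apply/boolp.asboolP; exists q0.
  by rewrite separable_poly_neq0.
case: (ex_minnP exA) => n /boolp.asboolP[P [P0 rP szP]] minP.
have rdv q : root (map_poly i q) x = (P %| q).
  apply/idP/idP => [rq|/dvdpP[h ->]]; last by rewrite rmorphM rootM rP orbT.
  rewrite /dvdp; apply/eqP/eqP; apply: contraT => r0.
  have /minP : A (size (q %% P)).
    apply/boolp.asboolP; exists (q %% P); split=> //.
    by move: rq; rewrite {1}(divp_eq q P) rmorphD rmorphM /root !hornerE (eqP rP) mulr0 add0r.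
  by rewrite -szP leqNgt ltn_modp P0.
have sP : separable_poly P by apply: dvdp_separable sq0; rewrite -rdv.
have szP1 : (1 < size P)%N.
  rewrite ltnNge; apply/negP => /size1_polyC PE; move: rP P0.
  by rewrite PE map_polyC rootC polyC_eq0 fmorph_eq0 => ->.
exists P; split=> // q nPq.
have [h Ph] := dvdpP _ _ (dvdp_gcdl P q).
have : root (map_poly i (h * gcdp P q)) x by rewrite -Ph rP.
rewrite rmorphM rootM !rdv => /orP[Pdh|Pdg]; last first.
  by rewrite (dvdp_trans Pdg (dvdp_gcdr P q)) in nPq.
rewrite /coprimep eqn_leq andbC; apply/andP; split.
  by rewrite lt0n size_poly_eq0 gcdp_eq0 (negPf P0).
have h0 : h != 0 by apply: contraNneq P0 => h0; rewrite Ph h0 mul0r.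
have g0 : gcdp P q != 0 by rewrite gcdp_eq0 (negPf P0).
have := dvdp_leq h0 Pdh; rewrite {1}Ph size_mul //.
by have := size_poly_gt0 h; rewrite h0; lia.
Qed.

End MinimalPolynomial.

(* A partial homomorphism between subfields of [L] is encoded by its graph. *)
Record partial_hom (L : fieldType) (A : L * L -> Prop) : Prop := PartialHom {
  phom1 : A (1, 1);
  phomB : forall x y x' y', A (x, y) -> A (x', y') -> A (x - x', y - y');
  phomM : forall x y x' y', A (x, y) -> A (x', y') -> A (x * x', y * y');
  phomV : forall x y, A (x, y) -> A (x^-1, y^-1);
  phom0 : forall y, A (0, y) -> y = 0 }.

Lemma eq_partial_hom (L : fieldType) (A B : L * L -> Prop) :
  (forall z, A z <-> B z) -> partial_hom A -> partial_hom B.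
Proof.
move=> e [h1 hB hM hV h0]; split; first exact/e.
- by move=> x y x' y' /e a /e b; apply/e; apply: hB.
- by move=> x y x' y' /e a /e b; apply/e; apply: hM.
- by move=> x y /e a; apply/e; apply: hV.
- by move=> y /e; apply: h0.
Qed.

Lemma phom_fun (L : fieldType) (A : L * L -> Prop) (hA : partial_hom A) x y y' :
  A (x, y) -> A (x, y') -> y = y'.
Proof.
move=> a a'; apply/eqP; rewrite -subr_eq0; apply/eqP; apply: (phom0 hA).
by rewrite -(subrr x); apply: phomB.
Qed.

(** Every relation satisfied by [x] is a multiple of [P], so it passes to [y]. Closure under
    inverses is Bezout: if u P + w q = c, then 1 / q(x) = w(x) / c, and likewise at [y]. *)
Lemma phom_adjoin (K L : fieldType) (i f : {rmorphism K -> L}) (P : {poly K})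
    (x y : L) :
  (forall q, root (map_poly i q) x = (P %| q)) ->
  (forall q, ~~ (P %| q) -> coprimep P q) ->
  root (map_poly f P) y ->
  partial_hom (fun z => exists q : {poly K},
    z = ((map_poly i q).[x], (map_poly f q).[y])).
Proof.
move=> rP cP rPy.
have z0 q : (map_poly i q).[x] = 0 -> (map_poly f q).[y] = 0.
  move=> /eqP; rewrite -/(root _ _) rP => /dvdpP[h ->].
  by rewrite rmorphM hornerM (eqP rPy) mulr0.
split.
- by exists 1; rewrite !rmorph1 !hornerC.
- move=> a b a' b' [q [-> ->]] [q' [-> ->]]; exists (q - q').
  by rewrite !rmorphB !hornerE.
- move=> a b a' b' [q [-> ->]] [q' [-> ->]]; exists (q * q').
  by rewrite !rmorphM !hornerE.
- move=> a b [q [-> ->]]; have [q0|nPq] := boolP (P %| q).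
    have q1 : (map_poly i q).[x] = 0 by apply/eqP; rewrite -/(root _ _) rP.
    by exists 0; rewrite q1 (z0 _ q1) !invr0 !rmorph0 !horner0.
  have /Bezout_coprimepP[[u w] /=] := cP _ nPq.
  rewrite -size_poly_eq1 => /size_poly1P[c c0 uwc].
  have rPx : root (map_poly i P) x by rewrite rP dvdpp.
  have e1 : (map_poly i w).[x] * (map_poly i q).[x] = i c.
    have := congr1 (fun g => (map_poly i g).[x]) uwc.
    by rewrite rmorphD !rmorphM !hornerE (eqP rPx) mulr0 add0r map_polyC hornerC.
  have e2 : (map_poly f w).[y] * (map_poly f q).[y] = f c.
    have := congr1 (fun g => (map_poly f g).[y]) uwc.
    by rewrite rmorphD !rmorphM !hornerE (eqP rPy) mulr0 add0r map_polyC hornerC.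
  exists (c^-1 *: w); rewrite !map_polyZ !hornerZ !fmorphV -e1 -e2.
  have n1 : (map_poly i q).[x] != 0 by rewrite -/(root _ _) rP.
  have n2 : (map_poly f w).[y] * (map_poly f q).[y] != 0 by rewrite e2 fmorph_eq0.
  have n3 : (map_poly i w).[x] * (map_poly i q).[x] != 0 by rewrite e1 fmorph_eq0.
  move: n2 n3; rewrite !mulf_eq0 !negb_or => /andP[? ?] /andP[? ?].
  by congr (_, _); field; apply/andP.
- by move=> b [q [/esym e ->]]; apply: z0.
Qed.

Lemma phom_dom_subfield (L : fieldType) (A : L * L -> Prop) :
  partial_hom A -> is_subfield (fun x => exists y, A (x, y)).
Proof.
move=> hA; split; first by exists 1; apply: phom1.
- by move=> x x' [y a] [y' a']; exists (y - y'); apply: phomB.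
- by move=> x x' [y a] [y' a']; exists (y * y'); apply: phomM.
- by move=> x [y a]; exists y^-1; apply: phomV.
Qed.

Lemma phom_domain (L : fieldType) (A : L * L -> Prop) : partial_hom A ->
  exists (K : fieldType) (i f : {rmorphism K -> L}),
    forall x y, A (x, y) <-> exists2 a, x = i a & y = f a.
Proof.
move=> hA; have [K [i hi]] := subfield_type (phom_dom_subfield hA).
have /boolp.choice[f hf] : forall a, exists y, A (i a, y).
  by move=> a; apply/hi; exists a.
have [g gf] : exists g : {rmorphism K -> L}, g =1 f.
  apply: exists_rmorphism => [|a b|a b]; apply: (phom_fun hA (hf _)).
  - by rewrite rmorph1; apply: phom1.
  - by rewrite rmorphB; apply: phomB.
  - by rewrite rmorphM; apply: phomM.
exists K, i, g => x y; split=> [a|[a -> ->]]; last by rewrite gf.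
have [b bx] := (hi x).1 (ex_intro _ y a).
by exists b; rewrite // gf; apply: (phom_fun hA a); rewrite -bx.
Qed.

Section Extension.
Variables (p : nat) (Om : fieldType) (t : Om).
Hypothesis hOm : is_sepclosure_Fpt p t.

Lemma eval_at_map (K : fieldType) (i : {rmorphism K -> Om}) (u : K) f :
  eval_at (i u) f = map_poly i (map_poly (fun c : {poly int} => (map_poly intr c).[u]) f).
Proof.
rewrite /eval_at; apply/polyP => j; rewrite coef_map !coef_map_id0 ?rmorph0 ?horner0 //.
rewrite -[RHS](horner_map i) -map_poly_comp; congr (_.[_]).
by apply: eq_map_poly => z /=; rewrite rmorph_int.
Qed.

(* Embeddings extend because [Om] is separable over F_p(t) and separably
   closed. *)
Lemma phom_extend (A : Om * Om -> Prop) t' :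
  partial_hom A -> A (t, t') ->
  exists s : {rmorphism Om -> Om}, forall x y, A (x, y) -> s x = y.
Proof.
move=> hA At.
(* [A] is joined to each [B], so that the union of the empty chain is admissible too. *)
pose PA (B : classical_sets.set (Om * Om)) := partial_hom (fun z => B z \/ A z).
have [|B [hB maxB]] := @classical_sets.Zorn_bigcup _ PA.
  move=> F FP Ftot.
  have two z1 z2 : (classical_sets.bigcup F id z1 \/ A z1) ->
      (classical_sets.bigcup F id z2 \/ A z2) ->
      exists2 X, partial_hom (fun z => X z \/ A z) /\
        (forall z, X z -> classical_sets.bigcup F id z \/ A z) &
        (X z1 \/ A z1) /\ (X z2 \/ A z2).
    have FX X : F X -> forall z, X z -> classical_sets.bigcup F id z \/ A z.
      by move=> FX z Xz; left; exists X.
    move=> [[X FX1 X1]|a1] [[Y FY Y2]|a2].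
    - case: (Ftot _ _ FX1 FY) => sub.
        by exists Y; split; [exact: FP|exact: FX|left; apply: sub|left].
      by exists X; split; [exact: FP|exact: FX|left|left; apply: sub].
    - by exists X; split; [exact: FP|exact: FX|left|right].
    - by exists Y; split; [exact: FP|exact: FX|right|left].
    exists A; split; [|by right|by right|by right].
    by apply: eq_partial_hom hA => z; split; [right|case].
  have back X (h : forall z, X z -> classical_sets.bigcup F id z \/ A z) z :
    X z \/ A z -> classical_sets.bigcup F id z \/ A z by case=> [/h|]; [|right].
  split; first by right; apply: phom1.
  - by move=> x y x' y' a /(two _ _ a)[X [hX /back h] [X1 X2]]; apply/h/(phomB hX).
  - by move=> x y x' y' a /(two _ _ a)[X [hX /back h] [X1 X2]]; apply/h/(phomM hX).
  - by move=> x y a; have [X [hX /back h] [X1 _]] := two _ _ a a; apply/h/(phomV hX).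
  - by move=> y a; have [X [hX _] [X1 _]] := two _ _ a a; apply: (phom0 hX).
have [K [i [f Kif]]] := phom_domain hB.
(* Maximality forces the domain to be everything: a missing [x] is sent to a root of its minimal
   polynomial transported by [f], which is still separable. *)
have total x : exists a, i a = x.
  apply: boolp.contrapT => nx.
  have [u tu tu'] := (Kif t t').1 (or_intror At).
  have [g [sg rg]] := Om_separable hOm x.
  move: sg rg; rewrite tu eval_at_map => sg rg.
  have [P [sP szP rP cP]] := minimal_poly_exists sg rg.
  have [y ry] : exists y, root (map_poly f P) y.
    by apply: (Om_closed hOm); rewrite ?separable_map ?size_map_poly.
  have hB' := phom_adjoin rP cP ry.
  set B' := (fun z => exists q, _) in hB'.
  have BB' z : B z \/ A z -> B' z.
    case: z => a b /Kif[c -> ->]; exists c%:P.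
    by rewrite !map_polyC !hornerC.
  apply: (maxB B'); last first.
    by apply: eq_partial_hom hB' => z; split; [left|case=> // Az; apply: BB'; right].
  split; first by move=> z Bz; apply: BB'; left.
  move=> sub; apply: nx.
  have /Kif[a -> _] : B (x, y) \/ A (x, y).
    by left; apply: sub; exists 'X; rewrite !map_polyX !hornerX.
  by exists a.
have /boolp.choice[h hh] := total.
have hi : cancel i h by move=> a; apply: (fmorph_inj i); rewrite hh.
have [s sE] : exists s : {rmorphism Om -> Om}, s =1 f \o h.
  apply: exists_rmorphism => [|x y|x y] /=.
  - by rewrite -[X in h X](rmorph1 i) hi rmorph1.
  - by rewrite -rmorphB; congr (f _); apply: (fmorph_inj i); rewrite rmorphB !hh.
  - by rewrite -rmorphM; congr (f _); apply: (fmorph_inj i); rewrite rmorphM !hh.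
exists s => x y Axy; have [a -> ->] := (Kif x y).1 (or_intror Axy).
by rewrite sE /= hi.
Qed.

End Extension.

(** * Finite enumerations and polynomials over a subfield *)

Lemma finite_enum (T : eqType) (A : T -> Prop) (N : nat) :
  (forall s : seq T, uniq s -> (forall x, x \in s -> A x) -> (size s <= N)%N) ->
  exists2 o : seq T, uniq o & forall x, x \in o <-> A x.
Proof.
move=> bnd; pose Q n := boolp.asbool (exists s : seq T,
  [/\ uniq s, forall x, x \in s -> A x & size s = n]).
have Q0 : exists n, Q n by exists 0%N; apply/boolp.asboolP; exists [::].
have QN n : Q n -> (n <= N)%N by move=> /boolp.asboolP[s [us sA <-]]; apply: bnd.
case: (ex_maxnP Q0 QN) => n /boolp.asboolP[s [us sA sn]] maxn.
exists s => // x; split=> [/sA//|Ax]; apply: contraT => xs.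
have /maxn : Q n.+1.
  apply/boolp.asboolP; exists (x :: s); split; rewrite /= ?xs ?sn //.
  by move=> y; rewrite inE => /orP[/eqP->|/sA].
by rewrite ltnn.
Qed.

Lemma roots_enum (L : fieldType) (f : {poly L}) : f != 0 ->
  exists2 o : seq L, uniq o & forall x, x \in o <-> root f x.
Proof.
move=> f0; apply: (@finite_enum _ (root f) (size f)) => s us rs.
by apply/ltnW/max_poly_roots => //; apply/allP.
Qed.

Lemma poly_lift (K L : fieldType) (i : {rmorphism K -> L}) (f : {poly L}) :
  (forall j, exists a, i a = f`_j) -> exists g, map_poly i g = f.
Proof.
move=> /boolp.choice[h hh]; exists (\poly_(j < size f) h j).
apply/polyP => j; rewrite coef_map coef_poly.
by case: ltnP => le; [apply: hh|rewrite raddf0 nth_default].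
Qed.

Section SubfieldClosure.
Variables (L : fieldType) (S : L -> Prop) (hS : is_subfield S).

Lemma subfield0 : S 0.
Proof. by rewrite -(subrr 1); apply: subfieldB => //; apply: subfield1. Qed.
Lemma subfieldN x : S x -> S (- x).
Proof. by move=> Sx; rewrite -sub0r; apply: subfieldB => //; apply: subfield0. Qed.
Lemma subfieldD x y : S x -> S y -> S (x + y).
Proof. by move=> Sx Sy; rewrite -[y]opprK; apply: subfieldB => //; apply: subfieldN. Qed.
Lemma subfield_div x y : S x -> S y -> S (x / y).
Proof. by move=> Sx Sy; apply: subfieldM => //; apply: subfieldV. Qed.
Lemma subfieldX x n : S x -> S (x ^+ n).
Proof.
move=> Sx; elim: n => [|n IH]; first by rewrite expr0; apply: subfield1.
by rewrite exprS; apply: subfieldM.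
Qed.
Lemma subfield_sum (I : Type) (r : seq I) (P : pred I) f :
  (forall i, P i -> S (f i)) -> S (\sum_(i <- r | P i) f i).
Proof.
move=> h; elim/big_rec: _ => [|i x Pi Sx]; first exact: subfield0.
by apply: subfieldD => //; apply: h.
Qed.
Lemma subfield_nat n : S n%:R.
Proof.
elim: n => [|n IH]; first exact: subfield0.
by rewrite -natr1; apply: subfieldD => //; apply: subfield1.
Qed.

Definition poly_over (f : {poly L}) : Prop := forall i, S f`_i.

Lemma poly_overC c : S c -> poly_over c%:P.
Proof. by move=> Sc i; rewrite coefC; case: eqP => // _; apply: subfield0. Qed.
Lemma poly_over0 : poly_over 0.
Proof. by move=> i; rewrite coef0; apply: subfield0. Qed.
Lemma poly_overX : poly_over 'X.
Proof.
by move=> i; rewrite coefX; case: eqP => _; [apply: subfield1|apply: subfield0].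
Qed.
Lemma poly_overD f g : poly_over f -> poly_over g -> poly_over (f + g).
Proof. by move=> hf hg i; rewrite coefD; apply: subfieldD. Qed.
Lemma poly_overB f g : poly_over f -> poly_over g -> poly_over (f - g).
Proof. by move=> hf hg i; rewrite coefB; apply: subfieldB. Qed.
Lemma poly_overM f g : poly_over f -> poly_over g -> poly_over (f * g).
Proof.
by move=> hf hg i; rewrite coefM; apply: subfield_sum => j _; apply: subfieldM.
Qed.
Lemma poly_over1 : poly_over 1.
Proof. by apply: poly_overC; apply: subfield1. Qed.
Lemma poly_overXn f n : poly_over f -> poly_over (f ^+ n).
Proof.
move=> hf; elim: n => [|n IH]; first by rewrite expr0; apply: poly_over1.
by rewrite exprS; apply: poly_overM.
Qed.
Lemma poly_over_poly n f : (forall i, (i < n)%N -> S (f i)) ->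
  poly_over (\poly_(i < n) f i).
Proof. by move=> h i; rewrite coef_poly; case: ifP => [/h//|_]; apply: subfield0. Qed.
Lemma poly_over_deriv f : poly_over f -> poly_over f^`().
Proof.
by move=> hf i; rewrite coef_deriv -mulr_natl; apply: subfieldM => //; apply: subfield_nat.
Qed.
Lemma poly_over_comp f g : poly_over f -> poly_over g -> poly_over (f \Po g).
Proof.
move=> hf hg; rewrite comp_polyE => i; rewrite coef_sum.
by apply: subfield_sum => j _; rewrite coefZ; apply: subfieldM => //; apply: poly_overXn.
Qed.
Lemma subfield_horner f x : poly_over f -> S x -> S f.[x].
Proof.
move=> hf Sx; rewrite horner_coef; apply: subfield_sum => i _.
by apply: subfieldM => //; apply: subfieldX.
Qed.

End SubfieldClosure.

Lemma coprime_pred_pexp p f : prime p -> (0 < f)%N -> coprime p (p ^ f).-1.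
Proof.
move=> hp f0; have pq : (p %| p ^ f)%N by rewrite dvdn_exp.
apply: coprime_dvdl pq _; rewrite coprime_sym coprimePn //.
by rewrite expn_gt0 prime_gt0.
Qed.

(** * Finite fields and the algebraic closure of F_p *)

Section FiniteFields.
Variables (p : nat) (L : fieldType).
Hypothesis hp : prime p.
Hypothesis hL : p \in [pchar L].

Lemma FrobD f (x y : L) : (x + y) ^+ (p ^ f) = x ^+ (p ^ f) + y ^+ (p ^ f).
Proof. by apply: exprDn_pchar; rewrite (eq_pnat _ (pcharf_eq hL)) pnatX pnat_id. Qed.

Lemma FrobN f (x : L) : (- x) ^+ (p ^ f) = - x ^+ (p ^ f).
Proof. by apply/eqP; rewrite -subr_eq0 opprK -FrobD addNr expr0n expn_eq0 eqn0Ngt prime_gt0. Qed.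

Lemma FrobB f (x y : L) : (x - y) ^+ (p ^ f) = x ^+ (p ^ f) - y ^+ (p ^ f).
Proof. by rewrite FrobD FrobN. Qed.

Lemma Frob_inj f (x y : L) : x ^+ (p ^ f) = y ^+ (p ^ f) -> x = y.
Proof.
move=> /eqP; rewrite -subr_eq0 -FrobB expf_eq0 => /andP[_].
by rewrite subr_eq0 => /eqP.
Qed.

Lemma Frob1_inj (x y : L) : x ^+ p = y ^+ p -> x = y.
Proof. by have := @Frob_inj 1 x y; rewrite expn1. Qed.

Lemma Fq_subfield f : is_subfield (@Fq p f L).
Proof.
split; rewrite /Fq; first by rewrite expr1n.
- by move=> x y hx hy; rewrite FrobB hx hy.
- by move=> x y hx hy; rewrite exprMn hx hy.
- by move=> x hx; rewrite exprVn hx.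
Qed.

Lemma FqM f g (x : L) : Fq p f x -> Fq p (f * g) x.
Proof.
rewrite /Fq => hx; elim: g => [|g IH]; first by rewrite muln0 expr1.
by rewrite mulnS expnD exprM hx.
Qed.

Lemma Fpbar_common (l : seq L) : (forall x, x \in l -> Fpbar p x) ->
  exists2 f, (0 < f)%N & forall x, x \in l -> Fq p f x.
Proof.
elim: l => [|y l IH] h; first by exists 1%N.
have [|f f0 hf] := IH; first by move=> x xl; apply: h; rewrite inE xl orbT.
have [g g0 hg] := h y (mem_head _ _).
exists (f * g)%N; first by rewrite muln_gt0 f0.
move=> x; rewrite inE => /orP[/eqP->|/hf hx]; last exact: FqM.
by rewrite mulnC; apply: FqM.
Qed.

Lemma Fpbar_subfield : is_subfield (@Fpbar p L).
Proof.
have two (x y : L) : Fpbar p x -> Fpbar p y ->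
    exists2 f, (0 < f)%N & Fq p f x /\ Fq p f y.
  move=> hx hy; have [|f f0 h] := @Fpbar_common [:: x; y].
    by move=> z; rewrite !inE => /orP[]/eqP->.
  by exists f => //; split; apply: h; rewrite !inE eqxx ?orbT.
split; first by exists 1%N => //; apply: subfield1 (Fq_subfield 1).
- by move=> x y hx /(two _ _ hx)[f f0 [h1 h2]]; exists f => //; apply: (subfieldB (Fq_subfield f)).
- by move=> x y hx /(two _ _ hx)[f f0 [h1 h2]]; exists f => //; apply: (subfieldM (Fq_subfield f)).
- by move=> x [f f0 h]; exists f => //; apply: (subfieldV (Fq_subfield f)).
Qed.

Lemma Fpbar_root (x : L) : Fpbar p x -> exists2 y, Fpbar p y & y ^+ p = x.
Proof.
move=> [[//|f] f0 hx]; exists (x ^+ (p ^ f)).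
  by apply: (subfieldX Fpbar_subfield); exists f.+1.
by rewrite -exprM -expnSr.
Qed.

(** By Euler's theorem [M] divides p^phi(M) - 1. *)
Lemma Fpbar_unity (x : L) M : coprime p M -> (0 < M)%N -> x ^+ M = 1 -> Fpbar p x.
Proof.
move=> cpM M0 xM; exists (totient M); first by rewrite totient_gt0.
have := cyclic.Euler_exp_totient cpM => /eqP; rewrite /Fq => e.
have p0 : (0 < p ^ totient M)%N by rewrite expn_gt0 prime_gt0.
have : (M %| p ^ totient M - 1)%N by rewrite -eqn_mod_dvd.
case/dvdnP => c ec; rewrite -(subnK p0) ec exprD expr1 mulnC exprM xM expr1n mul1r.
by [].
Qed.

(* Pigeonhole: the powers of ['X] modulo [f] take finitely many values. *)
Lemma powers_congr_poly (f : {poly L}) : f != 0 -> poly_over (@Fpbar p L) f ->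
  exists i j g, [/\ (i < j)%N, poly_over (@Fpbar p L) g & 'X^j - 'X^i = g * f].
Proof.
move=> f0 hf.
have [|e e0 he] := @Fpbar_common f.
  by move=> c /(nthP 0)[j _ <-]; apply: hf.
have [K [i iK]] := subfield_type (Fq_subfield e).
have iFp c : Fpbar p (i c) by exists e => //; apply/iK; exists c.
have [|f' ff'] := @poly_lift _ _ i f.
  move=> j; apply/iK; have [lt|ge] := ltnP j (size f).
    by apply: he; rewrite mem_nth.
  by rewrite nth_default //; apply: (subfield0 (Fq_subfield e)).
have f'0 : f' != 0 by apply: contraNneq f0 => h; rewrite -ff' h rmorph0.
have [o uo oP] : exists2 o : seq L, uniq o & forall x, x \in o <-> Fq p e x.
  have q1 : (1 < p ^ e)%N by rewrite -(exp1n e) ltn_exp2r ?prime_gt1.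
  have n0 : ('X^(p ^ e) - 'X : {poly L}) != 0.
    apply: contraTneq q1 => h0; rewrite -leqNgt.
    have := congr1 (fun g : {poly L} => g`_(p ^ e)) h0.
    rewrite coefB coefXn eqxx coefX coef0; case: eqP => [->//|_].
    by rewrite subr0 => /eqP; rewrite oner_eq0.
  have [o uo oP] := roots_enum n0; exists o => // y.
  rewrite oP /root !hornerE subr_eq0 /Fq; split=> [/eqP//|->//].
pose d := size f'; pose R m := 'X^m %% f'.
(* A remainder modulo [f'] is coded by the positions of its coefficients in the list [o] of the
   elements of the field with p^e elements; [inord] alters none of these positions. *)
pose code m := [ffun j : 'I_d => inord (index (i (R m)`_j) o) : 'I_(size o).+1].
pose N := #|{ffun 'I_d -> 'I_(size o).+1}|.
have : ~~ injectiveb (fun m : 'I_N.+1 => code m).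
  by apply/injectiveP => /leq_card; rewrite card_ord ltnn.
case/injectivePn => a [b neq ecode].
have eR : R a = R b.
  apply/polyP => j; have [lt|ge] := ltnP j d; last first.
    by rewrite !nth_default // (leq_trans _ ge) // ltnW // ltn_modp.
  have := congr1 (fun c : {ffun 'I_d -> 'I_(size o).+1} => val (c (Ordinal lt))) ecode.
  have io c : i c \in o by apply/oP/iK; exists c.
  rewrite !ffunE /= !inordK ?ltnS ?index_size // => h.
  by apply: (fmorph_inj i); rewrite -(nth_index 0 (io (R a)`_j)) h nth_index.
wlog lt : a b neq eR {ecode} / (a < b)%N.
  move=> w; case: (ltngtP a b) => [lt|lt|/val_inj e']; first exact: (w a b).
    by apply: (w b a) => //; rewrite eq_sym.
  by rewrite e' eqxx in neq.
exists a, b, (map_poly i ('X^b %/ f' - 'X^a %/ f')); split=> //.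
  by move=> j; rewrite coef_map; apply: iFp.
rewrite -ff' -rmorphM mulrBl.
have e' m : 'X^m %/ f' * f' = 'X^m - R m by rewrite {2}(divp_eq 'X^m f') addrK.
by rewrite !e' eR opprB addrA subrK rmorphB /= !map_polyXn.
Qed.

(** [Z] is meant to be {0} or the maximal ideal of a valuation. An algebraic relation over Fpbar
    modulo [Z] makes two powers of [x] congruent, so that [x] becomes zero or a root of unity. *)
Lemma powers_congr (Z : L -> Prop) (f : {poly L}) (x : L) :
  f != 0 -> poly_over (@Fpbar p L) f ->
  (forall g, poly_over (@Fpbar p L) g -> Z (g.[x] * f.[x])) ->
  exists i j, (i < j)%N /\ Z (x ^+ j - x ^+ i).
Proof.
move=> f0 hf hZ; have [i [j [g [lt kg e]]]] := powers_congr_poly f0 hf.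
exists i, j; split=> //.
have -> : x ^+ j - x ^+ i = g.[x] * f.[x] by rewrite -hornerM -e !hornerE.
exact: hZ.
Qed.

End FiniteFields.

(** * The Galois group of Fpbar(t) *)

Section GaloisGroup.
Variables (p : nat) (Om : fieldType) (t : Om).
Hypothesis hp : prime p.
Hypothesis hOm : is_sepclosure_Fpt p t.

Local Notation k := (@Fpbar p Om).
Local Notation Gal := (Defs.gal t k).

Let ksub : is_subfield k := Fpbar_subfield hp (Om_pchar hOm).

(** The axiom excludes only relations with coefficients in F_p; a relation over Fpbar is first
    replaced by one of the form t^j = t^i. *)
Lemma Fpbar_transcendental f : poly_over k f -> f.[t] = 0 -> f = 0.
Proof.
move=> kf f0; apply/eqP; apply: contraT => fn0.
have [g _|i [j [lt e]]] := powers_congr (Z := fun z => z = 0) hp (Om_pchar hOm) fn0 kf (x := t).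
  by rewrite f0 mulr0.
have := Om_transc hOm (c := 'X^j - 'X^i).
rewrite rmorphB /= !map_polyXn /root !hornerE => /(_ (introT eqP e)).
move/(congr1 (fun g : {poly Om} => g`_j)).
rewrite coefB !coefXn eqxx coef0 [(j == i)%N]gtn_eqF // subr0 => /eqP.
by rewrite oner_eq0.
Qed.

Lemma separable_poly_of x : exists f : {poly Om}, [/\ separable_poly f, root f x,
  forall s, Gal s -> map_poly s f = f &
  exists g, f = eval_at t g].
Proof.
have [g [sg rg]] := Om_separable hOm x.
exists (eval_at t g); split=> //; last by exists g.
move=> s [st _]; rewrite -[in RHS]st (eval_at_map s t).
by rewrite /eval_at.
Qed.

Lemma gal_id : Gal idfun. Proof. by split. Qed.

Lemma gal_comp s1 s2 : Gal s1 -> Gal s2 -> Gal (s1 \o s2).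
Proof.
by move=> [t1 k1] [t2 k2]; split=> [|x kx] /=; rewrite ?t2 ?t1 ?k2 ?k1.
Qed.

Lemma gal_conj_enum x : exists o : seq Om, forall s, Gal s -> s x \in o.
Proof.
have [f [sf rf fs _]] := separable_poly_of x.
have [o _ oP] := roots_enum (separable_poly_neq0 sf).
by exists o => s Gs; apply/oP; rewrite -(fs s Gs) fmorph_root.
Qed.

(** Surjectivity holds because [s] is injective and permutes the finitely many roots of a separable
    polynomial over F_p(t). *)
Lemma gal_inv s : Gal s -> exists s', [/\ Gal s', cancel s s' & cancel s' s].
Proof.
move=> Gs; have surj y : exists x, s x = y.
  have [f [sf rf fs _]] := separable_poly_of y.
  have [o uo oP] := roots_enum (separable_poly_neq0 sf).
  have sub : {subset map s o <= o}.
    by move=> z /mapP[x /oP rx ->]; apply/oP; rewrite -(fs s Gs) fmorph_root.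
  have us : uniq (map s o) by rewrite map_inj_uniq //; apply: fmorph_inj.
  have [_ eo] := uniq_min_size us sub (eq_leq (esym (size_map s o))).
  have : y \in map s o by rewrite eo; apply/oP.
  by case/mapP => x _ ->; exists x.
have [h hh] := boolp.choice surj.
have hK : cancel s h by move=> x; apply: (fmorph_inj s); rewrite hh.
have [s' s'E] : exists s' : {rmorphism Om -> Om}, s' =1 h.
  apply: exists_rmorphism => [|x y|x y]; apply: (fmorph_inj s).
  - by rewrite hh rmorph1.
  - by rewrite rmorphB !hh.
  - by rewrite rmorphM !hh.
case: Gs => [st sk].
exists s'; split=> [|x|x]; rewrite ?s'E ?hh ?hK //.
by split=> [|x kx]; rewrite s'E; [rewrite -{1}st hK|rewrite -{1}(sk x kx) hK].
Qed.

Record subgroup (P : {rmorphism Om -> Om} -> Prop) : Prop := Subgroup {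
  subgroup_gal : forall s, P s -> Gal s;
  subgroup_id : P idfun;
  subgroup_comp : forall s1 s2, P s1 -> P s2 -> P (s1 \o s2);
  subgroup_inv : forall s, P s -> exists s', [/\ P s', cancel s s' & cancel s' s] }.

Lemma subgroup_Gal : subgroup Gal.
Proof.
by split; [|apply: gal_id|apply: gal_comp|apply: gal_inv].
Qed.

Lemma subgroup_fix P (xs : seq Om) : subgroup P ->
  subgroup (fun s => P s /\ {in xs, forall x, s x = x}).
Proof.
move=> hP; split=> [s [/(subgroup_gal hP)]//||s1 s2 [P1 f1] [P2 f2]|s [Ps fs]].
- by split=> //; apply: subgroup_id.
- by split; [apply: subgroup_comp|move=> x xl /=; rewrite f2 // f1].
have [s' [Ps' ss' s's]] := subgroup_inv hP Ps.
by exists s'; split=> //; split=> // x xl; rewrite -{1}(fs x xl) ss'.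
Qed.

Section Orbits.
Variables (P : {rmorphism Om -> Om} -> Prop) (hP : subgroup P).

Lemma orbit_exists x : exists o : seq Om,
  uniq o /\ forall y, y \in o <-> exists2 s, P s & s x = y.
Proof.
have [l hl] := gal_conj_enum x.
have [|o uo oP] := @finite_enum _ (fun y => exists2 s, P s & s x = y) (size l).
  move=> o uo oP; apply: uniq_leq_size => // y /oP[s Ps <-].
  exact/hl/(subgroup_gal hP).
by exists o.
Qed.

Lemma orbit_map o x s : uniq o -> (forall y, y \in o <-> exists2 s, P s & s x = y) ->
  P s -> perm_eq (map s o) o.
Proof.
move=> uo oP Ps; have us : uniq (map s o) by rewrite map_inj_uniq //; apply: fmorph_inj.
have sub : {subset map s o <= o}.
  move=> z /mapP[y /oP[s' Ps' <-] ->]; apply/oP.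
  by exists (s \o s') => //; apply: subgroup_comp.
have [_ eo] := uniq_min_size us sub (eq_leq (esym (size_map s o))).
exact: uniq_perm.
Qed.

End Orbits.

(** Total in [P], so that no proof that [P] is a subgroup enters the term; the default [[::]] is not
    reached for subgroups. *)
Definition orb (P : {rmorphism Om -> Om} -> Prop) (x : Om) : seq Om :=
  if boolp.pselect (exists o : seq Om,
    uniq o /\ forall y, y \in o <-> exists2 s, P s & s x = y) is left h
  then sval (boolp.cid h) else [::].

Section OrbitPolynomials.
Variables (P : {rmorphism Om -> Om} -> Prop) (hP : subgroup P).

Lemma orb_spec x : uniq (orb P x) /\
  forall y, y \in orb P x <-> exists2 s, P s & s x = y.
Proof.
rewrite /orb; case: boolp.pselect => [h|]; first exact: svalP (boolp.cid h).
by case; apply: orbit_exists.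
Qed.

Lemma orb_uniq x : uniq (orb P x). Proof. exact: (orb_spec x).1. Qed.

Lemma orbP x y : y \in orb P x <-> exists2 s, P s & s x = y.
Proof. exact: (orb_spec x).2. Qed.

Lemma orb_id x : x \in orb P x.
Proof. by apply/orbP; exists idfun => //; apply: subgroup_id. Qed.

Lemma orb_perm x s : P s -> perm_eq (map s (orb P x)) (orb P x).
Proof.
move=> Ps; have := orbit_map hP (orb_uniq x) (orbP x) Ps.
exact.
Qed.

Lemma orb_poly_fixed x s : P s ->
  map_poly s (\prod_(y <- orb P x) ('X - y%:P)) = \prod_(y <- orb P x) ('X - y%:P).
Proof.
move=> Ps; rewrite rmorph_prod /=.
rewrite -[RHS](perm_big _ (orb_perm x Ps)) /= big_map; apply: eq_bigr => y _.
by rewrite rmorphB /= map_polyX map_polyC.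
Qed.

Lemma orb_sum_fixed x s : P s -> s (\sum_(y <- orb P x) y) = \sum_(y <- orb P x) y.
Proof.
by move=> Ps; rewrite rmorph_sum -[RHS](perm_big _ (orb_perm x Ps)) /= big_map.
Qed.

Lemma orb_prod_fixed (f : Om -> Om) (x : Om) (s : {rmorphism Om -> Om}) : (forall y, s (f y) = f (s y)) -> P s ->
  s (\prod_(y <- orb P x) f y) = \prod_(y <- orb P x) f y.
Proof.
move=> sf Ps; rewrite rmorph_prod -[RHS](perm_big _ (orb_perm x Ps)) /= big_map.
by apply: eq_bigr => y _; rewrite sf.
Qed.

Lemma stable_closure (ys : seq Om) : exists zs : seq Om, {subset ys <= zs} /\
  forall s, P s -> {in zs, forall z, s z \in zs}.
Proof.
exists (flatten [seq orb P y | y <- ys]); split=> [y yl|s Ps z].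
  by apply/flatten_mapP; exists y => //; apply: orb_id.
move=> /flatten_mapP[y yl /orbP[s' Ps' <-]].
apply/flatten_mapP; exists y => //; apply/orbP; exists (s \o s') => //.
exact: subgroup_comp.
Qed.

End OrbitPolynomials.

Definition ratfun x := exists A B : {poly Om},
  [/\ poly_over k A, poly_over k B, B.[t] != 0 & x = A.[t] / B.[t]].

Lemma ratfun_poly A : poly_over k A -> ratfun A.[t].
Proof.
move=> kA; exists A, 1; split=> //; first exact: poly_over1.
  by rewrite hornerC oner_neq0.
by rewrite hornerC divr1.
Qed.

Lemma ratfunC c : k c -> ratfun c.
Proof. by move=> kc; rewrite -(hornerC c t); apply: ratfun_poly; apply: poly_overC. Qed.

Lemma ratfunt : ratfun t.
Proof. by rewrite -{1}(hornerX t); apply: ratfun_poly; apply: poly_overX. Qed.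

Lemma ratfun_subfield : is_subfield ratfun.
Proof.
split; first by apply: ratfunC; apply: subfield1.
- move=> x y [A [B [kA kB nB ->]]] [C [D [kC kD nD ->]]].
  exists (A * D - C * B), (B * D); split.
  + by apply: poly_overB => //; apply: poly_overM.
  + exact: poly_overM.
  + by rewrite hornerM mulf_neq0.
  + by rewrite !hornerE /=; field; apply/andP.
- move=> x y [A [B [kA kB nB ->]]] [C [D [kC kD nD ->]]].
  exists (A * C), (B * D); split; try exact: poly_overM.
  + by rewrite hornerM mulf_neq0.
  + by rewrite !hornerM; field; apply/andP.
move=> x [A [B [kA kB nB ->]]]; have [A0|nA] := eqVneq A.[t] 0.
  by rewrite A0 mul0r invr0; apply: ratfunC; apply: subfield0.
by exists B, A; split=> //; rewrite invf_div.
Qed.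

Lemma gal_ratfun s x : Gal s -> ratfun x -> s x = x.
Proof.
move=> [st sk] [A [B [kA kB nB ->]]].
have e C : poly_over k C -> s C.[t] = C.[t].
  move=> kC; rewrite -[LHS](horner_map s) st; congr (_.[t]).
  by apply/polyP => i; rewrite coef_map /= sk.
by rewrite fmorph_div !e.
Qed.

(** If [x] is not in Fpbar(t), its minimal polynomial has degree at least 2 and, being separable, a
    root [y] other than [x]; the embedding that maps [x] to [y] extends to an element of the Galois
    group. *)
Lemma ratfun_fixed x : (forall s, Gal s -> s x = x) -> ratfun x.
Proof.
move=> fx; apply: boolp.contrapT => nx.
have [K [i iK]] := subfield_type ratfun_subfield.
have [u iu] := (iK t).1 ratfunt.
have [g [sg rg]] := Om_separable hOm x.
move: sg rg; rewrite -iu eval_at_map => sg rg.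
have [P [sP szP rP cP]] := minimal_poly_exists sg rg.
have rPx : root (map_poly i P) x by rewrite rP dvdpp.
have [Q PQ] := factor_theorem _ _ rPx.
have Q0 : Q != 0.
  by apply: contraTneq (separable_poly_neq0 sP) => Q0; rewrite -(map_poly_eq0 i) PQ Q0 mul0r eqxx.
have szPQ : size P = (size Q).+1.
  by rewrite -(size_map_poly i) PQ size_mul ?polyXsubC_eq0 // size_XsubC addn2.
have szQ : (1 < size Q)%N.
  rewrite ltnNge; apply/negP => szQ; apply: nx; apply/iK.
  have /eqP sz2 : size P = 2%N.
    by have := size_poly_gt0 Q; rewrite Q0; move: szP; rewrite szPQ; lia.
  have P1 : P`_1 != 0.
    have := lead_coef_eq0 P; rewrite /lead_coef (eqP sz2) /= => ->.
    exact: separable_poly_neq0.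
  exists (- P`_0 / P`_1); move: rPx; rewrite /root horner_coef size_map_poly (eqP sz2).
  rewrite !big_ord_recl big_ord0 /= !coef_map expr0 mulr1 expr1 addr0 => /eqP h.
  by rewrite fmorph_div rmorphN; apply: (mulIf (x := i P`_1)); rewrite ?fmorph_eq0 // divfK ?fmorph_eq0 //; apply/esym/eqP; rewrite -subr_eq0 opprK addrC mulrC h.
move: (sP); rewrite -(separable_map i) PQ separable_root => /andP[sQ nQ].
have [y ry] := Om_closed hOm sQ szQ.
have rPy : root (map_poly i P) y by rewrite PQ rootM ry.
have hA := phom_adjoin rP cP rPy.
have AC c : exists q : {poly K}, (i c, i c) = ((map_poly i q).[x], (map_poly i q).[y]).
  by exists c%:P; rewrite map_polyC !hornerC.
have At := AC u; rewrite iu in At.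
have [s sA] := phom_extend hOm hA At.
have Gs : Gal s.
  split; first by rewrite -iu; apply: sA.
  by move=> c kc; have [d <-] := (iK c).1 (ratfunC kc); apply: sA.
have sx : s x = y by apply: sA; exists 'X; rewrite map_polyX !hornerX.
by move: nQ; rewrite -(fx s Gs) sx ry.
Qed.

(** Composing a valuation with such an [s] moves its place: [place_exists] takes t + a and 1 / t for
    [t'] to reach every point from 0. *)
Lemma substitution_exists t' :
  (forall A, poly_over k A -> A.[t'] = 0 -> A = 0) ->
  exists s : {rmorphism Om -> Om}, s t = t' /\ forall c, k c -> s c = c.
Proof.
move=> tr'.
have ne A u : A.[u] != 0 -> A != 0 by apply: contraNneq => ->; rewrite horner0.
have nt A : poly_over k A -> A != 0 -> A.[t] != 0.
  by move=> kA; apply: contraNneq => h; rewrite (Fpbar_transcendental kA h).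
have nt' A : poly_over k A -> A != 0 -> A.[t'] != 0.
  by move=> kA; apply: contraNneq => h; rewrite (tr' _ kA h).
pose G (z : Om * Om) := exists A B : {poly Om}, [/\ poly_over k A, poly_over k B, B != 0 &
  z = (A.[t] / B.[t], A.[t'] / B.[t'])].
have [||s sG] := @phom_extend _ _ _ hOm G t'.
- split.
  + exists 1, 1; split; [exact: poly_over1|exact: poly_over1|exact: oner_neq0|].
    by rewrite !hornerC divr1.
  + move=> x y x' y' [A [B [kA kB nB [-> ->]]]] [C [D [kC kD nD [-> ->]]]].
    exists (A * D - C * B), (B * D); split; last 1 first.
    * congr (_, _); rewrite !hornerE; field; apply/andP; split; by [apply: nt|apply: nt'].
    * by apply: poly_overB => //; apply: poly_overM.
    * exact: poly_overM.
    * by rewrite mulf_neq0.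
  + move=> x y x' y' [A [B [kA kB nB [-> ->]]]] [C [D [kC kD nD [-> ->]]]].
    exists (A * C), (B * D); split; last 1 first.
    * by rewrite !hornerM !invfM; congr (_, _); ring.
    * exact: poly_overM.
    * exact: poly_overM.
    * by rewrite mulf_neq0.
  + move=> x y [A [B [kA kB nB [-> ->]]]]; have [->|nA] := eqVneq A 0.
      exists 0, 1; rewrite !horner0 !mul0r invr0; split=> //; last exact: oner_neq0.
        exact: poly_over0.
      exact: poly_over1.
    by exists B, A; rewrite !invf_div.
  + move=> y [A [B [kA kB nB [/esym /eqP e ->]]]]; move: e.
    rewrite mulf_eq0 invr_eq0 (negPf (nt _ kB nB)) orbF.
    by move=> /eqP /(Fpbar_transcendental kA)->; rewrite horner0 mul0r.
- exists 'X, 1; rewrite !hornerX !hornerC !divr1; split=> //; last exact: oner_neq0.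
    exact: poly_overX.
  exact: poly_over1.
exists s; split.
  apply: sG; exists 'X, 1; rewrite !hornerX !hornerC !divr1; split=> //; last exact: oner_neq0.
    exact: poly_overX.
  exact: poly_over1.
move=> c kc; apply: sG; exists c%:P, 1; rewrite !hornerC !divr1.
split=> //; last exact: oner_neq0; first exact: poly_overC.
exact: poly_over1.
Qed.

Lemma place_exists (v0 : Om -> rat) : place_over t v0 ->
  (forall a, k a -> exists v, place_over (t - a) v) /\ exists v, place_over t^-1 v.
Proof.
move=> [hv0 v0t]; split=> [a ka|].
  have [|s [st sk]] := @substitution_exists (t + a).
    move=> A kA A0; apply/eqP; rewrite -(@comp_poly2_eq0 _ A ('X + a%:P)) ?size_XaddC //.
    apply/eqP/Fpbar_transcendental; last by rewrite horner_comp !hornerE.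
    by apply: poly_over_comp => //; apply: poly_overD; [|apply: poly_overX|apply: poly_overC].
  exists (v0 \o s); split; first exact: valuation_comp.
  by rewrite /= rmorphB st sk // addrK.
have t0 : t != 0.
  apply/eqP => t0; have := @Fpbar_transcendental 'X (poly_overX ksub).
  by rewrite hornerX t0 => /(_ erefl)/eqP; rewrite polyX_eq0.
have [|s [st sk]] := @substitution_exists t^-1.
  move=> A kA A0; apply/eqP; apply: contraT => nA.
  (* The reciprocal polynomial, whose value at [t] is t^(deg A) A(1/t). *)
  pose B := \poly_(i < size A) A`_((size A).-1 - i).
  have B0 : B = 0.
    apply: Fpbar_transcendental; first by apply: poly_over_poly.
    have -> : B.[t] = t ^+ (size A).-1 * A.[t^-1].
      rewrite horner_poly horner_coef big_distrr (reindex_inj rev_ord_inj) /=.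
      apply: eq_bigr => i _; have := ltn_ord i => lti.
      have e n m : (m < n)%N -> ((n.-1 - (n - m.+1))%N = m) /\ ((n - m.+1)%N = (n.-1 - m)%N) by lia.
      have le : (i <= (size A).-1)%N by rewrite -ltnS (ltn_predK lti).
      by have [-> ->] := e _ _ lti; rewrite mulrCA exprVn -expfB_cond ?(negPf t0) ?add0n.
    by rewrite A0 mulr0.
  have := congr1 (fun g : {poly Om} => g`_0) B0.
  rewrite coef_poly coef0 size_poly_gt0 nA subn0 => /eqP.
  by rewrite -/(lead_coef A) lead_coef_eq0 (negPf nA).
exists (v0 \o s); split; first exact: valuation_comp.
by rewrite /= fmorphV st invrK.
Qed.

(** Each [C i] depends only on the values of [s] on a finite list, hence is open and closed. The
    limit along an ultrafilter exists at each point because an element has finitely many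
    conjugates. *)
Lemma gal_compact (I : Type) (C : I -> {rmorphism Om -> Om} -> Prop)
    (supp : I -> seq Om) :
  (forall i (s s' : {rmorphism Om -> Om}), {in supp i, s =1 s'} -> C i s -> C i s') ->
  (forall l : seq I, exists2 s, Gal s & forall_in (C^~ s) l) ->
  exists2 s, Gal s & forall i, C i s.
Proof.
move=> supC fip.
have [|U [UC UI US U0 UU]] := @ultrafilter_exists {s | Gal s} I (fun i s => C i (sval s)).
  by move=> l; have [s Gs hs] := fip l; exists (exist _ s Gs).
have lim x : exists y, U (fun s => sval s x = y).
  have [o oP] := gal_conj_enum x.
  suff /(_ o) : forall l : seq Om, U (fun s => sval s x \in l) ->
      exists y, U (fun s => sval s x = y).
    apply; have [|/U0[[s Gs] /=]] := UU (fun s => sval s x \in o) => //.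
    by rewrite oP.
  elim=> [/U0[]//|y l IH h].
  have [hy|hy] := UU (fun s => sval s x = y); first by exists y.
  apply: IH; apply: US (UI _ _ h hy) => s /=.
  by rewrite inE => -[/orP[/eqP->|//]] [].
have [f fU] := boolp.choice lim.
have eqU (s0 : Om) (z : Om) : U (fun _ => s0 = z) -> s0 = z by move=> /U0[].
have [s sE] : exists s : {rmorphism Om -> Om}, s =1 f.
  apply: exists_rmorphism => [|x y|x y]; apply: eqU.
  - by apply: US (fU 1) => s <-; rewrite rmorph1.
  - by apply: US (UI _ _ (UI _ _ (fU x) (fU y)) (fU (x - y))) => s [[<- <-] <-]; rewrite rmorphB.
  - by apply: US (UI _ _ (UI _ _ (fU x) (fU y)) (fU (x * y))) => s [[<- <-] <-]; rewrite rmorphM.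
have fin (l : seq Om) : U (fun s' => {in l, sval s' =1 s}).
  elim: l => [|x l IH]; first by apply: US (fU 0) => s' _ x; rewrite in_nil.
  apply: US (UI _ _ IH (fU x)) => s' [hl hx] y.
  by rewrite inE => /orP[/eqP->|/hl//]; rewrite hx sE.
exists s; last first.
  by move=> i; have [s' [h1 h2]] := U0 _ (UI _ _ (fin (supp i)) (UC i)); apply: supC h2.
split; first by have [[s' [st sk]] /= h] := U0 _ (fin [:: t]); rewrite -h ?mem_head.
by move=> x kx; have [[s' [st sk]] /= h] := U0 _ (fin [:: x]); rewrite -h ?mem_head // sk.
Qed.

End GaloisGroup.

(** * Roots of unity in the separable closure *)

Section SeparablyClosed.
Variables (p : nat) (Om : fieldType) (t : Om).
Hypothesis hp : prime p.
Hypothesis hOm : is_sepclosure_Fpt p t.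
Local Notation k := (@Fpbar p Om).

Lemma separable_splits (f : {poly Om}) : separable_poly f -> f \is monic ->
  exists rs : seq Om, f = \prod_(r <- rs) ('X - r%:P).
Proof.
have [n] := ubnP (size f); elim: n f => // n IH f szf sf mf.
have [le1|gt1] := leqP (size f) 1.
  exists [::]; rewrite big_nil; have := monic_neq0 mf.
  move/eqP: mf; rewrite (size1_polyC le1) lead_coefC => -> _.
  by [].
have [r /factor_theorem[g fg]] := Om_closed hOm sf gt1.
have mg : g \is monic by move: mf; rewrite fg monicMr ?monicXsubC.
have [||rs grs] := IH g _ _ mg.
- have := szf; rewrite fg size_monicM ?polyXsubC_eq0 // size_XsubC addn2.
  by rewrite ltnS.
- by move: sf; rewrite fg separable_root => /andP[].
by exists (r :: rs); rewrite fg grs big_cons mulrC.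
Qed.

Lemma unity_splits M : coprime p M -> (0 < M)%N -> exists rs : seq Om,
  [/\ 'X^M - 1 = \prod_(r <- rs) ('X - r%:P), uniq rs & forall r, r \in rs -> k r].
Proof.
move=> cpM M0; have nM : M%:R != 0 :> Om.
  by rewrite -(dvdn_pcharf (Om_pchar hOm)) -prime_coprime.
have sM := separable_Xn_sub_1 nM.
have [rs E] := separable_splits sM (monic_Xn_sub_1 _ M0).
exists rs; split=> //; first by rewrite -separable_prod_XsubC -E.
move=> r; rewrite -root_prod_XsubC -E /root !hornerE subr_eq0 => /eqP.
exact: Fpbar_unity.
Qed.

Lemma Fpbar_infinite (l : seq Om) : exists2 c, k c & c \notin l.
Proof.
(* Prime to p and larger than [size l]: the M-th roots of unity cannot all lie in [l]. *)
pose M := (size l * p).+1.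
have cpM : coprime p M by rewrite /M -addn1 /coprime gcdnMDl gcdn1.
have [rs [E urs krs]] := unity_splits cpM (ltn0Sn _).
have szM : size rs = M.
  by apply: succn_inj; rewrite -(size_prod_XsubC rs id) -E size_Xn_sub_1.
apply: boolp.contrapT => h.
have /uniq_leq_size - /(_ urs) : {subset rs <= l}.
  by move=> r rrs; apply: contraT => rl; case: h; exists r => //; apply: krs.
rewrite szM /M; have := prime_gt0 hp; move: (size l) => n; nia.
Qed.

End SeparablyClosed.

(** * Places and inertia groups *)

Section Places.
Variables (p : nat) (Om : fieldType) (t : Om).
Hypothesis hp : prime p.
Hypothesis hOm : is_sepclosure_Fpt p t.
Local Notation k := (@Fpbar p Om).
Local Notation Gal := (Defs.gal t k).
Local Notation ratfun := (@ratfun p Om t).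

Let ksub : is_subfield k := Fpbar_subfield hp (Om_pchar hOm).

Definition uniformizer (u : Om) := (exists2 a, k a & u = t - a) \/ u = t^-1.

Lemma uniformizer_neq0 u : uniformizer u -> u != 0.
Proof.
have tr := Fpbar_transcendental hp hOm.
have nt a : k a -> t != a.
  move=> ka; apply/eqP => ta.
  have kp : poly_over k ('X - a%:P).
    by apply: poly_overB => //; [apply: poly_overX|apply: poly_overC].
  have := tr _ kp; rewrite !hornerE ta subrr => /(_ erefl)/eqP.
  by rewrite polyXsubC_eq0.
case=> [[a ka ->]|->]; first by rewrite subr_eq0 nt.
by rewrite invr_eq0; apply: nt; apply: subfield0.
Qed.

Lemma ratfun_uniformizer u : uniformizer u -> ratfun u.
Proof.
have rs := ratfun_subfield hp hOm.
case=> [[a ka ->]|->]; last by apply: subfieldV => //; apply: ratfunt.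
by apply: subfieldB => //; [apply: ratfunt|apply: ratfunC].
Qed.

(** The leading exponent [m] is the multiplicity of the root at a finite point, and minus the degree
    at oo, where [A] is the reciprocal polynomial. *)
Lemma poly_expand u C : uniformizer u -> poly_over k C -> C != 0 ->
  exists (m : int) (A : {poly Om}), [/\ poly_over k A, A`_0 != 0 & C.[t] = u ^ m * A.[u]].
Proof.
move=> hu kC C0; case: hu => [[a ka ->]|->].
  pose C' := C \Po ('X + a%:P).
  have C'0 : C' != 0 by rewrite comp_poly2_eq0 ?size_XaddC.
  have kC' : poly_over k C'.
    by apply: poly_over_comp => //; apply: poly_overD; [|apply: poly_overX|apply: poly_overC].
  have [m [A]] := multiplicity_XsubC C' 0; rewrite C'0 subr0 /= => nA C'A.
  exists m, A; split.
  - by move=> i; have := kC' (i + m)%N; rewrite C'A coefMXn ltnNge leq_addl addnK.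
  - by move: nA; rewrite /root horner_coef0.
  - have : C'.[t - a] = C.[t] by rewrite horner_comp !hornerE subrK.
    by rewrite C'A hornerM hornerXn mulrC => <-.
have t0 : t != 0 by rewrite -invr_eq0; apply: uniformizer_neq0; right.
exists (- (size C).-1%:Z), (\poly_(i < size C) C`_((size C).-1 - i)); split.
- exact: poly_over_poly.
- by rewrite coef_poly size_poly_gt0 C0 subn0 -/(lead_coef C) lead_coef_eq0.
rewrite exprz_inv opprK -exprnP horner_poly horner_coef big_distrr.
rewrite [RHS](reindex_inj rev_ord_inj) /=; apply: eq_bigr => i _.
have lti := ltn_ord i.
have e n m : (m < n)%N -> ((n.-1 - (n - m.+1))%N = m) /\ ((n - m.+1)%N = (n.-1 - m)%N) by lia.
have le : (i <= (size C).-1)%N by rewrite -ltnS (ltn_predK lti).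
have [-> ->] := e _ _ lti.
rewrite mulrCA exprVn; congr (_ * _).
by rewrite -[X in _ = t ^+ X / _](subnK le) exprD mulrAC divff ?mul1r ?expf_neq0.
Qed.

Lemma ratfun_expand u x : uniformizer u -> ratfun x -> x != 0 ->
  exists (m : int) (A B : {poly Om}), [/\ poly_over k A, poly_over k B,
    A`_0 != 0, B`_0 != 0 & x = u ^ m * (A.[u] / B.[u])].
Proof.
move=> hu [A [B [kA kB nB ->]]] x0.
have u0 := uniformizer_neq0 hu.
have A0 : A != 0 by apply: contraNneq x0 => ->; rewrite horner0 mul0r.
have B0 : B != 0 by apply: contraNneq nB => ->; rewrite horner0.
have [m [A' [kA' nA' ->]]] := poly_expand hu kA A0.
have [n [B' [kB' nB' ->]]] := poly_expand hu kB B0.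
exists (m - n), A', B'; split=> //.
by rewrite expfzDr // invfM mulrACA invr_expz.
Qed.

Variables (v : Om -> rat) (u : Om).
Hypothesis hu : uniformizer u.
Hypothesis hv : place_over u v.

Let vv : valuation v := hv.1.
Let u0 : u != 0 := uniformizer_neq0 hu.

Lemma val_const c : k c -> c != 0 -> v c = 0.
Proof.
move=> [f f0 hc] c0; have := valX vv (p ^ f) c0; rewrite [c ^+ _]hc => h.
have : (1 < p ^ f)%N by rewrite -(exp1n f) ltn_exp2r ?prime_gt1.
rewrite -(ltr_nat rat) => lt1; have : ((p ^ f)%:R - 1) * v c = 0 by lra.
by move/eqP; rewrite mulf_eq0 => /orP[/eqP|/eqP//]; lra.
Qed.

Lemma val_ge_const c : k c -> val_ge v 0 c.
Proof.
move=> kc; have [->|c0] := eqVneq c 0; first exact: val_ge0.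
by rewrite val_geN0 // val_const.
Qed.

Lemma val_poly A : poly_over k A -> val_ge v 0 A.[u] /\ val_gt v 0 (A.[u] - A`_0).
Proof.
elim/poly_ind: A => [|A c IH] kA.
  by rewrite horner0 coef0 subrr val_ge0 val_gt0.
have kc : k c by have := kA 0%N; rewrite coefD coefMX coefC add0r.
have kA' : poly_over k A by move=> i; have := kA i.+1; rewrite coefD coefMX coefC addr0.
have [hA _] := IH kA'.
rewrite coefD coefMX coefC add0r /= !hornerE addrK.
have gt : val_gt v 0 (A.[u] * u).
  apply: (@val_ge_gt _ _ 0 (0 + 1)) => //; apply: val_geM => //.
  by rewrite -hv.2 val_ge_id.
by split=> //; apply: val_geD => //; [apply: val_gt_ge|apply: val_ge_const].
Qed.

Lemma val_poly_unit A : poly_over k A -> A`_0 != 0 -> A.[u] != 0 /\ v A.[u] = 0.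
Proof.
move=> kA nA; have [_ h] := val_poly kA.
exact: (val_unit_eq vv nA (val_const (kA 0%N) nA)).
Qed.

Lemma ratfun_val_int x : ratfun x -> x != 0 -> exists m : int, v x = m%:~R.
Proof.
move=> rx x0; have [m [A [B [kA kB nA nB ->]]]] := ratfun_expand hu rx x0.
have [A0 vA] := val_poly_unit kA nA; have [B0 vB] := val_poly_unit kB nB.
exists m; rewrite valM ?mulf_neq0 ?invr_eq0 // ?expfz_neq0 // val_div // vA vB subr0.
by rewrite valZ // hv.2 mulr1.
Qed.

Lemma ratfun_integral x : ratfun x -> val_ge v 0 x ->
  exists A B : {poly Om}, [/\ poly_over k A, poly_over k B, B`_0 != 0 & x = A.[u] / B.[u]].
Proof.
move=> rx; have [-> _|x0] := eqVneq x 0.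
  exists 0, 1; rewrite horner0 mul0r coefC oner_neq0; split=> //.
    exact: poly_over0.
  exact: poly_over1.
have [m [A [B [kA kB nA nB xE]]]] := ratfun_expand hu rx x0.
have [A0 vA] := val_poly_unit kA nA; have [B0 vB] := val_poly_unit kB nB.
rewrite val_geN0 // {1}xE valM ?mulf_neq0 ?invr_eq0 // ?expfz_neq0 // val_div // vA vB subr0.
rewrite valZ // hv.2 mulr1 ler0z => m0.
case: m m0 xE => // m _ xE; exists ('X^m * A), B; split=> //.
  by apply: poly_overM => //; apply: poly_overXn => //; apply: poly_overX.
by rewrite hornerM hornerXn -mulrA xE.
Qed.

Lemma ratfun_residue x : ratfun x -> val_ge v 0 x ->
  exists2 c, k c & val_gt v 0 (x - c).
Proof.
move=> rx /(ratfun_integral rx)[A [B [kA kB nB ->]]].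
have [hA gA] := val_poly kA; have [hB gB] := val_poly kB.
have [B0 vB] := val_poly_unit kB nB.
exists (A`_0 / B`_0); first exact: subfield_div.
have -> : A.[u] / B.[u] - A`_0 / B`_0 =
  ((A.[u] - A`_0) * B`_0 - (B.[u] - B`_0) * A`_0) / (B.[u] * B`_0).
  by field; apply/andP.
rewrite -[0]addr0; apply: (val_gtM vv); last first.
  by rewrite val_geN0 ?invr_eq0 ?mulf_neq0 // valV ?mulf_neq0 // valM // vB val_const // addr0 oppr0.
by apply: (val_gtB vv); rewrite -[0]addr0; apply: (val_gtM vv) => //; apply: val_ge_const.
Qed.

(** The residue field of [Om] is Fpbar: reducing a polynomial relation for a unit [x] makes a power
    of [x] congruent to 1, so that [x] is congruent to a root of unity. *)
Lemma residue x : val_ge v 0 x -> exists2 c, k c & val_gt v 0 (x - c).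
Proof.
move=> x_ge0; have [hx0|hx0] := boolP (val_gt v 0 x).
  by exists 0; [apply: subfield0|rewrite subr0].
have xn0 : x != 0 by apply: contraNneq hx0 => ->; apply: val_gt0.
have vx0 : v x = 0.
  by move: x_ge0 hx0; rewrite val_geN0 // val_gtN0 // => *; lra.
have [f [sf rf _ [g fg]]] := separable_poly_of hOm x.
have f0 := separable_poly_neq0 sf.
have rff i : ratfun f`_i.
  rewrite fg /eval_at coef_map_id0 ?rmorph0 ?horner0 //.
  apply: ratfun_poly => //; move=> j; rewrite coef_map /=.
  case: (g`_i)`_j => n; first by rewrite -pmulrn; apply: subfield_nat.
  by rewrite NegzE mulrNz; apply: subfieldN => //; rewrite -pmulrn; apply: subfield_nat.
(* Division by a coefficient of least valuation makes all coefficients integral and one of them 1,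
   so that the reduction [C] is not zero. *)
have [j0 fj0 minj] : exists2 j0, f`_j0 != 0 & forall j, val_ge v (v f`_j0) f`_j.
  have lt0 : ((size f).-1 < size f)%N by rewrite prednK // size_poly_gt0.
  pose P (i : 'I_(size f)) := f`_i != 0.
  have P0 : P (Ordinal lt0) by rewrite /P /= -/(lead_coef f) lead_coef_eq0.
  case: (@Order.TotalTheory.arg_minP _ _ _ _ P (fun i => v f`_i) P0) => i Pi hi.
  exists i => // j; have [lt|ge] := ltnP j (size f); last by rewrite [f`_j]nth_default ?val_ge0.
  have [->|nj] := eqVneq f`_j 0; first exact: val_ge0.
  by rewrite val_geN0 //; apply: (hi (Ordinal lt)).
pose f' i := f`_i / f`_j0.
have /boolp.choice[c hc] : forall i, exists c, k c /\ val_gt v 0 (f' i - c).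
  move=> i; have [||c kc hc] := @ratfun_residue (f' i); last by exists c.
    by apply: subfield_div => //; apply: ratfun_subfield.
  rewrite /f' -(subrr (v f`_j0)); apply: val_geM => //.
  by rewrite -valV // val_ge_id.
pose C := \poly_(i < size f) c i.
have kC : poly_over k C by apply: poly_over_poly => // i _; case: (hc i).
have C0 : C != 0.
  apply/eqP => C0; have := congr1 (fun h : {poly Om} => h`_j0) C0.
  rewrite coef_poly coef0; case: ltnP => [_|ge]; last by rewrite nth_default ?eqxx in fj0.
  move=> c0; case: (hc j0) => _.
  by rewrite c0 subr0 /f' divff // /val_gt oner_eq0 (val1 vv) ltxx.
have Cx : val_gt v 0 C.[x].
  have -> : C.[x] = - (\sum_(i < size f) (f' i - c i) * x ^+ i).
    under eq_bigr => i _ do rewrite mulrBl /f' mulrAC.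
    rewrite sumrB opprB -big_distrl /= -horner_coef (eqP rf) mul0r subr0.
    by rewrite horner_poly.
  rewrite val_gtN //; apply: val_gt_sum => // i _.
  rewrite -[0]addr0; apply: val_gtM => //; first by case: (hc i).
  by rewrite val_geN0 ?expf_neq0 // valX // vx0 mulr0.
have [h kh|i [j [lt e]]] := powers_congr (Z := val_gt v 0) hp (Om_pchar hOm) C0 kC (x := x).
  rewrite mulrC -[0]addr0; apply: val_gtM => //; rewrite horner_coef.
  apply: val_ge_sum => // i _; rewrite -[0]addr0; apply: val_geM => //.
    exact: val_ge_const.
  by rewrite val_geN0 ?expf_neq0 // valX // vx0 mulr0.
pose N := (j - i)%N.
have N0 : (0 < N)%N by rewrite subn_gt0.
have xN : val_gt v 0 (x ^+ N - 1).
  have -> : x ^+ N - 1 = (x ^+ j - x ^+ i) / x ^+ i.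
    by rewrite -(subnK (ltnW lt)) exprD mulrBl mulfK ?expf_neq0 // divff ?expf_neq0.
  rewrite -[0]addr0; apply: val_gtM => //.
  by rewrite val_geN0 ?invr_eq0 ?expf_neq0 // valV ?expf_neq0 // valX // vx0 mulr0 oppr0.
have [M cpM NE] : exists2 M, coprime p M & N = (M * p ^ logn p N)%N.
  by have [M ? ?] := pfactor_coprime hp N0; exists M.
have M0 : (0 < M)%N by move: N0; rewrite NE muln_gt0 => /andP[].
(* The p-part of the exponent drops out, since x^N - 1 is a p-power of x^M - 1. *)
have xM : val_gt v 0 (x ^+ M - 1).
  have [->|n0] := eqVneq (x ^+ M - 1) 0; first exact: val_gt0.
  have eN : x ^+ N - 1 = (x ^+ M - 1) ^+ (p ^ logn p N).
    by rewrite (FrobB hp (Om_pchar hOm)) expr1n -exprM -NE.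
  move: xN; rewrite eN !val_gtN0 ?expf_neq0 // valX // pmulr_rgt0 // ltr0n expn_gt0.
  by rewrite prime_gt0.
have [rs [E _ krs]] := unity_splits hp hOm cpM M0.
(* Otherwise every factor x - r is a unit, and so is x^M - 1. *)
have : exists2 r, r \in rs & val_gt v 0 (x - r).
  apply: boolp.contrapT => nr; have n r : r \in rs -> ~~ val_gt v 0 (x - r).
    by move=> rr; apply/negP => h; apply: nr; exists r.
  have := congr1 (fun h : {poly Om} => h.[x]) E.
  rewrite !hornerE horner_prod => h; move: xM; rewrite h.
  have {}n r : r \in rs -> ('X - r%:P).[x] != 0 /\ v ('X - r%:P).[x] = 0.
    move=> rr; have := n r rr; rewrite !hornerE => nr'.
    have r0 : x - r != 0 by apply: contraNneq nr' => ->; apply: val_gt0.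
    split=> //; move: nr'; rewrite val_gtN0 // => nr'.
    have : val_ge v 0 (x - r) by apply: val_geB => //; apply/val_ge_const/krs.
    by rewrite val_geN0 // => ?; lra.
  have n0 : \prod_(r <- rs) ('X - r%:P).[x] != 0.
    by rewrite prodf_seq_neq0; apply/allP => r rr; apply/implyP => _; case: (n r rr).
  rewrite val_gtN0 // val_prod // => [|r /n[]//].
  by rewrite big_seq big1 ?ltxx // => r /n[].
by case=> r rr hr; exists r => //; apply: krs.
Qed.

End Places.

(** * Approximation of inertia-invariant elements by rational functions *)

Section Approximation.
Variables (p : nat) (Om : fieldType) (t : Om).
Hypothesis hp : prime p.
Hypothesis hOm : is_sepclosure_Fpt p t.
Local Notation k := (@Fpbar p Om).
Local Notation Gal := (Defs.gal t k).
Local Notation ratfun := (@ratfun p Om t).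
Local Notation subgroup := (@subgroup p Om t).

Let ksub : is_subfield k := Fpbar_subfield hp (Om_pchar hOm).

Variables (v : Om -> rat) (u : Om).
Hypothesis hu : uniformizer p t u.
Hypothesis hv : place_over u v.

Let vv : valuation v := hv.1.
Let u0 : u != 0 := uniformizer_neq0 hp hOm hu.

Definition inertia_gal (s : {rmorphism Om -> Om}) := Gal s /\ inertia v s.

Lemma gal_u s : Gal s -> s u = u.
Proof. by move=> Gs; apply: (gal_ratfun Gs); apply: ratfun_uniformizer. Qed.

(** Values are rational and [u] is invariant, so some x^b / u^a with b > 0 is a unit; inertia fixes
    its residue, hence maps it to a unit. *)
Lemma val_inertia s x : inertia_gal s -> x != 0 -> v (s x) = v x.
Proof.
move=> [Gs Is] x0; pose b := `|denq (v x)|%N; pose a := numq (v x).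
pose y := x ^+ b * u ^ (- a).
have ua0 m : u ^ m != 0 by rewrite expfz_neq0.
have b0 : b%:R != 0 :> rat by rewrite pnatr_eq0 absz_eq0 denq_eq0.
have vxE : b%:R * v x = a%:~R.
  have -> : b%:R = (denq (v x))%:~R :> rat by rewrite -[in RHS]absz_denq.
  by rewrite -[X in _ * X](divq_num_den (v x)) mulrC divfK // intr_eq0 denq_eq0.
have vy z : z != 0 -> v (z ^+ b * u ^ (- a)) = b%:R * (v z - v x).
  move=> z0; rewrite valM ?expf_neq0 // valX // valZ // hv.2 mulr1 mulrBr vxE.
  by rewrite rmorphN.
have y0 : y != 0 by rewrite mulf_neq0 ?expf_neq0.
have vy0 : v y = 0 by rewrite vy // subrr mulr0.
have := Is y; rewrite val_geN0 // vy0 => /(_ isT) h.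
have [_] : s y != 0 /\ v (s y) = v y by apply: valD_eqr; rewrite ?vy0.
have -> : s y = s x ^+ b * u ^ (- a).
  rewrite rmorphM rmorphXn /=; congr (_ * _).
  by rewrite rmorphXz ?unitfE // (gal_u Gs).
rewrite vy0 vy ?fmorph_eq0 // => /eqP.
by rewrite mulf_eq0 (negPf b0) /= subr_eq0 => /eqP.
Qed.

Lemma val_ge_inertia s c x : inertia_gal s -> val_ge v c (s x) = val_ge v c x.
Proof.
move=> Js; have [->|x0] := eqVneq x 0; first by rewrite rmorph0.
by rewrite !val_geN0 ?fmorph_eq0 // val_inertia.
Qed.

Lemma val_gt_inertia s c x : inertia_gal s -> val_gt v c (s x) = val_gt v c x.
Proof.
move=> Js; have [->|x0] := eqVneq x 0; first by rewrite rmorph0.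
by rewrite !val_gtN0 ?fmorph_eq0 // val_inertia.
Qed.

Lemma inertia_subgroup : subgroup inertia_gal.
Proof.
split=> [s []//||s1 s2 J1 J2|s Js].
- split; first exact: gal_id.
  by move=> x _ /=; rewrite subrr val_gt0.
- split; first by apply: gal_comp; [case: J1|case: J2].
  move=> x hx /=; have -> : s1 (s2 x) - x = s1 (s2 x - x) + (s1 x - x).
    by rewrite rmorphB addrA subrK.
  apply: val_gtD => //; last by case: J1 => _; apply.
  by rewrite val_gt_inertia //; case: J2 => _; apply.
have [s' [Gs' ss' s's]] := gal_inv hOm Js.1.
exists s'; split=> //; split=> // x hx.
have hx' : val_ge v 0 (s' x) by rewrite -(val_ge_inertia _ _ Js) s's.
by have := Js.2 _ hx'; rewrite s's -val_gtN // opprB.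
Qed.

Lemma val_ge_lower (l : seq Om) : exists B : rat, forall z, z \in l -> val_ge v B z.
Proof.
elim: l => [|x l [B hB]]; first by exists 0.
exists (Num.min (v x) B) => z; rewrite inE => /orP[/eqP->|/hB].
  by apply: (val_ge_le _ (val_ge_id v x)); rewrite ge_min lexx.
by apply: val_ge_le; rewrite ge_min lexx orbT.
Qed.

(** [c] avoids the negatives of the residues of the integral elements of [ys], so that v (y + c) is
    the minimum of v y and 0. *)
Lemma generic_constant (ys : seq Om) : exists2 c, k c /\ c != 0 &
  forall y, y \in ys -> y + c != 0 /\
    v (y + c) = if val_gt v 0 y then 0 else v y.
Proof.
have /boolp.choice[f hf] : forall y, exists c, val_ge v 0 y -> k c /\ val_gt v 0 (y - c).
  move=> y; have [/(residue hp hOm hu hv)[c kc hc]|_] := boolP (val_ge v 0 y).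
    by exists c.
  by exists 0.
have [c kc cl] := Fpbar_infinite hp hOm (0 :: [seq - f y | y <- ys]).
move: cl; rewrite inE negb_or => /andP[c0 cl].
exists c => // y yl; have vc := val_const hp hv kc c0.
case: ifP => [hy|/negbT hy].
  by have := valD_eq vv c0 (y := y); rewrite vc addrC; apply.
have y0 : y != 0 by apply: contraNneq hy => ->; apply: val_gt0.
have [vy0|vyn0] := eqVneq (v y) 0.
  have [|kf hfy] := hf y; first by rewrite val_geN0 // vy0.
  have fc0 : f y + c != 0.
    by apply: contraNneq cl => /eqP; rewrite addrC addr_eq0 => /eqP->; apply: map_f.
  have vfc : v (f y + c) = 0 by apply: (val_const hp hv) => //; apply: subfieldD.
  rewrite vy0 -vfc; apply: valD_eqr => //.
  by rewrite vfc [y + c]addrC [f y + c]addrC opprD addrACA subrr add0r.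
apply: valD_eq => //; rewrite val_gtN0 // vc.
by move: hy; rewrite val_gtN0 // => *; lra.
Qed.

(** The quotient w / (w + c) is close to 1 where [w] has a high pole and close to 0 where it has a
    high zero; a generic constant [c] keeps it integral at every conjugate of [v]. *)
Lemma separating_element z (N : rat) : val_gt v 0 z -> 0 <= N -> exists e,
  [/\ val_ge v N (e - 1), forall s, Gal s -> val_ge v 0 (s e) &
      forall s, Gal s -> ~~ val_gt v 0 (s z) -> val_ge v N (s e)].
Proof.
move=> hz N0; have [z0|z0] := eqVneq z 0.
  exists 1; rewrite subrr val_ge0; split=> // s _; last by rewrite z0 rmorph0 val_gt0.
  by rewrite rmorph1 val_geN0 ?oner_neq0 // val1.
rewrite val_gtN0 // in hz.
(* With this [b], u / z^b has a pole at [v], while it has a zero at each conjugate place where [z]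
   has none. *)
pose b := (Num.truncn (1 / v z)).+1.
have hb : 1 < b%:R * v z.
  have := Num.Theory.truncnS_gt (1 / v z); rewrite -/b => h.
  by move: h; rewrite ltr_pdivrMr.
pose w0 := u / z ^+ b.
have w00 : w0 != 0 by rewrite mulf_neq0 ?invr_eq0 ?expf_neq0.
have vw0 : v w0 = 1 - b%:R * v z by rewrite val_div ?expf_neq0 // hv.2 valX.
(* A power that brings the orders of this pole and of these zeros to at least [N]. *)
pose M := (Num.truncn (N / - v w0) + Num.truncn N).+1.
have hM1 : N <= M%:R.
  have := Num.Theory.truncnS_gt N; rewrite /M -!natr1 natrD => h.
  have h' : 0 <= (Num.truncn (N / - v w0))%:R :> rat by [].
  by lra.
have hM2 : M%:R * v w0 <= - N.
  have h := Num.Theory.truncnS_gt (N / - v w0).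
  have h' : N / - v w0 <= M%:R.
    apply: le_trans (ltW h) _; by rewrite ler_nat ltnS leq_addr.
  by move: h'; rewrite ler_pdivrMr; lra.
pose w := w0 ^+ M.
have wn0 : w != 0 by rewrite expf_neq0.
have vw : v w = M%:R * v w0 by rewrite valX.
have M0 : 0 < M%:R :> rat by rewrite ltr0n.
have [c [kc c0] hc] := generic_constant (orb Gal w).
have oG := subgroup_Gal hOm.
have hs s : Gal s -> s w + c != 0 /\ v (s w + c) = if val_gt v 0 (s w) then 0 else v (s w).
  by move=> Gs; apply: hc; apply/(orbP hOm oG); exists s.
have vc := val_const hp hv kc c0.
exists (w / (w + c)); have sE s : Gal s -> s (w / (w + c)) = s w / (s w + c).
  by move=> Gs; rewrite fmorph_div rmorphD /= [s c]Gs.2.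
have swn0 s : Gal s -> s w != 0 by move=> Gs; rewrite fmorph_eq0.
split.
- have [wc0] := hs _ (gal_id p t); rewrite /= => vwc.
  have -> : w / (w + c) - 1 = - (c / (w + c)) by field.
  rewrite val_geN // val_geN0 ?mulf_neq0 ?invr_eq0 // val_div // vc vwc.
  rewrite val_gtN0 // vw; case: ltP; last by lra.
  have : M%:R * v w0 < 0 by rewrite pmulr_rlt0 // vw0; lra.
  by lra.
- move=> s Gs; rewrite sE //; have [swc0 vswc] := hs s Gs.
  rewrite val_geN0 ?mulf_neq0 ?invr_eq0 ?swn0 // val_div ?swn0 // vswc.
  rewrite val_gtN0 ?swn0 //; case: ltP; last by rewrite subrr.
  by rewrite subr0 => /ltW.
move=> s Gs hsz; rewrite sE //; have [swc0 vswc] := hs s Gs.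
have sz0 : s z != 0 by rewrite fmorph_eq0.
have vsw : M%:R <= v (s w).
  rewrite rmorphXn valX ?fmorph_eq0 // fmorph_div rmorphXn /= (gal_u Gs).
  rewrite val_div ?expf_neq0 // hv.2 valX // -[X in X <= _]mulr1 ler_pM2l //.
  move: hsz; rewrite val_gtN0 // -leNgt => h.
  have : b%:R * v (s z) <= 0 by rewrite pmulr_rle0 // ltr0n.
  by lra.
rewrite val_geN0 ?mulf_neq0 ?invr_eq0 ?swn0 // val_div ?swn0 // vswc val_gtN0 ?swn0 //.
by case: ltP; lra.
Qed.

Variable x : Om.
Hypothesis hx : forall s, inertia_gal s -> s x = x.

(** An [s] that moves [x] is outside the inertia group, so it does not preserve the residue of some
    integral element; [z] is that element minus its residue. By compactness finitely many [z] serve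
    for all such [s]. *)
Lemma finite_separation : exists zs : seq Om,
  (forall z, z \in zs -> val_gt v 0 z) /\
  forall s, Gal s -> s x != x -> exists2 z, z \in zs & ~~ val_gt v 0 (s z).
Proof.
pose C (i : option Om) (s : {rmorphism Om -> Om}) :=
  if i is Some z then val_ge v 0 z -> val_gt v 0 (s z - z) else s x <> x.
pose supp i := if i is Some z then [:: z] else [:: x].
have supC i (s s' : {rmorphism Om -> Om}) : {in supp i, s =1 s'} -> C i s -> C i s'.
  by case: i => [z|] h /=; rewrite h ?mem_head.
have : ~ forall l : seq (option Om), exists2 s, Gal s & forall_in (C^~ s) l.
  move=> /(gal_compact hOm supC)[s Gs Cs].
  by apply: (Cs None); apply: hx; split=> // z; apply: (Cs (Some z)).
move=> /boolp.existsNP[l hl].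
have /boolp.choice[f hf] : forall y, exists c, val_ge v 0 y -> k c /\ val_gt v 0 (y - c).
  move=> y; have [/(residue hp hOm hu hv)[c kc hc]|_] := boolP (val_ge v 0 y).
    by exists c.
  by exists 0.
exists [seq z - f z | z <- pmap id l & val_ge v 0 z]; split.
  by move=> y /mapP[z]; rewrite mem_filter => /andP[/hf[_ h] _] ->.
move=> s Gs sx; apply: boolp.contrapT => nz; apply: hl; exists s => //.
apply/forall_in_mem => -[z|] il /=; last by apply/eqP.
move=> hz; have [kf hfz] := hf z hz.
have : val_gt v 0 (s (z - f z)).
  apply: contraT => h; case: nz; exists (z - f z) => //.
  apply/mapP; exists z => //; rewrite mem_filter hz /=.
  by rewrite mem_pmap; apply/mapP; exists (Some z).
rewrite rmorphB /= [s (f z)]Gs.2 // => h.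
have -> : s z - z = (s z - f z) - (z - f z) by rewrite opprB addrA subrK.
exact: val_gtB.
Qed.

Lemma separating_element_all (N : rat) : 0 <= N -> exists e,
  [/\ val_ge v N (e - 1), forall s, Gal s -> val_ge v 0 (s e) &
      forall s, Gal s -> s x != x -> val_ge v N (s e)].
Proof.
move=> N0; have [zs [zs0 hzs]] := finite_separation.
suff [e [e1 e2 e3]] : exists e,
  [/\ val_ge v N (e - 1), forall s, Gal s -> val_ge v 0 (s e) &
      forall s, Gal s -> (exists2 z, z \in zs & ~~ val_gt v 0 (s z)) -> val_ge v N (s e)].
  by exists e; split=> // s Gs sx; apply: e3 => //; apply: hzs.
elim: zs zs0 {hzs} => [|z zs IH] zs0.
  exists 1; rewrite subrr val_ge0; split=> // s _; last by case.
  by rewrite rmorph1 val_geN0 ?oner_neq0 // val1.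
have [|e [e1 e2 e3]] := IH; first by move=> y yl; apply: zs0; rewrite inE yl orbT.
have [d [d1 d2 d3]] := separating_element (zs0 z (mem_head _ _)) N0.
exists (e * d); split.
- have -> : e * d - 1 = (e - 1) * d + (d - 1) by ring.
  apply: val_geD => //; rewrite -[N]addr0; apply: val_geM => //.
  exact: (d2 _ (gal_id p t)).
- by move=> s Gs; rewrite rmorphM -[0]addr0; apply: val_geM => //; [apply: e2|apply: d2].
move=> s Gs [y]; rewrite inE => /orP[/eqP->|yl] hy; rewrite rmorphM.
  by rewrite -[N]add0r; apply: val_geM => //; [apply: e2|apply: d3].
rewrite -[N]addr0; apply: val_geM => //; last exact: d2.
by apply: e3 => //; exists y.
Qed.

(** This replaces the completion of Fpbar(t). With [e'] close to 1 at [v] and close to 0 at the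
    conjugate places given by the [s] that move [x], the trace of e' x is a rational function, all
    of whose terms are small except e' x itself. *)
Lemma inertia_fixed_approx (N : rat) : exists2 g, ratfun g & val_ge v N (x - g).
Proof.
have oG := subgroup_Gal hOm.
have [B hB] := val_ge_lower (orb Gal x).
(* [B] bounds the poles of the conjugates of [x], by which the terms of the trace lose precision. *)
pose N' : rat := Num.max 0 (N - B).
have N'0 : 0 <= N' by rewrite le_max lexx.
have N'N : N <= N' + B by rewrite -lerBlDr le_max lexx orbT.
have [e [e1 e2 e3]] := separating_element_all N'0.
pose Px := fun s => Gal s /\ {in [:: x], forall y, s y = y}.
have oP : subgroup Px := subgroup_fix [:: x] oG.
have prodB (l : seq Om) : (forall y, y \in l -> val_ge v N' y) ->
    val_ge v N' (\prod_(y <- l) (1 - y) - 1).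
  elim: l => [|y l IH] h; first by rewrite big_nil subrr val_ge0.
  rewrite big_cons.
  have -> : (1 - y) * \prod_(j <- l) (1 - j) - 1 =
    (\prod_(j <- l) (1 - j) - 1) - y * (1 + (\prod_(j <- l) (1 - j) - 1)) by ring.
  have IH' : val_ge v N' (\prod_(j <- l) (1 - j) - 1).
    by apply: IH => z zl; apply: h; rewrite inE zl orbT.
  apply: val_geB => //; rewrite -[N']addr0; apply: val_geM => //.
    by apply: h; rewrite mem_head.
  apply: val_geD => //; first by rewrite val_geN0 ?oner_neq0 // val1.
  exact: (val_ge_le N'0 IH').
(* Made invariant under the stabilizer of [x], so that an [s] moving e' x also moves [x]. *)
pose e' : Om := 1 - \prod_(y <- orb Px e) (1 - y).
have se' s : Px s -> s e' = e'.
  move=> Ps; rewrite rmorphB rmorph1 (orb_prod_fixed hOm oP (f := fun y => 1 - y)) // => y.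
  by rewrite rmorphB rmorph1.
have se'N s : Gal s -> s x != x -> val_ge v N' (s e').
  move=> Gs sx; have -> : s e' = - (\prod_(y <- map s (orb Px e)) (1 - y) - 1).
    rewrite rmorphB rmorph1 rmorph_prod big_map opprB; congr (_ - _).
    by apply: eq_bigr => y _; rewrite rmorphB rmorph1.
  rewrite val_geN //; apply: prodB => _ /mapP[y /(orbP hOm oP)[s' [Gs' s'x] <-] ->].
  by apply: (e3 (s \o s')); [apply: gal_comp|rewrite /= s'x ?mem_head].
have e'1 : val_ge v N' (e' - 1).
  rewrite /e' addrAC subrr add0r val_geN // (big_rem e) ?(orb_id hOm oP) //= -[N']addr0.
  apply: val_geM => //; first by rewrite -val_geN // opprB.
  rewrite big_seq; apply: val_ge_prod => // y /mem_rem/(orbP hOm oP)[s [Gs _] <-].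
  apply: val_geB => //; first by rewrite val_geN0 ?oner_neq0 // val1.
  exact: e2.
exists (\sum_(y <- orb Gal (e' * x)) y).
  by apply: (ratfun_fixed hp hOm) => s Gs; apply: (orb_sum_fixed hOm oG).
rewrite (big_rem (e' * x)) ?(orb_id hOm oG) //= opprD addrA.
apply: val_geB => //.
  have -> : x - e' * x = - ((e' - 1) * x) by ring.
  rewrite val_geN //; apply: (val_ge_le N'N); apply: val_geM => //.
  by apply: hB; exact: (orb_id hOm oG).
rewrite big_seq; apply: val_ge_sum => // y.
rewrite (rem_filter _ (orb_uniq hOm oG _)) mem_filter /= => /andP[ny /(orbP hOm oG)[s Gs sy]].
rewrite -sy rmorphM; apply: (val_ge_le N'N); apply: val_geM => //; last first.
  by apply: hB; apply/(orbP hOm oG); exists s.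
apply: se'N => //; apply: contraNneq ny => sx.
rewrite -sy rmorphM sx se' //; split=> // z; rewrite inE => /eqP->.
exact: sx.
Qed.

Lemma inertia_fixed_val : x != 0 -> exists m : int, v x = m%:~R.
Proof.
move=> x0; have [g rg hg] := inertia_fixed_approx (v x + 1).
have [g0 vg] : g != 0 /\ v g = v x.
  apply: valD_eqr => //; rewrite -val_gtN // opprB.
  by apply: (val_ge_gt _ hg); lra.
by have [m hm] := ratfun_val_int hp hOm hu hv rg g0; exists m; rewrite -vg.
Qed.

End Approximation.

Lemma linear_root (K L : fieldType) (i : {rmorphism K -> L}) (g : {poly K}) x :
  size g = 2%N -> root (map_poly i g) x -> exists a, i a = x.
Proof.
move=> sz2; have g1 : g`_1 != 0.
  have := lead_coef_eq0 g; rewrite /lead_coef sz2 /= => ->.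
  by rewrite -size_poly_eq0 sz2.
rewrite /root horner_coef size_map_poly sz2.
rewrite !big_ord_recl big_ord0 /= !coef_map expr0 mulr1 expr1 addr0 => /eqP h.
exists (- g`_0 / g`_1); rewrite fmorph_div rmorphN.
apply: (mulIf (x := i g`_1)); rewrite ?fmorph_eq0 // divfK ?fmorph_eq0 //.
by apply/esym/eqP; rewrite -subr_eq0 opprK addrC mulrC h.
Qed.

(** [x] is a simple root of [q] and the only root of X^p - a, so their gcd, which is defined over
    [K], is linear. *)
Lemma separable_inseparable (K L : fieldType) (i : {rmorphism K -> L}) p
    (q : {poly K}) (x : L) a :
  prime p -> p \in [pchar L] ->
  root (map_poly i q) x -> (map_poly i q)^`().[x] != 0 -> x ^+ p = i a ->
  exists b, i b = x.
Proof.
move=> hp hL rx dx xp.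
pose g := gcdp q ('X^p - a%:P).
have Xp : map_poly i ('X^p - a%:P) = ('X - x%:P) ^+ p.
  have hLp : p \in [pchar {poly L}] by rewrite pchar_poly.
  rewrite rmorphB /= map_polyXn map_polyC /= -xp rmorphXn /=.
  exact/esym/(pFrobenius_autB_comm hLp (mulrC _ _)).
have [Q1 qE] := factor_theorem _ _ rx.
have Q1x : Q1.[x] != 0.
  by move: dx; rewrite qE derivM derivXsubC !hornerE subrr mulr0 add0r.
have p0 := prime_gt0 hp.
apply: (linear_root (g := g)).
  rewrite -(size_map_poly i) gcdp_map Xp qE -(prednK p0) exprS mulrC.
  have g0 : gcdp Q1 (('X - x%:P) ^+ p.-1) != 0.
    by rewrite gcdp_eq0 negb_and expf_neq0 ?polyXsubC_eq0 // orbT.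
  rewrite (eqp_size (gcdp_mul2l _ _ _)) size_mul ?polyXsubC_eq0 // size_XsubC.
  have /eqP -> : coprimep Q1 (('X - x%:P) ^+ p.-1).
    by rewrite coprimep_expr // coprimep_XsubC.
  by [].
rewrite gcdp_map Xp root_gcd rx /root !hornerE subrr expr0n.
by rewrite eqn0Ngt p0.
Qed.

Record derivation (L : fieldType) (D : L -> L) : Prop := Derivation {
  derD : forall x y, D (x + y) = D x + D y;
  derM : forall x y, D (x * y) = D x * y + x * D y }.

(** * The derivation d/dt and the different *)

Section Derivations.
Variables (L : fieldType) (D : L -> L) (hD : derivation D).

Lemma der0 : D 0 = 0.
Proof. by apply: (addrI (D 0)); rewrite -derD // !addr0. Qed.
Lemma derN x : D (- x) = - D x.
Proof. by apply/eqP; rewrite -subr_eq0 opprK -derD // addNr der0. Qed.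
Lemma derB x y : D (x - y) = D x - D y.
Proof. by rewrite derD // derN. Qed.
Lemma der1 : D 1 = 0.
Proof.
have := derM hD 1 1; rewrite !mul1r mulr1 => h.
by apply: (addrI (D 1)); rewrite -h addr0.
Qed.
Lemma der_sum (I : Type) (r : seq I) (P : pred I) f :
  D (\sum_(i <- r | P i) f i) = \sum_(i <- r | P i) D (f i).
Proof. exact: (big_morph D (derD hD) der0). Qed.
Lemma derX x n : D (x ^+ n) = n%:R * x ^+ n.-1 * D x.
Proof.
elim: n => [|n IH]; first by rewrite expr0 der1 !mul0r.
rewrite exprS derM // IH; case: n {IH} => [|n]; first by rewrite /= expr0; ring.
by rewrite /= -[n.+2%:R]natr1 exprS; ring.
Qed.
Lemma derV x : x != 0 -> D x^-1 = - D x / x ^+ 2.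
Proof.
move=> x0; have := derM hD x x^-1; rewrite divff // der1 => h.
apply: (mulfI x0); apply: (addrI (D x / x)); rewrite -h; field.
exact: x0.
Qed.
Lemma der_div x y : y != 0 -> D (x / y) = (D x * y - x * D y) / y ^+ 2.
Proof. by move=> y0; rewrite derM // derV //; field. Qed.
Lemma der_horner (f : {poly L}) x :
  D f.[x] = (\poly_(i < size f) D f`_i).[x] + f^`().[x] * D x.
Proof.
have e (g : {poly L}) n : (size g <= n)%N -> (\poly_(i < size g) D g`_i) = \poly_(i < n) D g`_i.
  move=> le; apply/polyP => i; rewrite !coef_poly; case: ltnP => [lt|ge].
    by rewrite (leq_trans lt le).
  by rewrite nth_default // der0; case: ifP.
elim/poly_ind: f => [|f c IH].
  by rewrite horner0 der0 deriv0 size_poly0 !horner0 mul0r addr0 horner_poly big_ord0.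
rewrite derivD derivM derivX derivC addr0 mulr1 !hornerE derD // derM // IH.
have -> : (\poly_(i < size (f * 'X + c%:P)) D (f * 'X + c%:P)`_i) =
    (\poly_(i < size f) D f`_i) * 'X + (D c)%:P.
  rewrite (e _ (size f).+1); last first.
    by rewrite size_MXaddC; case: ifP.
  apply/polyP => i; rewrite coefD coefMX coefC !coef_poly coefD coefMX coefC.
  by case: i => [|i] /=; rewrite ?add0r // addr0 ltnS; case: ifP; rewrite addr0.
by rewrite !hornerE; ring.
Qed.

Lemma der_scale c : derivation (fun x => c * D x).
Proof.
by split=> x y; rewrite ?(derD hD) ?(derM hD); ring.
Qed.

End Derivations.

Section DerivationOfT.
Variables (p : nat) (Om : fieldType) (t : Om).
Hypothesis hp : prime p.
Hypothesis hOm : is_sepclosure_Fpt p t.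
Local Notation k := (@Fpbar p Om).
Local Notation Gal := (Defs.gal t k).

Let hch : p \in [pchar Om] := Om_pchar hOm.
Let ksub : is_subfield k := Fpbar_subfield hp hch.

Definition pth (y : Om) := exists x, x ^+ p = y.

Lemma pth_subfield : is_subfield pth.
Proof.
split; first by exists 1; rewrite expr1n.
- move=> _ _ [x <-] [y <-]; exists (x - y).
  by have := FrobB hp hch 1 x y; rewrite expn1.
- by move=> _ _ [x <-] [y <-]; exists (x * y); rewrite exprMn.
- by move=> _ [x <-]; exists x^-1; rewrite exprVn.
Qed.

Lemma pth_const c : k c -> pth c.
Proof. by move=> /(Fpbar_root hp hch)[y _ <-]; exists y. Qed.

(** A p-th root [z] of [t] would satisfy a separable equation f(t, z) = 0. Put h(Z) = f(Z^p, Z): it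
    vanishes at [z], hence identically, whereas h'(z) is the derivative of f in its second variable,
    since Z^p has derivative 0. *)
Lemma t_not_pth : ~ pth t.
Proof.
move=> [z zt].
have [f [sf rf _ [g fg]]] := separable_poly_of hOm z.
have kint (c : {poly int}) : poly_over k (map_poly intr c).
  move=> j; rewrite coef_map /=; case: (c`_j) => n.
    by rewrite -pmulrn; apply: subfield_nat.
  by rewrite NegzE mulrNz; apply: subfieldN => //; rewrite -pmulrn; apply: subfield_nat.
pose h : {poly Om} := \sum_(i < size g) (map_poly intr g`_i \Po 'X^p) * 'X^i.
have evz c : (map_poly intr c \Po 'X^p).[z] = (map_poly intr c).[t] :> Om.
  by rewrite horner_comp hornerXn zt.
have fi i : f`_i = (map_poly intr g`_i).[t].
  by rewrite fg /eval_at coef_map_id0 ?rmorph0 ?horner0.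
have szf : (size f <= size g)%N by rewrite fg size_poly.
have hz : h.[z] = f.[z].
  rewrite horner_sum (horner_coef_wide _ szf); apply: eq_bigr => i _.
  by rewrite hornerM hornerXn evz fi.
have Xp0 : ('X^p : {poly Om})^`() = 0.
  by rewrite derivXn -mulr_natr -polyC_natr (pcharf0 hch) mulr0.
have h'z : h^`().[z] = f^`().[z].
  have szf' : (size f^`() <= size g)%N by rewrite (leq_trans (leq_trans (size_poly _ _) (leq_pred _))).
  rewrite raddf_sum horner_sum.
  have -> : f = \poly_(i < size g) f`_i.
    by apply/polyP => i; rewrite coef_poly; case: ltnP => // ge; rewrite nth_default // (leq_trans szf).
  rewrite poly_def raddf_sum horner_sum; apply: eq_bigr => i _.
  by rewrite /= derivM deriv_comp Xp0 mulr0 mul0r add0r derivZ hornerM hornerZ evz fi.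
have h0 : h = 0.
  (* Raising the coefficients to the power p gives hF(t) = h(z)^p, to which the transcendence of [t]
     applies. *)
  pose hF := \poly_(i < size h) h`_i ^+ p.
  have kh : poly_over k h.
    move=> j; rewrite coef_sum; apply: subfield_sum => // i _.
    apply: poly_overM => //; last by apply: poly_overXn => //; apply: poly_overX.
    by apply: poly_over_comp => //; apply: poly_overXn => //; apply: poly_overX.
  have hFt : hF.[t] = 0.
    have -> : hF.[t] = h.[z] ^+ p.
      rewrite horner_poly horner_coef -[p]expn1 (big_morph _ (FrobD hp hch 1) (id1 := 0)).
        by apply: eq_bigr => i _; rewrite expn1 exprMn -zt exprAC.
      by rewrite expn1 expr0n eqn0Ngt prime_gt0.
    by rewrite hz (eqP rf) expr0n eqn0Ngt prime_gt0.
  have hF0 : hF = 0.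
    apply: (Fpbar_transcendental hp hOm) => //.
    by apply: poly_over_poly => // i _; apply: subfieldX.
  apply/polyP => i; have := congr1 (fun c : {poly Om} => c`_i) hF0.
  rewrite coef_poly !coef0; case: ltnP => [_|ge _]; last by rewrite nth_default.
  by move=> /eqP; rewrite expf_eq0 => /andP[_ /eqP].
move: sf; rewrite unlock => /coprimep_root /(_ rf).
by rewrite -h'z h0 deriv0 horner0 eqxx.
Qed.

(** Om^p[t] is a field, the inverse of y being y^(p-1) / y^p. Each [x] is separable over it, and
    also purely inseparable as x^p lies in it, so [x] belongs to it. *)
Lemma pth_t_generate x : exists2 A, poly_over pth A & x = A.[t].
Proof.
pose S y := exists2 A, poly_over pth A & y = A.[t].
have ps := pth_subfield.
have Spth y : S (y ^+ p).
  by exists (y ^+ p)%:P; rewrite ?hornerC //; apply: poly_overC => //; exists y.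
have SM y z : S y -> S z -> S (y * z).
  by move=> [A pA ->] [B pB ->]; exists (A * B); rewrite ?hornerM //; apply: poly_overM.
have Ssub : is_subfield S.
  split=> //; first by have := Spth 1; rewrite expr1n.
    by move=> y z [A pA ->] [B pB ->]; exists (A - B); rewrite ?hornerE //; apply: poly_overB.
  move=> y Sy; have [->|y0] := eqVneq y 0; first by have := Spth 0; rewrite expr0n eqn0Ngt prime_gt0 // invr0.
  have -> : y^-1 = y ^+ p.-1 * y^-1 ^+ p.
    rewrite -[in y^-1 ^+ p](prednK (prime_gt0 hp)) exprS mulrCA -exprMn divff // expr1n mulr1.
    by [].
  apply: (SM) => //; elim: p.-1 => [|n IH]; last by rewrite exprS; apply: (SM).
  by rewrite expr0; have := Spth 1; rewrite expr1n.
have St : S t by exists 'X; rewrite ?hornerX //; apply: poly_overX.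
have [K [i iK]] := subfield_type Ssub.
have [w iw] := (iK t).1 St.
apply: (iK x).2.
have [g [sg rg]] := Om_separable hOm x.
move: sg rg; rewrite -iw eval_at_map => sg rg.
have [a ia] := (iK _).1 (Spth x).
apply: (separable_inseparable hp hch rg _ (esym ia)).
by move: sg; rewrite unlock => /coprimep_root; apply.
Qed.

(** Otherwise [t] would be separable over Om^p, hence a p-th power. This makes d/dt independent of
    the expression A(t) chosen for an element. *)
Lemma pth_deriv_wd A : poly_over pth A -> A.[t] = 0 -> A^`().[t] = 0.
Proof.
move=> pA A0; apply/eqP; apply: contraT => dA.
have [K [i iK]] := subfield_type pth_subfield.
have [|A' A'E] := @poly_lift _ _ i A; first by move=> j; apply/iK.
have [a ia] : exists a, i a = t ^+ p by apply/iK; exists t.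
apply: boolp.contrapT => _; apply: t_not_pth; apply: (iK t).2.
apply: (separable_inseparable hp hch (q := A') (x := t) _ _ (esym ia)); rewrite A'E //.
by apply/eqP.
Qed.

(* d/dt: by separability every element of [Om] is a polynomial in [t] over the
   p-th powers, on which d/dt vanishes. *)
Definition ddt (x : Om) : Om :=
  if boolp.pselect (exists2 A, poly_over pth A & x = A.[t]) is left h
  then (sval (boolp.cid2 h))^`().[t] else 0.

Lemma ddt_poly A : poly_over pth A -> ddt A.[t] = A^`().[t].
Proof.
move=> pA; rewrite /ddt; case: boolp.pselect => [h|[]]; last by exists A.
case: (boolp.cid2 h) => /= B pB /eqP; rewrite eq_sym -subr_eq0 => /eqP e.
have := @pth_deriv_wd (B - A); rewrite derivB !hornerE e => /(_ _ erefl) h'.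
apply/eqP; rewrite -subr_eq0; apply/eqP/h'.
by apply: poly_overB => //; apply: pth_subfield.
Qed.

Lemma ddt_derivation : derivation ddt.
Proof.
have ps := pth_subfield.
split=> x y; have [A pA ->] := pth_t_generate x; have [B pB ->] := pth_t_generate y.
  have pAB := poly_overD ps pA pB.
  by rewrite -hornerD (ddt_poly pAB) derivD hornerD !ddt_poly.
have pAB := poly_overM ps pA pB.
by rewrite -hornerM (ddt_poly pAB) derivM !hornerE !ddt_poly.
Qed.

Lemma ddt_kpoly A : poly_over k A -> ddt A.[t] = A^`().[t].
Proof. by move=> kA; apply: ddt_poly => i; apply: pth_const. Qed.

Lemma ddt_const c : k c -> ddt c = 0.
Proof.
move=> kc; rewrite -(hornerC c t) ddt_kpoly ?derivC ?horner0 //.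
exact: poly_overC.
Qed.

Lemma ddt_t : ddt t = 1.
Proof.
by rewrite -{1}(hornerX t) ddt_kpoly ?derivX ?hornerC //; apply: poly_overX.
Qed.

Lemma ddt_gal s x : Gal s -> ddt (s x) = s (ddt x).
Proof.
move=> [st sk]; have [A pA ->] := pth_t_generate x.
rewrite ddt_poly // -!(horner_map s) st -deriv_map ddt_poly // => i.
by have [y yA] := pA i; exists (s y); rewrite coef_map /= -yA rmorphXn.
Qed.

Lemma ddt_iter n A : poly_over pth A -> iter n ddt A.[t] = A^`(n).[t].
Proof.
move=> pA; elim: n => [|n IH] //=.
rewrite IH ddt_poly //; elim: n {IH} => [|n IHn]; first by rewrite derivn0.
by rewrite derivnS; apply: poly_over_deriv => //; apply: pth_subfield.
Qed.

Lemma derivn_pchar (A : {poly Om}) : A^`(p) = 0.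
Proof.
apply/polyP => i; rewrite coef_derivn coef0 addnC -mulr_natr.
have /dvdnP[c ->] : (p %| (i + p) ^_ p)%N.
  by rewrite -bin_ffact dvdn_mull // dvdn_fact // prime_gt0 //=.
by rewrite natrM (pcharf0 hch) !mulr0.
Qed.

Lemma ddt_iter_pchar x : iter p ddt x = 0.
Proof.
have [A pA ->] := pth_t_generate x.
by rewrite ddt_iter // derivn_pchar horner0.
Qed.

(** Differentiating deg A times leaves the leading coefficient times the factorial of deg A, which
    is prime to p. *)
Lemma pth_t_free A : poly_over pth A -> (size A <= p)%N -> A.[t] = 0 -> A = 0.
Proof.
move=> pA szA A0; apply/eqP; apply: contraT => nA.
have n0 n : A^`(n).[t] = 0.
  rewrite -ddt_iter // A0; elim: n => // n IH; rewrite iterS IH.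
  exact: der0 ddt_derivation.
have := n0 (size A).-1.
have -> : A^`((size A).-1) = (lead_coef A *+ (size A).-1`!)%:P.
  apply/polyP => -[|i]; rewrite coef_derivn coefC /=.
    by rewrite addn0 ffactnn.
  rewrite nth_default ?mul0rn //.
  by rewrite addnS -addSn prednK ?leq_addr // size_poly_gt0.
rewrite hornerC -mulr_natr => /eqP; rewrite mulf_eq0 lead_coef_eq0 (negPf nA) /=.
have lt : ((size A).-1 < p)%N by rewrite prednK // size_poly_gt0.
rewrite -(dvdn_pcharf hch); elim: (size A).-1 lt => [|n IH] lt.
  by rewrite dvdn1 => /eqP p1; have := hp; rewrite p1.
rewrite factS Euclid_dvdM // => /orP[|/IH]; first by rewrite gtnNdvd.
by apply; apply: ltnW.
Qed.

Lemma ddt_ker x : ddt x = 0 -> pth x.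
Proof.
have ps := pth_subfield.
have [A pA ->] := pth_t_generate x.
have [K [i iK]] := subfield_type pth_subfield.
have [|A' A'E] := @poly_lift _ _ i A; first by move=> j; apply/iK.
have [a ia] : exists a, i a = t ^+ p by apply/iK; exists t.
(* Reduction modulo X^p - t^p gives an expression of degree less than p. By [pth_t_free] its
   derivative is then zero as a polynomial, so only the constant term is left. *)
pose B := A' %% ('X^p - a%:P).
have iB : poly_over pth (map_poly i B) by move=> j; rewrite coef_map; apply/iK; exists B`_j.
have BA : (map_poly i B).[t] = A.[t].
  rewrite -A'E [in RHS](divp_eq A' ('X^p - a%:P)) rmorphD rmorphM rmorphB /= !hornerE.
  by rewrite map_polyXn map_polyC !hornerE /= ia subrr mulr0 add0r.
have szX : size ('X^p - a%:P) = p.+1 by apply: size_XnsubC; apply: prime_gt0.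
have szB : (size B <= p)%N.
  by rewrite -ltnS -szX ltn_modp -size_poly_eq0 szX.
rewrite -BA ddt_poly // => /pth_t_free dB0.
have {}dB0 : (map_poly i B)^`() = 0.
  apply: dB0; first by apply: poly_over_deriv.
  apply: leq_trans (size_poly _ _) _; rewrite size_map_poly.
  exact: leq_trans (leq_pred _) szB.
suff -> : map_poly i B = ((map_poly i B)`_0)%:P by rewrite hornerC; apply: iB.
apply/polyP => -[|j]; rewrite coefC //=.
have [lt|ge] := ltnP j.+1 p; last by rewrite nth_default // size_map_poly (leq_trans szB).
have := congr1 (fun c : {poly Om} => c`_j) dB0; rewrite coef_deriv coef0 -mulr_natr.
move/eqP; rewrite mulf_eq0 => /orP[/eqP//|].
by rewrite -(dvdn_pcharf hch) gtnNdvd.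
Qed.

End DerivationOfT.

(** * The derivation d/du at a place *)

Section LocalDerivation.
Variables (p : nat) (Om : fieldType) (t : Om).
Hypothesis hp : prime p.
Hypothesis hOm : is_sepclosure_Fpt p t.
Local Notation k := (@Fpbar p Om).
Local Notation Gal := (Defs.gal t k).
Local Notation ratfun := (@ratfun p Om t).
Local Notation inertia_gal v := (@inertia_gal p Om t v).

Let ksub : is_subfield k := Fpbar_subfield hp (Om_pchar hOm).

Variables (v : Om -> rat) (u : Om).
Hypothesis hu : uniformizer p t u.
Hypothesis hv : place_over u v.

Let vv : valuation v := hv.1.
Let u0 : u != 0 := uniformizer_neq0 hp hOm hu.
Let hD := ddt_derivation hp hOm.
Local Notation ddt := (ddt p t).

Lemma ddt_u_neq0 : ddt u != 0.
Proof.
have t1 := ddt_t hp hOm.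
case: (hu) => [[a ka ->]|ut].
  by rewrite (derB hD) t1 (ddt_const hp hOm ka) subr0 oner_neq0.
have t0 : t != 0 by rewrite -invr_eq0 -ut.
by rewrite ut (derV hD) // t1 mulf_neq0 ?oppr_eq0 ?oner_eq0 // invr_eq0 expf_neq0.
Qed.

Definition ddu x := (ddt u)^-1 * ddt x.

Lemma ddu_derivation : derivation ddu. Proof. exact: der_scale hD _. Qed.
Let hDu := ddu_derivation.

Lemma ddu_u : ddu u = 1. Proof. by rewrite /ddu mulVf // ddt_u_neq0. Qed.

Lemma ddu_const c : k c -> ddu c = 0.
Proof. by move=> kc; rewrite /ddu (ddt_const hp hOm kc) mulr0. Qed.

Lemma ddu_kpoly A : poly_over k A -> ddu A.[u] = A^`().[u].
Proof.
move=> kA; rewrite (der_horner hDu) ddu_u mulr1 (_ : \poly_(i < size A) ddu A`_i = 0).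
  by rewrite horner0 add0r.
by apply/polyP => i; rewrite coef_poly coef0 ddu_const //; case: ifP.
Qed.

Lemma ratfun_ddu x : ratfun x -> val_ge v 0 x -> val_ge v 0 (ddu x).
Proof.
move=> rx /(ratfun_integral hp hOm hu hv rx)[A [B [kA kB nB ->]]].
have [B0 vB] := val_poly_unit hp hv kB nB.
have vk C : poly_over k C -> val_ge v 0 C.[u].
  by move=> kC; have [] := val_poly hp hv kC.
rewrite (der_div hDu) // !ddu_kpoly // -[0]addr0; apply: val_geM => //; last first.
  by rewrite val_geN0 ?invr_eq0 ?expf_neq0 // valV ?expf_neq0 // valX // vB mulr0 oppr0.
by apply: val_geB => //; rewrite -[0]addr0; apply: val_geM => //; apply: vk => //;
  apply: poly_over_deriv.
Qed.

Lemma ddu_Xz (m : int) : val_ge v (m%:~R - 1) (ddu (u ^ m)).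
Proof.
have vnat n : val_ge v 0 (n%:R : Om) by apply: (val_ge_const hp hv); apply: subfield_nat.
case: m => n.
  rewrite -exprnP (derX hDu) ddu_u mulr1; case: n => [|n].
    by rewrite mul0r val_ge0.
  rewrite -[_ - 1]add0r; apply: val_geM => //=; rewrite -pmulrn -natr1 addrK.
  by rewrite val_geN0 ?expf_neq0 // valX // hv.2 mulr1.
rewrite NegzE -exprnN (derV hDu) ?expf_neq0 // (derX hDu) ddu_u mulr1 /=.
have -> : - (n.+1%:R * u ^+ n) / u ^+ n.+1 ^+ 2 = - n.+1%:R * u ^- n.+2.
  by rewrite !exprS; field; rewrite expf_neq0 // u0.
rewrite -[_ - 1]add0r; apply: val_geM => //; first by rewrite val_geN.
rewrite val_geN0 ?invr_eq0 ?expf_neq0 // valV ?expf_neq0 // valX // hv.2 mulr1.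
by rewrite mulrNz -pmulrn -[n.+2%:R]natr1 opprD.
Qed.

Variable x : Om.
Hypothesis hx : forall s, inertia_gal v s -> s x = x.

(* Newton's lemma: near [x], the minimal polynomial of [x] over the rational
   functions becomes an integral polynomial with invertible derivative. *)
Lemma inertia_fixed_ddu_integral : val_ge v 0 x -> val_ge v 0 (ddu x).
Proof.
move=> x_ge0; have oG := subgroup_Gal hOm.
pose O := orb Gal x; pose O' := rem x O.
have uO : uniq O := orb_uniq hOm oG x.
have xO : x \in O := orb_id hOm oG x.
have O'P y : y \in O' -> y \in O /\ y != x.
  by rewrite /O' rem_filter // mem_filter /= => /andP[].
(* [N] exceeds the valuations of the differences between [x] and its other conjugates. Writing x = g
   + u^N x' with [g] rational, all conjugates of [x'] but [x'] itself then have poles. *)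
have [N hN] : exists N : nat, forall y, y \in O' -> v (y - x) < N%:R.
  elim: O' {O'P} => [|y l [N hN]]; first by exists 0%N.
  exists (N + (Num.truncn (v (y - x))).+1)%N => z; rewrite inE natrD.
  case/orP => [/eqP->|/hN h].
    apply: lt_le_trans (Num.Theory.truncnS_gt _) _.
    by rewrite lerDr.
  by apply: lt_le_trans h _; rewrite lerDl.
have [g rg hg] := inertia_fixed_approx hp hOm hu hv hx N%:R.
have uN0 : u ^+ N != 0 by rewrite expf_neq0.
pose f y := (y - g) / u ^+ N.
pose x' : Om := f x.
have xE : x = g + u ^+ N * x' by rewrite /x' /f mulrCA divff // mulr1 addrC subrK.
have vuN : v (u ^+ N) = N%:R by rewrite valX // hv.2 mulr1.
have x'_ge0 : val_ge v 0 x'.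
  rewrite -(subrr N%:R); apply: val_geM => //.
  by rewrite val_geN0 ?invr_eq0 // valV // vuN.
have hy y : y \in O' -> f y != 0 /\ v (f y) < 0.
  move=> yO'; have [_ nyx] := O'P y yO'.
  have [yg0 vyg] : y - g != 0 /\ v (y - g) = v (y - x).
    apply: valD_eqr; rewrite ?subr_eq0 //.
    rewrite (_ : y - g - (y - x) = x - g); last by ring.
    by apply: (val_ge_gt _ hg); apply: hN.
  rewrite mulf_neq0 ?invr_eq0 // val_div // vyg vuN subr_lt0; split=> //.
  exact: hN.
(* Scaled to constant coefficient 1, the factors of the other conjugates are congruent to 1, so that
   (X - x') P is congruent to X - x'. *)
pose P := \prod_(y <- O') (1 - (f y)^-1 *: 'X).
have PE : P`_0 = 1 /\ forall i, val_gt v 0 (P - 1)`_i.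
  rewrite /P big_seq; apply: (big_ind (fun Q : {poly Om} => Q`_0 = 1 /\ forall i, val_gt v 0 (Q - 1)`_i)).
  - by rewrite coefC subrr; split=> // i; rewrite coef0 val_gt0.
  - move=> Q R [Q0 hQ] [R0 hR]; split; first by rewrite coef0M Q0 R0 mulr1.
    have -> : Q * R - 1 = (Q - 1) * (R - 1) + (Q - 1) + (R - 1) by ring.
    move=> i; rewrite !coefD; apply: val_gtD => //; last by have := hR i; rewrite coefD.
    apply: val_gtD => //; last by have := hQ i; rewrite coefD.
    rewrite coefM; apply: val_gt_sum => // j _; rewrite -[0]addr0; apply: val_gtM => //.
    exact: val_gt_ge.
  - move=> y yO'; have [f0 vf] := hy y yO'.
    split; first by rewrite coefB coefZ coefX coefC mulr0 subr0.
    move=> i; rewrite addrAC subrr add0r coefN val_gtN // coefZ coefX.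
    case: (i == 1)%N; last by rewrite mulr0 val_gt0.
    by rewrite mulr1 val_gtN0 ?invr_eq0 // valV // oppr_gt0.
have [P0 Pi] := PE.
have PiS i : val_gt v 0 P`_i.+1 by have := Pi i.+1; rewrite coefB coefC subr0.
have PiZ i : val_ge v 0 P`_i.
  case: i => [|i]; last exact: val_gt_ge.
  by rewrite P0 val_geN0 ?oner_neq0 // val1.
have Px' : val_gt v 0 (P.[x'] - 1).
  have -> : P.[x'] - 1 = (P - 1).[x'] by rewrite !hornerE.
  rewrite horner_coef; apply: val_gt_sum => // i _; rewrite -[0]addr0.
  apply: val_gtM => //; rewrite -[0](mulr0 (i%:R : rat)); exact: val_geX.
have [Px0 vPx] := val_unit_eq vv (oner_neq0 _) (val1 vv) Px'.
pose G := ('X - x'%:P) * P.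
have G1 : val_gt v 0 (G`_1 - 1).
  rewrite /G mulrBl coefB coefXM coefCM P0 addrAC subrr add0r val_gtN //.
  by rewrite mulrC -[0]addr0; apply: val_gtM.
have [G10 vG1] := val_unit_eq vv (oner_neq0 _) (val1 vv) G1.
have GZ i : val_ge v 0 G`_i.
  rewrite /G mulrBl coefB coefXM coefCM; apply: val_geB => //.
    by case: eqP => // _; apply: val_ge0.
  by rewrite -[0]addr0; apply: val_geM.
(* Dividing by the linear coefficient, which is a unit, makes the coefficients rational: [F] is also
   the Galois-invariant product [F0] divided by its own linear coefficient. *)
pose F := (G`_1)^-1 *: G.
have FZ i : val_ge v 0 F`_i.
  rewrite coefZ -[0]addr0; apply: val_geM => //.
  by rewrite val_geN0 ?invr_eq0 // valV // vG1 oppr0.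
pose F0 := \prod_(y <- O) ('X - (f y)%:P).
have [c c0 GF0] : exists2 c, c != 0 & G = c *: F0.
  exists (\prod_(y <- O') (- (f y)^-1)).
    rewrite prodf_seq_neq0; apply/allP => y yO'; apply/implyP => _.
    by rewrite oppr_eq0 invr_eq0; case: (hy y yO').
  rewrite /F0 (perm_big _ (perm_to_rem xO)) big_cons -/O' -/x' scalerAr; congr (_ * _).
  rewrite -mul_polyC rmorph_prod -big_split /= /P big_seq [RHS]big_seq; apply: eq_bigr => y yO'.
  have [f0 _] := hy y yO'.
  by rewrite mulrBr -polyCM mulNr mulVf // polyCN mulNr mul_polyC polyCN opprK polyC1 addrC.
have F0g s : Gal s -> map_poly s F0 = F0.
  move=> Gs; have sf y : s (f y) = f (s y).
    rewrite fmorph_div rmorphB rmorphXn /= (gal_u hp hOm hu Gs).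
    by rewrite (gal_ratfun Gs rg).
  rewrite rmorph_prod /= [RHS](perm_big (map s O)); last by rewrite perm_sym; apply: (orb_perm hOm oG).
  rewrite big_map; apply: eq_bigr => y _.
  by rewrite rmorphB /= map_polyX map_polyC /= sf.
have Frat i : ratfun F`_i.
  have -> : F`_i = F0`_i / F0`_1.
    rewrite coefZ GF0 !coefZ mulrC.
    have F01 : F0`_1 != 0 by apply: contraNneq G10 => e; rewrite GF0 coefZ e mulr0.
    by field; apply/andP.
  apply: (ratfun_fixed hp hOm) => s Gs.
  by rewrite fmorph_div -!coef_map F0g.
have Fx' : F.[x'] = 0 by rewrite hornerZ hornerM hornerXsubC subrr mul0r mulr0.
have F'x' : F^`().[x'] = (G`_1)^-1 * P.[x'].
  by rewrite derivZ derivM derivXsubC hornerZ hornerD !hornerM hornerXsubC subrr mul0r addr0 hornerC mul1r.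
have dx' : val_ge v 0 (ddu x').
  have := der_horner hDu F x'; rewrite Fx' (der0 hDu) F'x' => /esym/eqP.
  rewrite addr_eq0; set q := (\poly_(i < size F) ddu F`_i).[x'] => /eqP h.
  have -> : ddu x' = - (G`_1 * P.[x']^-1 * q) by rewrite h; field; apply/andP.
  rewrite val_geN // -[0]addr0; apply: val_geM => //.
    by rewrite val_geN0 ?mulf_neq0 ?invr_eq0 // val_div // vG1 vPx subrr.
  rewrite /q horner_poly; apply: val_ge_sum => // i _; rewrite -[0]addr0.
  apply: val_geM => //; first exact: ratfun_ddu.
  by rewrite -[0](mulr0 (i%:R : rat)); apply: val_geX.
have g_ge0 : val_ge v 0 g.
  have -> : g = x - (x - g) by ring.
  by apply: val_geB => //; apply: (val_ge_le _ hg).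
rewrite xE (derD hDu) (derM hDu); apply: val_geD => //; first exact: ratfun_ddu.
apply: val_geD => //; rewrite -[0]addr0; apply: val_geM => //.
  have h := ddu_Xz N; rewrite -exprnP in h.
  case: N {hN hg uN0 f x' xE vuN x'_ge0 hy P PE P0 Pi PiS PiZ Px' Px0 vPx G G1 G10 vG1 GZ F FZ F0 c c0 GF0 F0g Frat Fx' F'x' dx'} h => [|N] h.
    by rewrite expr0 (der1 hDu) val_ge0.
  by apply: (val_ge_le _ h); rewrite -pmulrn -natr1 addrK.
by rewrite val_geN0 // vuN.
Qed.
End LocalDerivation.

Section InertiaFixedDerivation.
Variables (p : nat) (Om : fieldType) (t : Om).
Hypothesis hp : prime p.
Hypothesis hOm : is_sepclosure_Fpt p t.
Variables (v : Om -> rat) (u : Om).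
Hypothesis hu : uniformizer p t u.
Hypothesis hv : place_over u v.

Lemma inertia_fixed_ddu (x : Om) c : (forall s, inertia_gal p t v s -> s x = x) ->
  val_ge v c x -> val_ge v (c - 1) (ddu p t u x).
Proof.
move=> hx; have hDu := ddu_derivation hp hOm u.
have [->|x0] := eqVneq x 0; first by rewrite (der0 hDu) => _; apply: val_ge0.
have u0 := uniformizer_neq0 hp hOm hu.
have vv : valuation v := hv.1.
have [m vx] := inertia_fixed_val hp hOm hu hv hx x0.
rewrite val_geN0 // => hc; have um0 n : u ^ n != 0 by rewrite expfz_neq0.
have xE : x = u ^ m * (x * u ^ (- m)) by rewrite mulrCA -expfzDr // subrr expr0z mulr1.
have x'_ge0 : val_ge v 0 (x * u ^ (- m)).
  by rewrite val_geN0 ?mulf_neq0 // valM // valZ // vx hv.2 mulr1 rmorphN subrr.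
have hx' s : inertia_gal p t v s -> s (x * u ^ (- m)) = x * u ^ (- m).
  move=> Js; rewrite rmorphM hx // rmorphXz ?unitfE // (gal_u hp hOm hu); first by [].
  by case: Js.
have d' := inertia_fixed_ddu_integral hp hOm hu hv hx' x'_ge0.
rewrite xE (derM hDu); apply: (val_ge_le (d := m%:~R - 1)); first by rewrite -vx; lra.
apply: val_geD => //.
  by rewrite -[_ - 1]addr0; apply: val_geM => //; apply: ddu_Xz.
apply: (val_ge_le (d := m%:~R + 0)); first by lra.
by apply: val_geM => //; rewrite val_geN0 // valZ // hv.2 mulr1.
Qed.

End InertiaFixedDerivation.

(** * Interpolation with control of valuations *)

Lemma interpolation (L : fieldType) (I : eqType) (a b : I -> L) (l : seq I) :
  injective a -> uniq l ->
  exists2 P : {poly L}, (size P <= size l)%N & forall i, i \in l -> P.[a i] = b i.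
Proof.
move=> inja; elim: l => [|i l IH] /=; first by exists 0; rewrite ?size_poly0.
move=> /andP[il ul]; have [P szP hP] := IH ul.
pose W := \prod_(j <- l) ('X - (a j)%:P).
have W0 : W.[a i] != 0.
  rewrite horner_prod prodf_seq_neq0; apply/allP => j jl; apply/implyP => _.
  by rewrite hornerXsubC subr_eq0; apply: contraNneq il => /inja->.
exists (P + ((b i - P.[a i]) / W.[a i]) *: W).
  rewrite (leq_trans (size_polyD _ _)) // geq_max (leq_trans szP) //=.
  by rewrite (leq_trans (size_scale_leq _ _)) // size_prod_XsubC.
move=> j; rewrite inE hornerD hornerZ => /orP[/eqP->|jl].
  by rewrite divfK // addrC subrK.
have -> : W.[a j] = 0 by rewrite horner_prod (big_rem j) //= hornerXsubC subrr mul0r.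
by rewrite hP // mulr0 addr0.
Qed.

(** Divided differences, with [C] collecting the losses from divisions by b - a. As a consequence, a
    monic polynomial of degree less than the number of points cannot be too small at all of them. *)
Lemma val_interpolation (L : fieldType) (v : L -> rat) (l : seq L) :
  valuation v -> uniq l -> exists C : rat, forall (N : rat) (Q : {poly L}),
    (size Q <= size l)%N -> (forall a, a \in l -> val_ge v N Q.[a]) ->
    forall i, val_ge v (N - C) Q`_i.
Proof.
move=> vv; elim: l => [|a l IH] /=.
  move=> _; exists 0 => N Q; rewrite leqn0 size_poly_eq0 => /eqP-> _ i.
  by rewrite coef0 val_ge0.
move=> /andP[al ul]; have [C hC] := IH ul.
have [B B0 hB] : exists2 B : rat, 0 <= B & forall b, b \in l -> v (b - a) <= B.
  elim: l {al ul IH hC} => [|b l [B B0 hB]]; first by exists 0.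
  exists (Num.max (v (b - a)) B); first by rewrite le_max B0 orbT.
  by move=> c; rewrite inE => /orP[/eqP->|/hB h]; rewrite le_max ?lexx ?h ?orbT.
pose A : rat := Num.max 0 (- v a).
have A0 : 0 <= A by rewrite le_max lexx.
have hA : val_ge v (- A) a.
  by apply: (val_ge_le _ (val_ge_id v a)); rewrite lerNl le_max lexx orbT.
exists (Num.max 0 C + B + A) => N Q szQ hQ.
have CC : C <= Num.max 0 C by rewrite le_max lexx orbT.
have C0 : 0 <= Num.max 0 C by rewrite le_max lexx.
have [Q1 Q1E] : exists Q1, Q - (Q.[a])%:P = Q1 * ('X - a%:P).
  by apply: factor_theorem; rewrite /root !hornerE subrr.
have QE : Q = Q1 * ('X - a%:P) + (Q.[a])%:P by rewrite -Q1E subrK.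
have szQ1 : (size Q1 <= size l)%N.
  have [->|Q10] := eqVneq Q1 0; first by rewrite size_poly0.
  have : (size (Q - (Q.[a])%:P)%R <= (size l).+1)%N.
    rewrite (leq_trans (size_polyD _ _)) // geq_max szQ size_polyN.
    by rewrite (leq_trans (size_polyC_leq1 _)).
  by rewrite Q1E size_mul ?polyXsubC_eq0 // size_XsubC addn2.
have hQ1 := hC (N - B) Q1 szQ1.
have {}hQ1 i : val_ge v (N - B - C) Q1`_i.
  apply: hQ1 => b bl; have ba : b - a != 0.
    by rewrite subr_eq0; apply: contraNneq al => <-.
  have -> : Q1.[b] = (Q.[b] - Q.[a]) / (b - a).
    by rewrite [in Q.[b]]QE !hornerE addrK mulfK.
  apply: val_geM => //.
    by apply: val_geB => //; apply: hQ; rewrite inE ?eqxx ?bl ?orbT.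
  by rewrite val_geN0 ?invr_eq0 // valV // lerN2 hB.
move=> i; rewrite QE coefD mulrBr coefB coefMX coefMC coefC.
apply: val_geD => //; last first.
  case: (i == 0)%N; last exact: val_ge0.
  by apply: (val_ge_le _ (hQ a (mem_head _ _))); lra.
apply: val_geB => //.
  case: (i == 0)%N; first exact: val_ge0.
  by apply: (val_ge_le _ (hQ1 i.-1)); lra.
apply: (val_ge_le (d := (N - B - C) + (- A))); first by lra.
exact: val_geM.
Qed.

(** * Finite layers *)

Section LayerExistence.
Variables (p : nat) (Om : fieldType) (t : Om).
Hypothesis hp : prime p.
Hypothesis hOm : is_sepclosure_Fpt p t.
Local Notation k := (@Fpbar p Om).
Local Notation Gal := (Defs.gal t k).
Local Notation ratfun := (@ratfun p Om t).

Let ksub : is_subfield k := Fpbar_subfield hp (Om_pchar hOm).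
Let oG := subgroup_Gal hOm.

Lemma generic_sum (x y : Om) : exists2 c, k c & c != 0 /\ forall s s', Gal s -> Gal s' ->
  s (x + c * y) = s' (x + c * y) -> s x = s' x /\ s y = s' y.
Proof.
pose l := [seq (ab.1 - ab.2) / (de.2 - de.1) |
  ab <- [seq (a, b) | a <- orb Gal x, b <- orb Gal x],
  de <- [seq (d, e) | d <- orb Gal y, e <- orb Gal y]].
have [c kc] := Fpbar_infinite hp hOm (0 :: l); rewrite inE negb_or => /andP[c0 cl].
exists c => //; split=> // s s' Gs Gs'; rewrite !rmorphD !rmorphM /= (Gs.2 c kc) (Gs'.2 c kc) => e.
have [sy|sy] := eqVneq (s y) (s' y).
  by split=> //; move: e; rewrite sy; apply: addIr.
have e' : s x - s' x = c * (s' y - s y).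
  have -> : s x = s' x + c * s' y - c * s y by rewrite -e addrK.
  by ring.
case/negP: cl; apply/allpairsP; exists ((s x, s' x), (s y, s' y)); split.
- by apply/allpairsP; exists (s x, s' x); split=> //; apply/(orbP hOm oG); [exists s|exists s'].
- by apply/allpairsP; exists (s y, s' y); split=> //; apply/(orbP hOm oG); [exists s|exists s'].
by rewrite /= e' mulfK // subr_eq0 eq_sym.
Qed.

Lemma primitive_element (ys : seq Om) : exists th, forall s s', Gal s -> Gal s' ->
  (s th = s' th <-> {in ys, s =1 s'}).
Proof.
elim: ys => [|y ys [th hth]]; first by exists 0 => s s' _ _; rewrite !rmorph0; split.
have [c kc [c0 hc]] := generic_sum th y.
exists (th + c * y) => s s' Gs Gs'; split.
  move=> /(hc s s' Gs Gs')[/(hth s s' Gs Gs') h sy] z.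
  by rewrite inE => /orP[/eqP->|/h].
move=> h; rewrite !rmorphD !rmorphM /= (Gs.2 c kc) (Gs'.2 c kc) (h y) ?mem_head //.
by congr (_ + _); apply/(hth s s' Gs Gs') => z zl; rewrite h // inE zl orbT.
Qed.

(* Membership in the field k(t)(ys), as described by Galois theory. *)
Definition in_layer (ys : seq Om) x :=
  forall s, Gal s -> {in ys, forall y, s y = y} -> s x = x.

Lemma in_layer_agree ys x s s' : in_layer ys x -> Gal s -> Gal s' ->
  {in ys, s =1 s'} -> s x = s' x.
Proof.
move=> hx Gs Gs' e; have [r [Gr s'r rs']] := gal_inv hOm Gs'.
rewrite -[LHS]rs' -[s x]/(s x); congr (s' _).
have := hx (r \o s) (gal_comp Gr Gs); apply=> y yl /=.
by rewrite e // s'r.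
Qed.

Lemma in_layer_mem ys y : y \in ys -> in_layer ys y.
Proof. by move=> yl s _ ->. Qed.

Lemma in_layer_subfield ys : is_subfield (in_layer ys).
Proof.
split=> [s _ _|x y hx hy s Gs fs|x y hx hy s Gs fs|x hx s Gs fs].
- exact: rmorph1.
- by rewrite rmorphB hx // hy.
- by rewrite rmorphM hx // hy.
- by rewrite fmorphV hx.
Qed.

Lemma in_layer_ratfun ys x : ratfun x -> in_layer ys x.
Proof. by move=> rx s Gs _; apply: (gal_ratfun Gs rx). Qed.

Variables (v : Om -> rat) (u : Om).
Hypothesis hu : uniformizer p t u.
Hypothesis hv : place_over u v.

Let vv : valuation v := hv.1.
Let u0 : u != 0 := uniformizer_neq0 hp hOm hu.
Local Notation J := (@inertia_gal p Om t v).
Let oJ := inertia_subgroup hp hOm hu hv.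

(** The product of the orbit is fixed by inertia, and its factors all have the valuation of [x]. *)
Lemma val_inertia_orbit x : x != 0 ->
  exists m : int, (size (orb J x))%:R * v x = m%:~R.
Proof.
move=> x0; pose N := \prod_(y <- orb J x) y.
have y0 y : y \in orb J x -> y != 0 /\ v y = v x.
  by move=> /(orbP hOm oJ)[s Js <-]; rewrite fmorph_eq0 (val_inertia hp hOm hu hv Js).
have N0 : N != 0.
  by rewrite prodf_seq_neq0; apply/allP => y yo; apply/implyP => _; case: (y0 y yo).
have hN s : J s -> s N = N by move=> Js; apply: (orb_prod_fixed hOm oJ (f := id)).
have [m vN] := inertia_fixed_val hp hOm hu hv hN N0.
exists m; rewrite -vN /N val_prod // => [|y /y0[]//].
rewrite big_seq (eq_bigr (fun => v x)); last by move=> y /y0[].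
by rewrite -big_seq big_const_seq count_predT iter_addr_0 mulr_natl.
Qed.

Section Layer.
Variable ys : seq Om.

Lemma inertia_reps : exists n (tau : 'I_n -> {rmorphism Om -> Om}),
  [/\ (0 < n)%N, forall i, J (tau i),
      forall s, J s -> exists i : 'I_n, {in ys, s =1 tau i} &
      forall i j, {in ys, tau i =1 tau j} -> i = j].
Proof.
have [th hth] := primitive_element ys.
pose o := orb J th; have uo : uniq o := orb_uniq hOm oJ th.
have : forall i : 'I_(size o), exists s, J s /\ s th = nth 0 o i.
  by move=> i; have /(orbP hOm oJ)[s Js sth] := mem_nth 0 (ltn_ord i); exists s.
move=> /boolp.choice[tau htau]; exists (size o), tau.
have JG s : J s -> Gal s by case.
split=> [|i|s Js|i j e].
- rewrite lt0n size_eq0; apply/eqP => oe.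
  by have := orb_id hOm oJ th; rewrite -/o oe.
- by case: (htau i).
- have so : s th \in o by apply/(orbP hOm oJ); exists s.
  have lt : (index (s th) o < size o)%N by rewrite index_mem.
  exists (Ordinal lt); have [Jt tE] := htau (Ordinal lt).
  by apply/(hth _ _ (JG _ Js) (JG _ Jt)); rewrite tE nth_index.
have [[Ji iE] [Jj jE]] := (htau i, htau j).
have /eqP := (hth _ _ (JG _ Ji) (JG _ Jj)).2 e.
by rewrite iE jE nth_uniq // => /eqP/val_inj.
Qed.

Variables (n : nat) (tau : 'I_n -> {rmorphism Om -> Om}).
Hypothesis n0 : (0 < n)%N.
Hypothesis Jtau : forall i, J (tau i).
Hypothesis repr : forall s, J s -> exists i : 'I_n, {in ys, s =1 tau i}.
Hypothesis tau_inj : forall i j, {in ys, tau i =1 tau j} -> i = j.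

Lemma layer_orbit_size x : in_layer ys x -> (size (orb J x) <= n)%N.
Proof.
move=> hx; rewrite -[n]card_ord cardE -(size_map (fun i => tau i x)).
apply: uniq_leq_size; first exact: (orb_uniq hOm oJ).
move=> y /(orbP hOm oJ)[s Js <-]; have [i si] := repr Js.
apply/mapP; exists i; first by rewrite mem_enum.
by apply: (in_layer_agree hx) si; [case: Js|case: (Jtau i)].
Qed.

(** A crude common denominator: it makes the values discrete, which is what [layer_value_group]
    needs to find the ramification index [e]. *)
Lemma layer_val_fact x : in_layer ys x -> x != 0 ->
  exists m : int, (n`!)%:R * v x = m%:~R.
Proof.
move=> hx x0; have [m hm] := val_inertia_orbit x0.
have /dvdn_fact/dvdnP[c ->] : (0 < size (orb J x) <= n)%N.
  rewrite layer_orbit_size // andbT.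
  by have := orb_id hOm oJ x; case: (orb J x).
exists (c%:Z * m); rewrite natrM -mulrA hm rmorphM /=.
by rewrite pmulrn.
Qed.

Lemma layer_value_group : exists (e : nat) (pi : Om),
  [/\ (0 < e)%N, in_layer ys pi, pi != 0, e%:R * v pi = 1 &
      forall x, in_layer ys x -> x != 0 -> exists m : int, e%:R * v x = m%:~R].
Proof.
have Lsub := in_layer_subfield ys.
have f0 : 0 < (n`!)%:R :> rat by rewrite ltr0n fact_gt0.
pose A m := boolp.asbool (exists x, [/\ in_layer ys x, x != 0, (0 < m)%N & (n`!)%:R * v x = m%:R]).
have Lu : in_layer ys u by apply: in_layer_ratfun; apply: (ratfun_uniformizer hp hOm).
have exA : exists m, A m.
  by exists (n`!); apply/boolp.asboolP; exists u; rewrite fact_gt0 hv.2 mulr1.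
case: (ex_minnP exA) => m /boolp.asboolP[pi [Lpi pi0 m0 vpi]] minm.
have mm : m%:R != 0 :> rat by rewrite pnatr_eq0 -lt0n.
have div x : in_layer ys x -> x != 0 -> exists q : int, (n`!)%:R * v x = q%:~R * m%:R.
  move=> Lx x0; have [a ha] := layer_val_fact Lx x0.
  exists (a %/ m)%Z; pose y := x * pi ^ (- (a %/ m)%Z).
  have piz (z : int) : pi ^ z != 0 by rewrite expfz_neq0.
  have y0 : y != 0 by rewrite mulf_neq0.
  have Ly : in_layer ys y.
    by move=> s Gs fs; rewrite rmorphM rmorphXz ?unitfE // Lx // Lpi.
  have vy : (n`!)%:R * v y = (a %% m)%Z%:~R.
    rewrite valM // valZ // mulrDr mulrCA vpi ha /modz rmorphB rmorphM /= rmorphN mulNr.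
    by rewrite -pmulrn.
  have r0 : 0 <= (a %% m)%Z by rewrite modz_ge0 // eqz_nat -lt0n.
  have rm : ((a %% m)%Z < m)%R by rewrite ltz_pmod.
  have rz : (a %% m)%Z = 0.
    case: (a %% m)%Z r0 rm vy => // r _ rm vy; case: (posnP r) => [->//|rp].
    have /minm : A r by apply/boolp.asboolP; exists y.
    by move: rm; rewrite ltz_nat ltnNge => /negPf->.
  by rewrite ha {1}(divz_eq a m) rz addr0 rmorphM.
have [e he] := div u Lu u0; rewrite hv.2 mulr1 in he.
have e0 : 0 < e.
  have : 0 < e%:~R * m%:R :> rat by rewrite -he.
  by rewrite pmulr_lgt0 ?ltr0n // ltr0z.
case: e he e0 => // e he e0; rewrite -pmulrn in he.
exists e, pi; split=> //.
  by apply: (mulfI mm); rewrite mulrA [m%:R * _]mulrC -he mulr1 vpi.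
move=> x Lx x0; have [q hq] := div x Lx x0; exists q.
by apply: (mulfI mm); rewrite mulrA [m%:R * _]mulrC -he hq mulrC.
Qed.

(** Each round removes a leading term c u^q pi^i, where [q] and [i] are the quotient and the
    remainder of the order by [e] and [c] is a residue in Fpbar; discreteness then raises the order
    by a full 1 / e. *)
Lemma layer_approx (e : nat) (pi x : Om) (a : int) (j : nat) :
  (0 < e)%N -> in_layer ys pi -> pi != 0 -> e%:R * v pi = 1 ->
  (forall x, in_layer ys x -> x != 0 -> exists m : int, e%:R * v x = m%:~R) ->
  in_layer ys x -> val_ge v (a%:~R / e%:R) x ->
  exists P : {poly Om}, [/\ (size P <= e)%N, forall i, ratfun P`_i &
    val_ge v ((a + j)%:~R / e%:R) (x - P.[pi])].
Proof.
move=> e0 Lpi pi0 vpi disc Lx hx.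
have rs := ratfun_subfield hp hOm.
have Lsub := in_layer_subfield ys.
have e0' : 0 < e%:R :> rat by rewrite ltr0n.
have vpiE : v pi = e%:R^-1 by apply: (mulfI (lt0r_neq0 e0')); rewrite vpi divff // lt0r_neq0.
elim: j => [|j [P [szP rP hP]]].
  have -> : a + 0%N = a by exact: addr0.
  exists 0; rewrite size_poly0 horner0 subr0; split=> // i.
  by rewrite coef0; apply: subfield0.
set y := x - P.[pi] in hP.
have Ly : in_layer ys y.
  apply: (subfieldB Lsub) => //; apply: (subfield_horner Lsub) => // i.
  exact: in_layer_ratfun.
have [hP'|hP'] := boolP (val_ge v ((a + j.+1)%:~R / e%:R) y); first by exists P.
have y0 : y != 0 by apply: contraNneq hP' => ->; apply: val_ge0.
have [b hb] := disc y Ly y0.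
have vy : v y = b%:~R / e%:R by rewrite -hb mulrAC divff ?mul1r // lt0r_neq0.
have bE : b = a + j.
  move: hP hP'; rewrite !val_geN0 // vy !ler_pM2r ?invr_gt0 // !ler_int.
  by move=> h1 h2; lia.
pose q := (b %/ e)%Z; pose i := `|(b %% e)%Z|%N.
have iE : (b %% e)%Z = i.
  by rewrite /i gez0_abs // modz_ge0 // eqz_nat -lt0n.
have ie : (i < e)%N by rewrite -ltz_nat -iE ltz_pmod.
have bqi : b%:~R / e%:R = q%:~R + i%:R / e%:R :> rat.
  rewrite (divz_eq b e) -/q iE rmorphD rmorphM /= mulrDl -!pmulrn mulfK //.
  by rewrite lt0r_neq0.
pose w := u ^ q * pi ^+ i.
have w0 : w != 0 by rewrite mulf_neq0 ?expfz_neq0 ?expf_neq0.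
have vw : v w = v y.
  by rewrite vy bqi valM ?expfz_neq0 ?expf_neq0 // valZ // valX // hv.2 mulr1 vpiE.
have [c kc hc] : exists2 c, k c & val_gt v 0 (y / w - c).
  by apply: (residue hp hOm hu hv); rewrite val_geN0 ?mulf_neq0 ?invr_eq0 // val_div // vw subrr.
exists (P + (c * u ^ q) *: 'X^i); split.
- rewrite (leq_trans (size_polyD _ _)) // geq_max szP (leq_trans (size_scale_leq _ _)) //.
  by rewrite size_polyXn.
- move=> l; rewrite coefD coefZ coefXn; apply: subfieldD => //.
  apply: subfieldM => //; last by case: eqP => _; [apply: subfield1|apply: subfield0].
  apply: subfieldM => //; first exact: ratfunC.
  have ru : ratfun u := ratfun_uniformizer hp hOm hu.
  by case: q {bqi w w0 vw hc} => q; [apply: subfieldX|apply: subfieldV => //; apply: subfieldX].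
have -> : x - (P + (c * u ^ q) *: 'X^i).[pi] = (y / w - c) * w.
  by rewrite hornerD hornerZ hornerXn mulrBl divfK // /y /w; ring.
set z := _ * w.
have hz : val_gt v (v y) z.
  by rewrite -[v y]add0r; apply: val_gtM => //; rewrite -vw val_ge_id.
have [->|z0] := eqVneq z 0; first exact: val_ge0.
have Lz : in_layer ys z.
  have LC d : k d -> in_layer ys d by move=> kd; apply: in_layer_ratfun; apply: ratfunC.
  have Lu : in_layer ys u by apply: in_layer_ratfun; apply: (ratfun_uniformizer hp hOm).
  have Lw : in_layer ys w.
    by move=> s Gs fs; rewrite rmorphM rmorphXn rmorphXz ?unitfE // Lu // Lpi.
  apply: (subfieldM Lsub) => //; apply: (subfieldB Lsub); last exact: LC.
  exact: (subfield_div Lsub).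
have [d hd] := disc z Lz z0.
have vz : v z = d%:~R / e%:R by rewrite -hd mulrAC divff ?mul1r // lt0r_neq0.
move: hz; rewrite val_gtN0 // val_geN0 // vz vy ltr_pM2r ?ler_pM2r ?invr_gt0 //.
by rewrite ltr_int ler_int bE -addn1 PoszD addrA lezD1.
Qed.

(** The layer is totally ramified because the residue field does not grow. If e < n, then pi^e is
    approximated by polynomials of degree less than [e] in [pi], so a monic polynomial of degree [e]
    is arbitrarily small at the [n] conjugates of [pi], against [val_interpolation]. *)
Lemma layer_uniformizer : exists pi, [/\ in_layer ys pi, pi != 0 & n%:R * v pi = 1].
Proof.
have [e [pi0 [e0 Lpi0 pi00 vpi0 disc]]] := layer_value_group.
have Lsub := in_layer_subfield ys.
have [th hth] := primitive_element ys.
have Lth : in_layer ys th.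
  by move=> s Gs fs; apply/(hth s idfun Gs (gal_id p t)) => y yl /=; rewrite fs.
have e0' : 0 < e%:R :> rat by rewrite ltr0n.
(* A primitive element, made negligible by a power of [u], is added to [pi0]: the sum still has
   valuation 1 / e, and now it has [n] conjugates. *)
have [N hN] : exists N : nat, val_gt v (v pi0) (u ^+ N * th).
  have [->|th0] := eqVneq th 0; first by exists 0%N; rewrite mulr0 val_gt0.
  exists (Num.truncn (v pi0 - v th)).+1.
  rewrite val_gtN0 ?mulf_neq0 ?expf_neq0 // valM ?expf_neq0 // valX // hv.2 mulr1.
  by have := Num.Theory.truncnS_gt (v pi0 - v th) => h; lra.
have [c kc [c0 hc]] := generic_sum pi0 (u ^+ N * th).
pose pi : Om := pi0 + c * (u ^+ N * th).
have Lu : in_layer ys u by apply: in_layer_ratfun; apply: (ratfun_uniformizer hp hOm).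
have Lpi : in_layer ys pi.
  apply: (subfieldD Lsub) => //; apply: (subfieldM Lsub).
    by apply: in_layer_ratfun; apply: ratfunC.
  by apply: (subfieldM Lsub) => //; apply: (subfieldX Lsub).
have [pin0 vpi] : pi != 0 /\ v pi = v pi0.
  apply: valD_eq => //; rewrite mulrC -[v pi0]addr0; apply: val_gtM => //.
  exact: (val_ge_const hp hv).
have ut : u ^+ N != 0 by rewrite expf_neq0.
have pi_inj s s' : Gal s -> Gal s' -> s pi = s' pi -> {in ys, s =1 s'}.
  move=> Gs Gs' /(hc s s' Gs Gs')[_]; rewrite !rmorphM !rmorphXn /=.
  rewrite !(gal_u hp hOm hu) // => /(mulfI ut) h.
  exact/(hth s s' Gs Gs').
have tpi_inj : injective (fun i => tau i pi).
  by move=> i j h; apply: tau_inj; apply: pi_inj h; [case: (Jtau i)|case: (Jtau j)].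
pose l := [seq tau i pi | i <- enum 'I_n].
have ul : uniq l by rewrite map_inj_uniq // enum_uniq.
have szl : size l = n by rewrite size_map size_enum_ord.
have szo : size (orb J pi) = n.
  apply/eqP; rewrite eqn_leq layer_orbit_size //= -{1}szl.
  apply: uniq_leq_size => // y /mapP[i _ ->].
  by apply/(orbP hOm oJ); exists (tau i).
exists pi; split=> //; rewrite vpi.
suff -> : n = e by [].
have [m hm] := val_inertia_orbit pin0; rewrite szo vpi in hm.
have nE : n%:R = (m * e)%:~R :> rat.
  rewrite rmorphM /= -hm -pmulrn -mulrA [v pi0 * _]mulrC vpi0 mulr1.
  by [].
have nE' : n = m * e :> int.
  by apply: (@intr_inj rat); rewrite -nE -pmulrn.
have en : (e <= n)%N.
  have m1 : 0 < m by move: n0 e0 nE'; clear; nia.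
  by move: n0 e0 nE' m1; clear; nia.
apply/eqP; rewrite eqn_leq en andbT leqNgt; apply/negP => lt.
have [C hC] := val_interpolation vv ul.
have [P [szP rP hP]] : exists P : {poly Om}, [/\ (size P <= e)%N, forall i, ratfun P`_i &
    val_ge v (C + 1) (pi ^+ e - P.[pi])].
  pose j := (e * (Num.truncn C).+2)%N.
  have [|||P [szP rP hP]] := @layer_approx e pi (pi ^+ e) 0 j e0 Lpi pin0 _ disc _ _.
  - by rewrite vpi.
  - exact: (subfieldX Lsub).
  - by rewrite mul0r val_geN0 ?expf_neq0 // valX // vpi vpi0.
  exists P; split=> //; apply: (val_ge_le _ hP); rewrite add0r -pmulrn natrM.
  rewrite mulrAC divff ?mul1r ?lt0r_neq0 // -natr1.
  by have := Num.Theory.truncnS_gt C => h; lra.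
pose Q := 'X^e - P.
have szQ : (size Q <= size l)%N.
  rewrite szl (leq_trans (size_polyD _ _)) // size_polyN size_polyXn geq_max lt.
  by rewrite (leq_trans szP) // ltnW.
have Qe : Q`_e = 1 by rewrite coefB coefXn eqxx nth_default // subr0.
have hQ a : a \in l -> val_ge v (C + 1) Q.[a].
  move=> /mapP[i _ ->]; rewrite -(val_ge_inertia hp hOm hu hv _ _ (Jtau i)) in hP.
  rewrite !hornerE; move: hP; rewrite rmorphB rmorphXn -(horner_map (tau i)) /=.
  have -> // : map_poly (tau i) P = P.
  apply/polyP => q; rewrite coef_map /=; apply: (gal_ratfun _ (rP q)).
  by case: (Jtau i).
have := hC (C + 1) Q szQ hQ e; rewrite Qe val_geN0 ?oner_neq0 // (val1 vv).
by move=> h; lra.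
Qed.

End Layer.

Lemma layer_exists (ys : seq Om) :
  (forall s, Gal s -> {in ys, forall y, s y \in ys}) ->
  exists n (tau : 'I_n -> {rmorphism Om -> Om}) pi, galois_layer p t v ys tau pi.
Proof.
move=> st; have [n [tau [n0 Jtau repr inj]]] := inertia_reps ys.
have [pi [Lpi pi0 vpi]] := layer_uniformizer n0 Jtau repr inj.
exists n, tau, pi; split=> //.
move=> s Gs Is; have [i hi] := repr s (conj Gs Is).
exists i; split=> // j hj; apply: inj => y yl.
by rewrite -hi // hj.
Qed.

End LayerExistence.

Lemma euclid_rem_inj (a b : int) (n i j : nat) :
  (i < n)%N -> (j < n)%N -> a * n + i = b * n + j -> i = j.
Proof.
move=> lti ltj /(congr1 (fun z : int => (z %% n)%Z)).
by rewrite !modzMDl !modz_small ?ltz_nat // => -[].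
Qed.

(** * Expansions in a uniformizer and the different *)

Section LayerTheory.
Variables (p : nat) (Om : fieldType) (t : Om).
Hypothesis hp : prime p.
Hypothesis hOm : is_sepclosure_Fpt p t.
Local Notation k := (@Fpbar p Om).
Local Notation Gal := (Defs.gal t k).
Variables (v : Om -> rat) (u : Om).
Hypothesis hu : uniformizer p t u.
Hypothesis hv : place_over u v.

Let vv : valuation v := hv.1.
Local Notation J := (@inertia_gal p Om t v).
Let oJ := inertia_subgroup hp hOm hu hv.

Variables (ys : seq Om) (n : nat) (tau : 'I_n -> {rmorphism Om -> Om}) (pi : Om).
Hypothesis hl : galois_layer p t v ys tau pi.

Let JG s : J s -> Gal s. Proof. by case. Qed.

Lemma layer_Jtau i : J (tau i). Proof. exact: (layer_inertia hl). Qed.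
Let Jtau := layer_Jtau.

Lemma layer_rep s : J s -> exists i : 'I_n, {in ys, s =1 tau i}.
Proof. by move=> [Gs Is]; have [i [hi _]] := layer_repr hl Gs Is; exists i. Qed.

Lemma layer_tau_inj i j : {in ys, tau i =1 tau j} -> i = j.
Proof.
move=> e; have [Gi Ii] := Jtau i; have [l [_ hl']] := layer_repr hl Gi Ii.
by rewrite -(hl' i) // -(hl' j).
Qed.

Lemma layer_n_gt0 : (0 < n)%N.
Proof.
by have [i _] := layer_rep (subgroup_id oJ); apply: leq_ltn_trans (ltn_ord i).
Qed.

Lemma layer_n_neq0 : n%:R != 0 :> rat.
Proof. by rewrite pnatr_eq0 -lt0n layer_n_gt0. Qed.

Lemma layer_pi_val : v pi = n%:R^-1.
Proof.
apply: (mulfI layer_n_neq0); rewrite (layer_pi_unif hl) divff //.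
exact: layer_n_neq0.
Qed.

Lemma in_layer_pi : in_layer p t ys pi. Proof. exact: (layer_pi hl). Qed.

Lemma layer_agree_pi s s' : Gal s -> Gal s' -> {in ys, s =1 s'} -> s pi = s' pi.
Proof. exact: (in_layer_agree hOm in_layer_pi). Qed.

Lemma val_spi s : J s -> v (s pi) = n%:R^-1.
Proof. by move=> Js; rewrite (val_inertia hp hOm hu hv Js) ?layer_pi_neq0 ?layer_pi_val //; apply: layer_pi_neq0 hl. Qed.

(** The product of the inertia orbit of [pi] has integral valuation although v pi = 1 / n, so there
    are at least [n] conjugates. *)
Lemma tau_pi_inj : injective (fun i => tau i pi).
Proof.
pose l := [seq tau i pi | i <- enum 'I_n].
have szl : size l = n by rewrite size_map size_enum_ord.
have sub : {subset orb J pi <= l}.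
  move=> y /(orbP hOm oJ)[s Js <-]; have [i si] := layer_rep Js.
  apply/mapP; exists i; first by rewrite mem_enum.
  exact: (layer_agree_pi (JG Js) (JG (Jtau i)) si).
have uo := orb_uniq hOm oJ pi.
have szo : (size l <= size (orb J pi))%N.
  have [m] := val_inertia_orbit hp hOm hu hv (layer_pi_neq0 hl).
  rewrite layer_pi_val => hm; rewrite szl.
  have : (size (orb J pi))%:R = (m * n)%:~R :> rat.
    by rewrite rmorphM /= -hm -pmulrn divfK // layer_n_neq0.
  have o0 : (0 < size (orb J pi))%N.
    by rewrite lt0n size_eq0; apply/eqP => oe; have := orb_id hOm oJ pi; rewrite oe.
  rewrite pmulrn => /intr_inj; move: o0 layer_n_gt0; move: (size _) => d; clear.
  case: m => a d0 n0.
    by rewrite -PoszM => -[dE]; rewrite dE leq_pmull //; move: d0; rewrite dE muln_gt0 => /andP[].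
  by rewrite NegzE mulNr -PoszM => dE; have := muln_gt0 a.+1 n; rewrite n0 /=; lia.
have ul := leq_size_uniq uo sub szo.
move=> i j e; apply: val_inj; apply/eqP; rewrite /= -(nth_uniq 0 _ _ ul) ?szl ?ltn_ord //.
have nl (q : 'I_n) : nth 0 l q = tau q pi.
  by rewrite (nth_map q 0 (fun i => tau i pi)) ?size_enum_ord // nth_ord_enum.
by rewrite !nl e.
Qed.

Lemma layer_pi_agree s s' : J s -> J s' -> s pi = s' pi -> {in ys, s =1 s'}.
Proof.
move=> Js Js' e; have [i si] := layer_rep Js; have [j sj] := layer_rep Js'.
have ij : i = j.
  apply: tau_pi_inj; rewrite -(layer_agree_pi (JG Js) (JG (Jtau i)) si) e.
  exact: (layer_agree_pi (JG Js') (JG (Jtau j)) sj).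
by move=> y yl; rewrite si // ij sj.
Qed.

Definition layer_group s := J s /\ {in ys, forall y, s y = y}.
Local Notation JL := layer_group.

Lemma layer_group_subgroup : subgroup p t JL. Proof. exact: subgroup_fix. Qed.

Lemma layer_group_pi s : JL s -> s pi = pi.
Proof. by move=> [Js fs]; apply: in_layer_pi => //; apply: JG. Qed.

Lemma layer_groupP s : J s -> s pi = pi -> JL s.
Proof.
move=> Js e; split=> //; have := @layer_pi_agree s idfun Js (subgroup_id oJ) e.
by [].
Qed.

Lemma layer_group_agree x s s' : (forall r, JL r -> r x = x) -> J s -> J s' ->
  {in ys, s =1 s'} -> s x = s' x.
Proof.
move=> hx Js Js' e; have [r [Jr s'r rs']] := subgroup_inv oJ Js'.
rewrite -[LHS]rs'; congr (s' _); apply: (hx (r \o s)); split.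
  exact: (subgroup_comp oJ).
by move=> y yl /=; rewrite e // s'r.
Qed.

(** Lagrange interpolation of the conjugates of [x] at those of [pi]; inertia permutes the data,
    hence by uniqueness fixes the coefficients. *)
Lemma layer_expansion x : (forall r, JL r -> r x = x) ->
  exists P : {poly Om}, [/\ (size P <= n)%N, forall i s, J s -> s P`_i = P`_i &
    x = P.[pi]].
Proof.
move=> hx.
have [P szP hP] := interpolation (fun i => tau i x) tau_pi_inj (enum_uniq 'I_n).
rewrite size_enum_ord in szP.
have {}hP i : P.[tau i pi] = tau i x by apply: hP; rewrite mem_enum.
exists P; split=> //.
  move=> i s Js; suff e : map_poly s P = P by rewrite -[in RHS]e coef_map.
  apply/eqP; rewrite -subr_eq0; apply/eqP.
  apply: (roots_geq_poly_eq0 (rs := [seq tau j pi | j <- enum 'I_n])).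
  - apply/allP => y /mapP[j _ ->]; rewrite /root hornerD hornerN.
    have [r [Jr sr rs]] := subgroup_inv oJ Js.
    have [l hlj] := layer_rep (subgroup_comp oJ Jr (Jtau j)).
    have e z : (forall r, JL r -> r z = z) -> s (tau l z) = tau j z.
      move=> hz; rewrite -(layer_group_agree hz (subgroup_comp oJ Jr (Jtau j)) (Jtau l) hlj) /=.
      exact: rs.
    by rewrite hP -{1}(e pi) ?horner_map ?hP ?(e x) ?subrr //; apply: layer_group_pi.
  - by rewrite map_inj_uniq ?enum_uniq //; apply: tau_pi_inj.
  - rewrite size_map size_enum_ord (leq_trans (size_polyD _ _)) // geq_max size_polyN.
    by rewrite size_map_poly szP.
have [i hi] := layer_rep (subgroup_id oJ).
have iJ := subgroup_id oJ.
by rewrite -[pi]/(idfun pi) (layer_agree_pi (JG iJ) (JG (Jtau i)) hi) hP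
  -(layer_group_agree hx iJ (Jtau i) hi).
Qed.

(** Nonzero coefficients have integral valuations and v pi = 1 / n, so the nonzero terms have
    distinct valuations and cannot cancel. *)
Lemma layer_expansion_val (P : {poly Om}) : (size P <= n)%N ->
  (forall i s, J s -> s P`_i = P`_i) -> P.[pi] != 0 ->
  (exists (m : int) (i : 'I_n), v P.[pi] = m%:~R + i%:R / n%:R) /\
  forall i, val_ge v (v P.[pi]) (P`_i * pi ^+ i).
Proof.
move=> szP hP Ppi0; have pi0 := layer_pi_neq0 hl.
pose f (i : 'I_n) := P`_i * pi ^+ i.
have PE : P.[pi] = \sum_i f i by rewrite (horner_coef_wide _ szP).
have [i0 fi0] : exists i, f i != 0.
  apply: boolp.contrapT => h; move: Ppi0; rewrite PE big1 ?eqxx // => i _.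
  by apply/eqP; apply: contraT => hi; case: h; exists i.
have vf (i : 'I_n) : f i != 0 -> exists m : int, v (f i) = m%:~R + i%:R / n%:R.
  rewrite /f mulf_eq0 negb_or => /andP[Pi0 pii].
  have [m hm] := inertia_fixed_val hp hOm hu hv (hP i) Pi0.
  by exists m; rewrite valM // valX // layer_pi_val hm.
have distinct (i j : 'I_n) : f i != 0 -> f j != 0 -> v (f i) = v (f j) -> i = j.
  move=> /vf[a ->] /vf[b ->] e; apply: val_inj.
  have e' : (a * n + i)%:~R = (b * n + j)%:~R :> rat.
    rewrite !rmorphD !rmorphM /= -!pmulrn; apply: (mulIf (x := n%:R^-1)).
      by rewrite invr_eq0 layer_n_neq0.
    by rewrite !mulrDl !mulfK ?layer_n_neq0.
  exact: (euclid_rem_inj (ltn_ord i) (ltn_ord j) (intr_inj e')).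
have [i1 [f1 min1]] : exists i1, f i1 != 0 /\ forall j, f j != 0 -> v (f i1) <= v (f j).
  case: (@Order.TotalTheory.arg_minP _ _ _ i0 (fun i => f i != 0) (fun i => v (f i)) fi0) => i1 h1 h2.
  by exists i1.
have [_ vP] : \sum_i f i != 0 /\ v (\sum_i f i) = v (f i1).
  apply: val_sum_eq => // j nj; have [->|fj] := eqVneq (f j) 0; first exact: val_gt0.
  rewrite val_gtN0 // lt_neqAle min1 // andbT.
  by apply: contraNneq nj => e; apply/eqP/esym/distinct.
rewrite PE vP; split.
  by have [m hm] := vf i1 f1; exists m, i1.
move=> j; have [lt|ge] := ltnP j n; last first.
  by rewrite nth_default ?mul0r ?val_ge0 // (leq_trans szP).
have [fj|fj] := eqVneq (f (Ordinal lt)) 0; first by rewrite -[_ * _]/(f (Ordinal lt)) fj val_ge0.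
by rewrite -[_ * _]/(f (Ordinal lt)) val_geN0 // min1.
Qed.

Lemma layer_coef_val (P : {poly Om}) c : (size P <= n)%N ->
  (forall i s, J s -> s P`_i = P`_i) -> val_ge v c P.[pi] ->
  forall i, val_ge v (c - i%:R / n%:R) P`_i.
Proof.
move=> szP hP hc i; have pi0 := layer_pi_neq0 hl.
have [e|Ppi0] := eqVneq P.[pi] 0.
  suff -> : P = 0 by rewrite coef0 val_ge0.
  apply: (roots_geq_poly_eq0 (rs := [seq tau j pi | j <- enum 'I_n])).
  - apply/allP => y /mapP[j _ ->]; have -> : P = map_poly (tau j) P.
      by apply/polyP => l; rewrite coef_map /= hP.
    by rewrite fmorph_root /root e.
  - by rewrite map_inj_uniq ?enum_uniq //; apply: tau_pi_inj.
  - by rewrite size_map size_enum_ord.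
have [_ h] := layer_expansion_val szP hP Ppi0.
have [->|Pi0] := eqVneq P`_i 0; first exact: val_ge0.
have := h i; rewrite !val_geN0 ?mulf_neq0 ?expf_neq0 // valM ?expf_neq0 // valX // layer_pi_val.
by move: hc; rewrite val_geN0 // => *; lra.
Qed.

Lemma layer_val_frac x : (forall r, JL r -> r x = x) -> x != 0 ->
  exists m : int, n%:R * v x = m%:~R.
Proof.
move=> hx x0; have [P [szP hP xE]] := layer_expansion hx.
have [|[m [i vx]] _] := layer_expansion_val szP hP; first by rewrite -xE.
exists (m * n + i); rewrite xE vx rmorphD rmorphM /= -!pmulrn mulrDr mulrC.
by rewrite mulrCA divff ?mulr1 // layer_n_neq0.
Qed.

(* Coefficients of integral elements are integral, since their valuation is an
   integer larger than -1. *)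
Lemma layer_coef_integral (P : {poly Om}) : (size P <= n)%N ->
  (forall i s, J s -> s P`_i = P`_i) -> val_ge v 0 P.[pi] ->
  forall i, val_ge v 0 P`_i.
Proof.
move=> szP hP hc i; have [->|Pi0] := eqVneq P`_i 0; first exact: val_ge0.
have lt : (i < n)%N.
  by rewrite ltnNge; apply: contraNN Pi0 => ge; rewrite nth_default // (leq_trans szP).
have := layer_coef_val szP hP hc i; rewrite !val_geN0 //.
have [m ->] := inertia_fixed_val hp hOm hu hv (hP i) Pi0.
have n0 : 0 < n%:R :> rat by rewrite ltr0n layer_n_gt0.
rewrite sub0r => h; have : -1 < m%:~R :> rat.
  apply: lt_le_trans h; rewrite ltrN2 ltr_pdivrMr // mul1r.
  by rewrite ltr_nat.
by rewrite -[-1]/((-1)%:~R) ltr_int ler0z; lia.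
Qed.

(** Integral elements are polynomials in [pi] with integral invariant coefficients, and s pi - pi
    divides every (s pi)^i - pi^i. Hence i_G can be read off from [pi]. *)
Lemma layer_diff_val x s : (forall r, JL r -> r x = x) -> val_ge v 0 x -> J s ->
  val_ge v (v (s pi - pi)) (s x - x).
Proof.
move=> hx x_ge0 Js; have [P [szP hP xE]] := layer_expansion hx.
have PZ : forall i, val_ge v 0 P`_i by apply: layer_coef_integral; rewrite -?xE.
have pi_ge0 : val_ge v 0 pi.
  by rewrite val_geN0 ?(layer_pi_neq0 hl) // layer_pi_val invr_ge0.
have spi_ge0 : val_ge v 0 (s pi) by rewrite (val_ge_inertia hp hOm hu hv).
have vX0 z i : val_ge v 0 z -> val_ge v 0 (z ^+ i).
  by move=> hz; have := val_geX vv i hz; rewrite mulr0.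
have -> : s x - x = (\sum_(i < size P) P`_i * \sum_(j < i) s pi ^+ (i.-1 - j) * pi ^+ j) * (s pi - pi).
  rewrite xE -horner_map /= (_ : map_poly s P = P); last first.
    by apply/polyP => i; rewrite coef_map /= hP.
  rewrite !horner_coef -sumrB big_distrl; apply: eq_bigr => i _ /=.
  by rewrite -mulrBr subrXX -mulrA [X in _ = _ * X]mulrC.
rewrite -[v (s pi - pi)]add0r; apply: val_geM => //; last exact: val_ge_id.
apply: val_ge_sum => // i _; rewrite -[0]addr0; apply: val_geM => //.
by apply: val_ge_sum => // j _; rewrite -[0]addr0; apply: val_geM => //; apply: vX0.
Qed.

(** Hilbert's formula: the valuation at [pi] of the derivative of its minimal polynomial. It is
    measured by [v], not by the valuation n v of the layer. *)
Definition different_exponent : rat :=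
  \sum_(i < n | tau i pi != pi) v (tau i pi - pi).
Local Notation delta := different_exponent.

(** Differentiate f(pi) = 0, where [f] is the minimal polynomial: f'(pi) times the derivative of
    [pi] is minus the value at [pi] of the polynomial of differentiated coefficients, which are
    integral because inertia fixes those of [f]. *)
Lemma ddu_pi : val_ge v (- delta) (ddu p t u pi).
Proof.
have hDu := ddu_derivation hp hOm u.
pose f : {poly Om} := \prod_i ('X - (tau i pi)%:P).
have [i0 hi0] := layer_rep (subgroup_id oJ).
have pi_i0 : tau i0 pi = pi.
  by rewrite -(layer_agree_pi (JG (subgroup_id oJ)) (JG (Jtau i0)) hi0).
have iE i : (tau i pi != pi) = (i != i0).
  apply/idP/idP; apply: contraNneq; first by move=> ->; rewrite pi_i0.
  by move=> e; apply/eqP/tau_pi_inj; rewrite e pi_i0.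
have fpi : f.[pi] = 0.
  by rewrite horner_prod (bigD1 i0) //= hornerXsubC pi_i0 subrr mul0r.
have f'pi : f^`().[pi] = \prod_(i | i != i0) (pi - tau i pi).
  rewrite /f (bigD1 i0) //= derivM derivXsubC hornerD !hornerM hornerXsubC pi_i0 subrr.
  rewrite mul0r addr0 hornerC mul1r horner_prod.
  by apply: eq_bigr => i _; rewrite hornerXsubC.
have fJ i s : J s -> s f`_i = f`_i.
  move=> Js; suff e : map_poly s f = f by rewrite -[in RHS]e coef_map.
  have pe : perm_eq [seq tau j pi | j <- enum 'I_n] (orb J pi).
    apply: uniq_perm; [by rewrite map_inj_uniq ?enum_uniq //; apply: tau_pi_inj|exact: (orb_uniq hOm oJ)|].
    move=> y; apply/idP/idP => [/mapP[j _ ->]|/(orbP hOm oJ)[r Jr <-]].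
      by apply/(orbP hOm oJ); exists (tau j).
    have [j hj] := layer_rep Jr; apply/mapP; exists j; first by rewrite mem_enum.
    exact: (layer_agree_pi (JG Jr) (JG (Jtau j)) hj).
  have -> : f = \prod_(y <- orb J pi) ('X - y%:P).
    by rewrite -(perm_big _ pe) /= big_map big_enum.
  exact: (orb_poly_fixed hOm oJ).
have pi_ge0 i : val_ge v 0 (tau i pi).
  by rewrite val_geN0 ?fmorph_eq0 ?(layer_pi_neq0 hl) // val_spi // invr_ge0.
have fZ i : val_ge v 0 f`_i.
  rewrite /f; elim/big_rec: _ i => [|j g _ IH] i.
    by rewrite coefC; case: eqP => _; rewrite ?val_ge0 // val_geN0 ?oner_neq0 // val1.
  rewrite mulrBl coefB coefXM coefCM; apply: val_geB => //.
    by case: eqP => _; [apply: val_ge0|apply: IH].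
  by rewrite -[0]addr0; apply: val_geM.
have f'0 : f^`().[pi] != 0.
  rewrite f'pi; apply/prodf_neq0 => i ni; rewrite subr_eq0 eq_sym iE //.
have vf' : v f^`().[pi] = delta.
  rewrite f'pi -big_filter val_prod //.
    rewrite big_filter /delta; apply: eq_big => [i|i _]; first by rewrite iE.
    by rewrite -(valN vv) opprB.
  by move=> i; rewrite mem_filter => /andP[ni _]; rewrite subr_eq0 eq_sym iE.
have := der_horner hDu f pi; rewrite fpi (der0 hDu) => /esym/eqP.
rewrite addr_eq0; set q := (\poly_(i < size f) _).[pi] => /eqP hq.
have -> : ddu p t u pi = - (q / f^`().[pi]) by rewrite hq; field.
rewrite val_geN // -[- delta]add0r; apply: val_geM => //; last first.
  by rewrite val_geN0 ?invr_eq0 // valV // vf'.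
rewrite /q horner_poly; apply: val_ge_sum => // i _; rewrite -[0]addr0; apply: val_geM => //.
  exact: (inertia_fixed_ddu_integral hp hOm hu hv (fJ i)).
have := val_geX vv i (_ : val_ge v 0 pi); rewrite mulr0; apply.
by rewrite val_geN0 ?(layer_pi_neq0 hl) // layer_pi_val invr_ge0.
Qed.

(** The two bounds come from the derivatives of the coefficients and of the powers of [pi] in the
    expansion of [x]. *)
Lemma layer_ddu x c : (forall r, JL r -> r x = x) -> val_ge v c x ->
  val_ge v (Num.min (c - 1) (c - n%:R^-1 - delta)) (ddu p t u x).
Proof.
move=> hx hc; have [P [szP hP xE]] := layer_expansion hx.
have hDu := ddu_derivation hp hOm u.
have pi0 := layer_pi_neq0 hl.
have Pc : forall i, val_ge v (c - i%:R / n%:R) P`_i.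
  by apply: layer_coef_val; rewrite -?xE.
have vpiX i : val_ge v (i%:R / n%:R) (pi ^+ i).
  by rewrite val_geN0 ?expf_neq0 // valX // layer_pi_val.
rewrite xE horner_coef (der_sum hDu); apply: val_ge_sum => // i _.
rewrite (derM hDu); apply: val_geD => //.
  have h := inertia_fixed_ddu hp hOm hu hv (hP i) (Pc i).
  apply: (val_ge_le _ (val_geM vv h (vpiX i))).
  by rewrite ge_min; apply/orP; left; lra.
rewrite (derX hDu) mulrA; case: (nat_of_ord i) (Pc i) => [|j] hj.
  by rewrite !mul0r mulr0 mul0r val_ge0.
have hn : val_ge v 0 (j.+1%:R : Om).
  by apply: (val_ge_const hp hv); apply: subfield_nat; apply: Fpbar_subfield => //; exact: (Om_pchar hOm).
have := val_geM vv (val_geM vv hj (val_geM vv hn (vpiX j))) ddu_pi.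
apply: val_ge_le; rewrite ge_min; apply/orP; right.
rewrite -[j.+1%:R]natr1; lra.
Qed.

End LayerTheory.

Lemma forall_in_impl (I : Type) (P Q : I -> Prop) l :
  (forall i, P i -> Q i) -> forall_in P l -> forall_in Q l.
Proof. by move=> PQ; elim: l => [|i l IH] //= [/PQ ? /IH]. Qed.

(** * Integral polynomials and one-units *)

Section IntegralPolynomials.
Variables (L : fieldType) (v : L -> rat).
Hypothesis vv : valuation v.

Lemma integral_quotient (rs : seq L) (h : {poly L}) : uniq rs ->
  (forall r, r \in rs -> val_ge v 0 r) -> (forall i, val_ge v 0 h`_i) ->
  all (root h) rs ->
  exists2 q, h = \prod_(r <- rs) ('X - r%:P) * q & forall i, val_ge v 0 q`_i.
Proof.
elim: rs h => [|r rs IH] h /=; first by exists h; rewrite ?big_nil ?mul1r.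
move=> /andP[rrs urs] rZ hZ /andP[/factor_theorem[q hq] rh].
have qZ i : val_ge v 0 q`_i.
  have [m] := ubnP (size q - i); elim: m i => // m IHm i lt.
  have [ge|lti] := leqP (size q) i; first by rewrite nth_default ?val_ge0.
  have -> : q`_i = h`_i.+1 + q`_i.+1 * r.
    by rewrite hq mulrBr coefB coefMX coefMC subrK.
  apply: val_geD => //; rewrite -[0]addr0; apply: val_geM => //; last first.
    by apply: rZ; rewrite mem_head.
  by apply: IHm; rewrite -ltnS (leq_trans _ lt) // ltnS subnS prednK // subn_gt0.
have rq : all (root q) rs.
  apply/allP => z zrs; have := allP rh z zrs; rewrite hq rootM root_XsubC.
  by case/orP => // /eqP zr; rewrite -zr zrs in rrs.
have [|q' qE q'Z] := IH q urs _ qZ rq.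
  by move=> z zrs; apply: rZ; rewrite inE zrs orbT.
by exists q' => //; rewrite hq qE big_cons mulrC mulrA.
Qed.

Definition one_unit (z : L) := val_gt v 0 (z - 1).

Lemma one_unit_val z : one_unit z -> z != 0 /\ v z = 0.
Proof. exact: (val_unit_eq vv (oner_neq0 _) (val1 vv)). Qed.

Lemma one_unit1 : one_unit 1. Proof. by rewrite /one_unit subrr val_gt0. Qed.

Lemma one_unitM z w : one_unit z -> one_unit w -> one_unit (z * w).
Proof.
move=> hz hw; have [w0 vw] := one_unit_val hw.
rewrite /one_unit (_ : z * w - 1 = (z - 1) * w + (w - 1)); last by ring.
apply: val_gtD => //; rewrite -[0]addr0; apply: val_gtM => //.
by rewrite val_geN0 // vw.
Qed.

Lemma one_unitV z : one_unit z -> one_unit z^-1.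
Proof.
move=> hz; have [z0 vz] := one_unit_val hz.
rewrite /one_unit (_ : z^-1 - 1 = (z - 1) * - z^-1); last by field.
rewrite -[0]addr0; apply: val_gtM => //.
by rewrite val_geN // val_geN0 ?invr_eq0 // valV // vz oppr0.
Qed.

Lemma one_unitX z n : one_unit z -> one_unit (z ^+ n).
Proof.
move=> hz; elim: n => [|n IH]; first by rewrite expr0; apply: one_unit1.
by rewrite exprS; apply: one_unitM.
Qed.

Lemma one_unitXz z (m : int) : one_unit z -> one_unit (z ^ m).
Proof.
by case: m => n hz; [apply: one_unitX|apply: one_unitV; apply: one_unitX].
Qed.

End IntegralPolynomials.

(** * Upper numbering *)

Section Cut.
Variables (Om : fieldType) (v : Om -> rat) (n : nat) (pi : Om).

(** The term min(i_G, x) of Serre's formula, for the automorphism that maps [pi] to [a]; i_G is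
    infinite when a = pi. *)
Definition cut (a : Om) (x : rat) : rat :=
  if a == pi then x else Num.min (n%:R * v (a - pi)) x.

Lemma cut_mono a x y : x <= y -> cut a x <= cut a y.
Proof.
rewrite /cut => xy; case: ifP => // _.
by rewrite le_min !ge_min lexx xy orbT.
Qed.

Lemma cut_min a x y : cut a (Num.min x y) = Num.min (cut a x) y.
Proof. by rewrite /cut; case: ifP => // _; rewrite minA. Qed.

Variable tau : 'I_n -> {rmorphism Om -> Om}.

Lemma herbrandE c : herbrand v tau pi c =
  n%:R^-1 * (\sum_(i < n) cut (tau i pi) (c + 1)) - 1.
Proof. by []. Qed.

Lemma herbrand_mono c d : c <= d -> herbrand v tau pi c <= herbrand v tau pi d.
Proof.
move=> cd; rewrite !herbrandE lerB // ler_wpM2l ?invr_ge0 // ler_sum // => i _.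
by apply: cut_mono; rewrite lerD2r.
Qed.

Lemma herbrand_strict c d : (exists i, tau i pi = pi) -> c < d ->
  herbrand v tau pi c < herbrand v tau pi d.
Proof.
move=> [i0 hi0] cd; have n0 : (0 < n)%N by apply: leq_ltn_trans (ltn_ord i0).
rewrite !herbrandE ltrD2r ltr_pM2l ?invr_gt0 ?ltr0n //.
rewrite (bigD1 i0) //= [X in _ < X](bigD1 i0) //=.
apply: ltr_leD; first by rewrite /cut hi0 eqxx; lra.
by apply: ler_sum => i _; apply: cut_mono; lra.
Qed.

End Cut.

(** phi(i_G(s) - 1): when [s] moves [pi], the largest upper index whose ramification group in this
    layer contains [s]. *)
Definition upper_number (Om : fieldType) (v : Om -> rat) n
    (tau : 'I_n -> {rmorphism Om -> Om}) (pi : Om) (s : {rmorphism Om -> Om}) :=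
  herbrand v tau pi (n%:R * v (s pi - pi) - 1).

(** * Herbrand's theorem for two layers *)

Section Herbrand.
Variables (p : nat) (Om : fieldType) (t : Om).
Hypothesis hp : prime p.
Hypothesis hOm : is_sepclosure_Fpt p t.
Local Notation k := (@Fpbar p Om).
Local Notation Gal := (Defs.gal t k).
Variables (v : Om -> rat) (u : Om).
Hypothesis hu : uniformizer p t u.
Hypothesis hv : place_over u v.

Let vv : valuation v := hv.1.
Local Notation J := (@inertia_gal p Om t v).
Let oJ := inertia_subgroup hp hOm hu hv.
Let JG s : J s -> Gal s. Proof. by case. Qed.

Section TwoLayers.
Variables (ys : seq Om) (n : nat) (tau : 'I_n -> {rmorphism Om -> Om}) (pi : Om).
Hypothesis hl : galois_layer p t v ys tau pi.
Variables (ys2 : seq Om) (n2 : nat) (tau2 : 'I_n2 -> {rmorphism Om -> Om}) (pi2 : Om).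
Hypothesis hl2 : galois_layer p t v ys2 tau2 pi2.
Hypothesis sub12 : {subset ys <= ys2}.

Local Notation JL := (@layer_group p Om t v ys).
Let oJL : subgroup p t JL := layer_group_subgroup hp hOm hu hv ys.

Local Notation F1 := (orb JL pi2).
Local Notation e' := (size (orb JL pi2)).

Let F1P b : b \in F1 <-> exists2 h, JL h & h pi2 = b.
Proof. exact: (orbP hOm oJL). Qed.

Let pi2_agree s s' : J s -> J s' -> s pi2 = s' pi2 -> {in ys, s =1 s'}.
Proof.
move=> Js Js' e y yl.
exact: (layer_pi_agree hp hOm hu hv hl2 Js Js' e (sub12 yl)).
Qed.

(** A coset decomposition: [F1] is the orbit of [pi2] under the subgroup fixing the smaller layer,
    and the [S k] are lifts of the elements of the quotient. *)
Lemma layer_orbit_fibers (S : 'I_n -> {rmorphism Om -> Om}) :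
  (forall k, J (S k) /\ {in ys, S k =1 tau k}) ->
  perm_eq [seq tau2 j pi2 | j <- enum 'I_n2] [seq S k b | k <- enum 'I_n, b <- F1].
Proof.
move=> hS; apply: uniq_perm.
- by rewrite map_inj_uniq ?enum_uniq //; apply: (tau_pi_inj hp hOm hu hv hl2).
- apply: allpairs_uniq; [exact: enum_uniq|exact: (orb_uniq hOm oJL)|].
  move=> [i b] [j d] /allpairsP[[i1 b1] /= [_ /F1P[h Jh hb] [-> ->]]].
  move=> /allpairsP[[j1 d1] /= [_ /F1P[h' Jh' hd] [-> ->]]].
  rewrite -hb -hd => e.
  have [[JSi Si] [JSj Sj]] := (hS i1, hS j1).
  have agr := pi2_agree (subgroup_comp oJ JSi Jh.1) (subgroup_comp oJ JSj Jh'.1) e.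
  have ij : i1 = j1.
    apply: (layer_tau_inj hl) => y yl; rewrite -Si // -Sj //.
    by have := agr y yl; rewrite /= Jh.2 // Jh'.2.
  by move: e; rewrite ij => /fmorph_inj ->.
move=> y; apply/mapP/allpairsP => [[j _ ->]|[[i b] /= [_ /F1P[h Jh <-] ->]]].
  have Jj := layer_Jtau hl2 j.
  have [i hi] := layer_rep hl Jj; have [JSi Si] := hS i.
  have [r [Jr Sr rS]] := subgroup_inv oJ JSi.
  exists (i, r (tau2 j pi2)); rewrite /= mem_enum rS; split=> //.
  apply/F1P; exists (r \o tau2 j) => //; split; first exact: (subgroup_comp oJ).
  by move=> z zl /=; rewrite hi // -Si // Sr.
have [JSi Si] := hS i; have Jc := subgroup_comp oJ JSi Jh.1.
have [j hj] := layer_rep hl2 Jc; exists j; first by rewrite mem_enum.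
exact: (layer_agree_pi hOm hl2 (JG Jc) (JG (layer_Jtau hl2 j)) hj).
Qed.

Lemma fibers_size : n2 = (n * e')%N.
Proof.
have := perm_size (@layer_orbit_fibers tau (fun i => conj (layer_Jtau hl i) (fun _ _ => erefl))).
by rewrite size_map size_enum_ord size_allpairs size_enum_ord.
Qed.

Lemma sum_fibers (S : 'I_n -> {rmorphism Om -> Om}) (phi : Om -> rat) :
  (forall k, J (S k) /\ {in ys, S k =1 tau k}) ->
  \sum_(j < n2) phi (tau2 j pi2) = \sum_(i < n) \sum_(b <- F1) phi (S i b).
Proof.
move=> hS.
transitivity (\sum_(a <- [seq tau2 j pi2 | j <- enum 'I_n2]) phi a).
  by rewrite big_map big_enum.
rewrite (perm_big _ (layer_orbit_fibers hS)) /= big_allpairs_dep.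
by rewrite big_enum.
Qed.

Let e'_gt0 : (0 < e')%N.
Proof.
rewrite lt0n size_eq0; apply/eqP => e; have := orb_id hOm oJL pi2.
by rewrite e.
Qed.

Let moved s b : J s -> s pi != pi -> b \in F1 -> s b != pi2.
Proof.
move=> Js spi /F1P[h [Jh fh] <-]; apply: contraNneq spi => e.
have agr := pi2_agree (subgroup_comp oJ Js Jh) (subgroup_id oJ) e.
apply/eqP; apply: (in_layer_pi hl) => [|y yl]; first exact: JG.
by have := agr y yl; rewrite /= fh.
Qed.

Let pi_JL2 r : @layer_group p Om t v ys2 r -> r pi = pi.
Proof.
move=> [Jr fr]; apply: (in_layer_pi hl) => [|y yl]; first exact: JG.
exact/fr/sub12.
Qed.

Let pi2_ge0 s : J s -> val_ge v 0 (s pi2).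
Proof.
move=> Js; rewrite (val_ge_inertia hp hOm hu hv) // val_geN0 ?(layer_pi_neq0 hl2) //.
by rewrite (layer_pi_val hp hOm hu hv hl2) invr_ge0.
Qed.

(** Serre's formula for i_G of a quotient group. With [f] the minimal polynomial of [pi2] over the
    smaller layer, s pi - pi and (s f)(pi2) divide each other. *)
Lemma val_fiber_sum s : J s -> s pi != pi ->
  v (s pi - pi) = \sum_(b <- F1) v (s b - pi2).
Proof.
move=> Js spi; pose f : {poly Om} := \prod_(b <- F1) ('X - b%:P).
have FZ b : b \in F1 -> val_ge v 0 b by move=> /F1P[h [Jh _] <-]; apply: pi2_ge0.
have fZ i : val_ge v 0 f`_i.
  rewrite /f big_seq; elim/big_rec: _ i => [|b g bF IH] i.
    by rewrite coefC; case: eqP => _; rewrite ?val_ge0 // val_geN0 ?oner_neq0 // val1.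
  rewrite mulrBl coefB coefXM coefCM; apply: val_geB => //.
    by case: eqP => _; [apply: val_ge0|apply: IH].
  by rewrite -[0]addr0; apply: val_geM => //; apply: FZ.
have fJL i r : JL r -> r f`_i = f`_i.
  by move=> Jr; rewrite -coef_map /f (orb_poly_fixed hOm oJL).
have fpi2 : f.[pi2] = 0.
  rewrite /f horner_prod (big_rem pi2) ?(orb_id hOm oJL) //=.
  by rewrite hornerXsubC subrr mul0r.
have sfE : (map_poly s f).[pi2] = \prod_(b <- F1) (pi2 - s b).
  rewrite rmorph_prod horner_prod; apply: eq_bigr => b _.
  by rewrite rmorphB /= map_polyX map_polyC hornerXsubC.
have P0 : \prod_(b <- F1) (pi2 - s b) != 0.
  rewrite prodf_seq_neq0; apply/allP => b bF; apply/implyP => _.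
  by rewrite subr_eq0 eq_sym moved.
have vP : v (\prod_(b <- F1) (pi2 - s b)) = \sum_(b <- F1) v (s b - pi2).
  rewrite val_prod // => [|b bF]; last by rewrite subr_eq0 eq_sym moved.
  by apply: eq_bigr => b _; rewrite -(valN vv) opprB.
(* Since f(pi2) = 0, (s f)(pi2) is the value of s f - f, whose coefficients are divisible by s pi -
   pi. *)
rewrite -vP; apply/eqP; rewrite eq_le; apply/andP; split.
  rewrite -val_geN0 // -sfE -[X in val_ge _ _ X]subr0 -fpi2 -hornerN -hornerD horner_coef.
  apply: val_ge_sum => // i _; rewrite -[v (s pi - pi)]addr0; apply: val_geM => //.
    by rewrite coefB coef_map; apply: (layer_diff_val hp hOm hu hv hl (fJL i)).
  have := val_geX vv i (pi2_ge0 (subgroup_id oJ)); rewrite mulr0; exact.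
(* Write pi = g(pi2) with [g] invariant. Then g - pi vanishes on [F1], so it is [f] times an
   integral polynomial; applying [s] and evaluating at [pi2] shows that (s f)(pi2) divides pi - s
   pi. *)
have [g [szg gJ piE]] := layer_expansion hp hOm hu hv hl2 pi_JL2.
have gZ : forall i, val_ge v 0 g`_i.
  apply: (layer_coef_integral hp hOm hu hv hl2) => //; rewrite -piE.
  by rewrite val_geN0 ?(layer_pi_neq0 hl) // (layer_pi_val hp hOm hu hv hl) invr_ge0.
have sg r : J r -> map_poly r g = g.
  by move=> Jr; apply/polyP => i; rewrite coef_map /= gJ.
have [||q qE qZ] := @integral_quotient _ v vv F1 (g - pi%:P) (orb_uniq hOm oJL pi2) FZ.
- move=> i; rewrite coefB; apply: val_geB => //; rewrite coefC; case: (i == 0)%N.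
    by rewrite val_geN0 ?(layer_pi_neq0 hl) // (layer_pi_val hp hOm hu hv hl) invr_ge0.
  exact: val_ge0.
- apply/allP => b /F1P[h [Jh fh] <-]; rewrite /root !hornerE.
  rewrite -{1}(sg h Jh) horner_map -piE subr_eq0; apply/eqP.
  by apply: (in_layer_pi hl) => //; apply: JG.
have := congr1 (fun c => (map_poly s c).[pi2]) qE.
rewrite rmorphB rmorphM /= hornerD hornerN hornerM (sg s Js) map_polyC hornerC -piE.
rewrite -/f sfE => e.
have sp0 : pi - s pi != 0 by rewrite subr_eq0 eq_sym.
have -> : v (s pi - pi) = v (pi - s pi) by rewrite -(valN vv) opprB.
rewrite -val_geN0 // e -[X in val_ge _ X _]addr0; apply: val_geM => //.
  exact: val_ge_id.
rewrite horner_coef; apply: val_ge_sum => // i _; rewrite -[0]addr0; apply: val_geM => //.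
  by rewrite coef_map (val_ge_inertia hp hOm hu hv).
have := val_geX vv i (pi2_ge0 (subgroup_id oJ)); rewrite mulr0; exact.
Qed.

Local Notation cut2 := (cut v n2 pi2).

(** Up to a shift by 1, the Herbrand function phi of the larger layer over the smaller one. *)
Definition psi (x : rat) : rat := e'%:R^-1 * \sum_(b <- F1) cut2 b x.

Lemma psi_mono x y : x <= y -> psi x <= psi y.
Proof.
move=> xy; rewrite /psi ler_wpM2l ?invr_ge0 //; apply: ler_sum => b _.
exact: cut_mono.
Qed.

Definition max_lift (s : {rmorphism Om -> Om}) := J s /\
  forall s' : {rmorphism Om -> Om}, J s' -> {in ys, s' =1 s} -> v (s' pi2 - pi2) <= v (s pi2 - pi2).

Lemma max_lift_exists s : J s ->
  exists2 s' : {rmorphism Om -> Om}, {in ys, s' =1 s} & max_lift s'.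
Proof.
move=> Js; pose P (j : 'I_n2) := all (fun y => tau2 j y == s y) ys.
have [j0 hj0] := layer_rep hl2 Js.
have P0 : P j0 by apply/allP => y yl; rewrite -hj0 // sub12.
case: (@Order.TotalTheory.arg_maxP _ _ _ j0 P (fun j => v (tau2 j pi2 - pi2)) P0) => j Pj maxj.
exists (tau2 j); first by move=> y yl; apply/eqP/(allP Pj).
split=> [|s' Js' e]; first exact: layer_Jtau hl2 j.
have [l hls] := layer_rep hl2 Js'.
rewrite (layer_agree_pi hOm hl2 (JG Js') (JG (layer_Jtau hl2 l)) hls).
apply: maxj; apply/allP => y yl; rewrite -hls ?sub12 // e //.
exact: (allP Pj).
Qed.

(** For a lift [s] of largest i_G, i_G(s h) is the minimum of i_G(h) and i_G(s): the ultrametric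
    inequality is an equality when i_G(h) < i_G(s), and otherwise maximality supplies the missing
    bound. *)
Lemma max_lift_val s b : max_lift s -> s pi != pi -> b \in F1 ->
  n2%:R * v (s b - pi2) = cut2 b (n2%:R * v (s pi2 - pi2)).
Proof.
move=> [Js maxs] spi bF; have [h [Jh fh] hb] := (F1P b).1 bF.
have sb0 : s b - pi2 != 0 by rewrite subr_eq0 moved.
have sp0 : s pi2 - pi2 != 0 by rewrite subr_eq0 moved // (orb_id hOm oJL).
have le : v (s b - pi2) <= v (s pi2 - pi2).
  rewrite -hb; apply: (maxs (s \o h)) => [|y yl /=]; first exact: (subgroup_comp oJ).
  by rewrite fh.
have n20 : 0 < n2%:R :> rat by rewrite ltr0n (layer_n_gt0 hp hOm hu hv hl2).
rewrite /cut; have [->//|nb] := eqVneq b pi2.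
have d0 : b - pi2 != 0 by rewrite subr_eq0.
have sE : s b - pi2 = s (b - pi2) + (s pi2 - pi2) by rewrite rmorphB addrA subrK.
have vsd : v (s (b - pi2)) = v (b - pi2) by apply: (val_inertia hp hOm hu hv).
rewrite -minr_pMr ?ltW //; congr (_ * _).
have [lt|ge] := ltP (v (b - pi2)) (v (s pi2 - pi2)).
  have [_] : s (b - pi2) + (s pi2 - pi2) != 0 /\
      v (s (b - pi2) + (s pi2 - pi2)) = v (s (b - pi2)).
    by apply: valD_eq; rewrite ?fmorph_eq0 // vsd val_gtN0.
  by rewrite -sE vsd.
apply/eqP; rewrite eq_le le -val_geN0 // sE; apply: val_geD => //.
  by rewrite val_geN0 ?fmorph_eq0 // vsd.
exact: val_ge_id.
Qed.

Lemma psi_max_lift s : max_lift s -> s pi != pi ->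
  psi (n2%:R * v (s pi2 - pi2)) = n%:R * v (s pi - pi).
Proof.
move=> ms spi; have e0 : e'%:R != 0 :> rat by rewrite pnatr_eq0 -lt0n.
rewrite /psi (eq_big_seq (fun b => n2%:R * v (s b - pi2))); last first.
  by move=> b bF; apply/esym/max_lift_val.
rewrite -mulr_sumr -val_fiber_sum //; last by case: ms.
by rewrite fibers_size natrM; field.
Qed.

(** Transitivity of phi, shifted by 1: the sum over the larger group is split by restriction to the
    smaller layer, and each part is evaluated with a maximal lift. *)
Lemma herbrand_tower x :
  herbrand v tau2 pi2 (x - 1) = herbrand v tau pi (psi x - 1).
Proof.
have e0 : e'%:R != 0 :> rat by rewrite pnatr_eq0 -lt0n.
(* Over the identity of the smaller layer the lift is the identity, whose i_G is infinite; elsewhere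
   it is a maximal one. *)
have /boolp.choice[S hS] : forall i : 'I_n, exists s : {rmorphism Om -> Om},
    (J s /\ {in ys, s =1 tau i}) /\
    (if tau i pi == pi then s pi2 = pi2 /\ {in ys, forall y, s y = y} else max_lift s).
  move=> i; have Ji := layer_Jtau hl i.
  case: eqP => [e|_]; last by have [s hs ms] := max_lift_exists Ji; exists s; split=> //; split=> //; case: ms.
  have [_ f] := layer_groupP hp hOm hu hv hl Ji e.
  exists idfun; split=> //; split; first exact: (subgroup_id oJ).
  by move=> y yl /=; rewrite f.
have SE i : S i pi = tau i pi.
  have [[JSi Si] _] := hS i.
  exact: (layer_agree_pi hOm hl (JG JSi) (JG (layer_Jtau hl i)) Si).
rewrite !herbrandE !subrK (sum_fibers (fun a => cut2 a x) (fun i => (hS i).1)).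
have n2E : n2%:R = n%:R * e'%:R :> rat by rewrite -natrM -fibers_size.
rewrite n2E invfM -mulrA; congr (_ * _ - _); rewrite mulr_sumr.
apply: eq_bigr => i _; have [[JSi Si] hi] := hS i; rewrite [RHS]/cut.
case: eqP hi => [e [Sp fS]|/eqP ne ms].
  rewrite /psi; congr (_ * _); have pS := orb_perm hOm oJL pi2 (conj JSi fS).
  by rewrite -[RHS](perm_big _ pS) big_map.
have Spi : S i pi != pi by rewrite SE.
rewrite -SE -(psi_max_lift ms Spi).
have -> : Num.min (psi (n2%:R * v (S i pi2 - pi2))) (psi x) =
    psi (Num.min (n2%:R * v (S i pi2 - pi2)) x).
  have [le|lt] := leP (n2%:R * v (S i pi2 - pi2)) x.
    by apply/min_idPl/psi_mono.
  by apply/min_idPr/psi_mono/ltW.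
rewrite /psi; congr (_ * _); apply: eq_big_seq => b bF.
by rewrite cut_min -max_lift_val // {1}/cut (negPf (moved JSi Spi bF)).
Qed.

Lemma upper_number_max_lift s : max_lift s -> s pi != pi ->
  upper_number v tau2 pi2 s = upper_number v tau pi s.
Proof. by move=> ms spi; rewrite /upper_number herbrand_tower psi_max_lift. Qed.

(** A maximal lift has the same upper number in both layers, and every other lift has an i_G that is
    no larger. *)
Lemma upper_number_le s : J s -> s pi != pi ->
  upper_number v tau2 pi2 s <= upper_number v tau pi s.
Proof.
move=> Js spi; have [s' e ms] := max_lift_exists Js.
have spi' : s' pi = s pi.
  exact: (layer_agree_pi hOm hl (JG ms.1) (JG Js) e).
rewrite /upper_number herbrand_tower; apply: herbrand_mono; rewrite lerD2r.
rewrite -spi' -psi_max_lift //; last by rewrite spi'.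
apply: psi_mono; rewrite ler_wpM2l //; apply: ms.2 => // y yl.
by rewrite e.
Qed.

End TwoLayers.
End Herbrand.

(** * Lifts to the whole inertia group *)

Section RamificationLift.
Variables (p : nat) (Om : fieldType) (t : Om).
Hypothesis hp : prime p.
Hypothesis hOm : is_sepclosure_Fpt p t.
Local Notation k := (@Fpbar p Om).
Local Notation Gal := (Defs.gal t k).
Variables (v : Om -> rat) (u : Om).
Hypothesis hu : uniformizer p t u.
Hypothesis hv : place_over u v.

Let vv : valuation v := hv.1.
Local Notation J := (@inertia_gal p Om t v).
Let oJ := inertia_subgroup hp hOm hu hv.
Let JG s : J s -> Gal s. Proof. by case. Qed.

Lemma layer_over (xs : seq Om) : exists ys n (tau : 'I_n -> {rmorphism Om -> Om}) pi,
  {subset xs <= ys} /\ galois_layer p t v ys tau pi.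
Proof.
have [ys [sub st]] := stable_closure hOm (subgroup_Gal hOm) xs.
have [n [tau [pi hl]]] := layer_exists hp hOm hu hv st.
by exists ys, n, tau, pi.
Qed.

(** Layers packed into one type, to serve as indices in the compactness argument. *)
Record layer_data := LayerData {
  ld_ys : seq Om;
  ld_n : nat;
  ld_tau : 'I_ld_n -> {rmorphism Om -> Om};
  ld_pi : Om;
  ld_layer : galois_layer p t v ld_ys ld_tau ld_pi }.

(* Herbrand's theorem gives lifts to finitely many larger layers, compactness a
   common lift to all of them. *)
Lemma ramification_lift ys n (tau : 'I_n -> {rmorphism Om -> Om}) pi sg :
  galois_layer p t v ys tau pi -> J sg -> sg pi != pi ->
  exists s : {rmorphism Om -> Om}, [/\ J s, {in ys, s =1 sg} &
    forall zs m (tau' : 'I_m -> {rmorphism Om -> Om}) pi',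
      galois_layer p t v zs tau' pi' -> s pi' != pi' ->
      upper_number v tau pi sg <= upper_number v tau' pi' s].
Proof.
move=> hl Jsg spi; set U := upper_number v tau pi sg.
(* The left conditions say that [s] agrees with [sg] on [ys] and lies in the inertia group, the
   right ones bound its upper number in each layer. Each looks at a single element of [Om]. *)
pose C (i : Om + layer_data) (s : {rmorphism Om -> Om}) := match i with
  | inl z => (z \in ys -> s z = sg z) /\ (val_ge v 0 z -> val_gt v 0 (s z - z))
  | inr d => s (ld_pi d) != ld_pi d -> U <= upper_number v (@ld_tau d) (ld_pi d) s
  end.
pose supp (i : Om + layer_data) :=
  match i with inl z => [:: z] | inr d => [:: ld_pi d] end.
have supC i (s s' : {rmorphism Om -> Om}) : {in supp i, s =1 s'} -> C i s -> C i s'.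
  by case: i => [z|d] h; rewrite /C /upper_number h ?mem_head.
have [|s Gs Cs] := gal_compact hOm supC.
- move=> l; pose F (i : Om + layer_data) := match i with inl _ => [::] | inr d => ld_ys d end.
  pose xs := flatten (map F l).
  have hxs : forall_in (fun i => {subset F i <= xs}) l.
    rewrite /xs; elim: l {xs} => [|i l IH] //=; split.
      by move=> y yl; rewrite mem_cat yl.
    by apply: forall_in_impl IH => j h y /h; rewrite mem_cat orbC => ->.
  have [ys2 [n2 [tau2 [pi2 [sub hl2]]]]] := layer_over (ys ++ xs).
  have sub1 : {subset ys <= ys2} by move=> y yl; apply: sub; rewrite mem_cat yl.
  have [s e ms] := max_lift_exists hOm hl2 sub1 Jsg.
  have [Js _] := ms.
  have se : s pi = sg pi by apply: (layer_agree_pi hOm hl (JG Js) (JG Jsg) e).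
  exists s; first exact: JG.
  apply: forall_in_impl hxs => -[z|d] /= subd.
    by split=> [/e//|]; apply: Js.2.
  move=> sd; have sub2 : {subset ld_ys d <= ys2}.
    by move=> y /subd yl; apply: sub; rewrite mem_cat yl orbT.
  have := upper_number_le hp hOm hu hv (ld_layer d) hl2 sub2 Js sd.
  apply: le_trans; rewrite (upper_number_max_lift hp hOm hu hv hl hl2 sub1 ms) ?se //.
  by rewrite /upper_number se.
exists s; split=> [|y yl|zs m tau' pi' hl' spi'].
- by split=> // z; case: (Cs (inl z)).
- by case: (Cs (inl y)) => /(_ yl).
exact: (Cs (inr (LayerData hl'))).
Qed.

Lemma upper_number_mem (U : rat) s : J s ->
  (forall zs m (tau' : 'I_m -> {rmorphism Om -> Om}) pi',
      galois_layer p t v zs tau' pi' -> s pi' != pi' ->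
      U <= upper_number v tau' pi' s) ->
  upper_ramification p t v U s.
Proof.
move=> Js hU; split; [exact: JG|by case: Js|move=> ys n tau pi hl c c0 hc].
have [e|ne] := eqVneq (s pi) pi; first by rewrite e subrr val_ge0.
have n0 : 0 < n%:R :> rat by rewrite ltr0n (layer_n_gt0 hp hOm hu hv hl).
rewrite val_geN0 ?subr_eq0 // ler_pdivrMr // mulrC leNgt; apply/negP => lt.
have := hU _ _ _ _ hl ne; rewrite leNgt => /negP; apply.
rewrite /upper_number -hc; apply: herbrand_strict; last by lra.
have [i0 hi0] := layer_rep hl (subgroup_id oJ); exists i0.
by rewrite -(layer_agree_pi hOm hl (gal_id p t) (JG (layer_Jtau hl i0)) hi0).
Qed.

(** In a layer containing [x], a positive upper number forces i_G > 1, so that s pi / pi is a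
    one-unit. A general [x] is a power of [pi] times a unit, whose residue inertia fixes. *)
Lemma upper_number_gt0_wild s : J s ->
  (forall zs m (tau' : 'I_m -> {rmorphism Om -> Om}) pi',
      galois_layer p t v zs tau' pi' -> s pi' != pi' ->
      0 < upper_number v tau' pi' s) ->
  wild_inertia v s.
Proof.
move=> Js hU x x0; have [ys [n [tau [pi [sub hl]]]]] := layer_over [:: x].
have Lx : in_layer p t ys x by apply: in_layer_mem; apply: sub; rewrite mem_head.
have pi0 := layer_pi_neq0 hl.
have [e|ne] := eqVneq (s pi) pi.
  have [_ fs] := layer_groupP hp hOm hu hv hl Js e.
  by rewrite fs ?sub ?mem_head // divff // subrr val_gt0.
have n0 : 0 < n%:R :> rat by rewrite ltr0n (layer_n_gt0 hp hOm hu hv hl).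
have vpi := layer_pi_val hp hOm hu hv hl.
have gt1 : 1 < n%:R * v (s pi - pi).
  rewrite ltNge; apply/negP => le; have := hU _ _ _ _ hl ne.
  rewrite ltNge => /negP; apply; apply: (@le_trans _ _ (herbrand v tau pi 0)).
    by apply: herbrand_mono; lra.
  rewrite herbrandE add0r subr_le0 mulrC ler_pdivrMr // mul1r.
  apply: (@le_trans _ _ (\sum_(i < n) (1 : rat))).
    by apply: ler_sum => i _; rewrite /cut; case: ifP => // _; rewrite ge_min lexx orbT.
  by rewrite sumr_const card_ord.
have ou : one_unit v (s pi / pi).
  rewrite /one_unit -(divff pi0) -mulrBl val_gtN0 ?mulf_neq0 ?invr_eq0 ?subr_eq0 //.
  rewrite val_div ?subr_eq0 // vpi subr_gt0 -[_^-1]mul1r ltr_pdivrMr // mulrC.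
  by [].
have [a ha] : exists m : int, n%:R * v x = m%:~R.
  apply: (layer_val_frac hp hOm hu hv hl) => // r [Jr fr].
  by apply: Lx => //; apply: JG.
pose y := x * pi ^ (- a).
have piz (m : int) : pi ^ m != 0 by rewrite expfz_neq0.
have y0 : y != 0 by rewrite mulf_neq0.
have vy : v y = 0.
  rewrite /y valM // valZ // vpi mulrNz -ha.
  by field; apply: lt0r_neq0.
have oy : one_unit v (s y / y).
  rewrite /one_unit -(divff y0) -mulrBl -[0]addr0; apply: val_gtM => //.
    by apply: Js.2; rewrite val_geN0 // vy.
  by rewrite val_geN0 ?invr_eq0 // valV // vy oppr0.
suff -> : s x / x = (s pi / pi) ^ a * (s y / y).
  by apply: one_unitM => //; apply: one_unitXz.
have spi0 : s pi != 0 by rewrite fmorph_eq0.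
rewrite /y rmorphM rmorphXz ?unitfE // expfzMl exprz_inv -!invr_expz.
have e1 : s pi ^ a != 0 by rewrite expfz_neq0.
by field; rewrite x0 e1 piz.
Qed.

End RamificationLift.

Lemma exprBn_pexp (R : comNzRingType) p n (x y : R) : p \in [pchar R] ->
  (x - y) ^+ (p ^ n) = x ^+ (p ^ n) - y ^+ (p ^ n).
Proof.
move=> hR; elim: n x y => [|n IH] x y; first by rewrite !expr1.
rewrite expnSr !exprM IH; exact: (pFrobenius_autB_comm hR (mulrC _ _)).
Qed.

(** * Functions with poles at infinity only *)

Section IntegralFunctions.
Variables (p : nat) (Om : fieldType) (t : Om).
Hypothesis hp : prime p.
Hypothesis hOm : is_sepclosure_Fpt p t.
Local Notation k := (@Fpbar p Om).
Local Notation Gal := (Defs.gal t k).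
Local Notation ratfun := (@ratfun p Om t).

Let hch : p \in [pchar Om] := Om_pchar hOm.
Let ksub : is_subfield k := Fpbar_subfield hp hch.
Let oG := subgroup_Gal hOm.

(** [B] divides some X^j - X^i, which is X^i times a p-power of X^M - 1 with [M] prime to p, and all
    roots of that lie in Fpbar. *)
Lemma Fpbar_closed (B : {poly Om}) : poly_over k B -> (1 < size B)%N ->
  exists2 r, k r & root B r.
Proof.
move=> kB szB; apply: boolp.contrapT => nr.
have B0 : B != 0 by rewrite -size_poly_gt0 (leq_trans _ szB).
have [i [j [g [lt kg e]]]] := powers_congr_poly hp hch B0 kB.
have co r : k r -> coprimep B ('X - r%:P).
  move=> kr; rewrite coprimep_XsubC; apply/negP => rr.
  by apply: nr; exists r.
have N0 : (0 < j - i)%N by rewrite subn_gt0.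
have [M cpM NE] := pfactor_coprime hp N0.
have M0 : (0 < M)%N by move: N0; rewrite NE muln_gt0 => /andP[].
have [rs [E _ krs]] := unity_splits hp hOm cpM M0.
have hLp : p \in [pchar {poly Om}] by rewrite pchar_poly.
have XE : 'X^j - 'X^i = 'X^i * ('X^M - 1) ^+ (p ^ logn p (j - i)) :> {poly Om}.
  rewrite exprBn_pexp // expr1n -exprM -NE mulrBr mulr1 -exprD.
  by rewrite subnKC // ltnW.
have : coprimep B ('X^j - 'X^i).
  rewrite XE coprimepMr coprimep_expr ?coprimep_expr //.
    rewrite E; elim: rs krs {E} => [|r rs IH] krs; first by rewrite big_nil coprimep1.
    rewrite big_cons coprimepMr (co r (krs r (mem_head _ _))) /=; apply: IH => z zr.
    by apply: krs; rewrite inE zr orbT.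
  by have := co 0; rewrite subr0; apply; apply: subfield0.
by rewrite e coprimepMr => /andP[_]; rewrite coprimepp => /eqP sz1; rewrite sz1 in szB.
Qed.

Lemma poly_over_factor (B : {poly Om}) a : poly_over k B -> k a -> root B a ->
  exists2 B1, poly_over k B1 & B = B1 * ('X - a%:P).
Proof.
move=> kB ka ra; have [K [i iK]] := subfield_type ksub.
have [|B' B'E] := @poly_lift _ _ i B; first by move=> j; apply/iK.
have [b ib] := (iK a).1 ka.
have /factor_theorem[q qE] : root B' b by rewrite -(fmorph_root i) B'E ib.
exists (map_poly i q); first by move=> j; rewrite coef_map; apply/iK; exists q`_j.
by rewrite -B'E qE rmorphM rmorphB /= map_polyX map_polyC /= ib.
Qed.

Lemma ratfun_polynomial x : ratfun x ->
  (forall a, k a -> exists2 v, place_over (t - a) v & val_ge v 0 x) ->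
  exists2 C, poly_over k C & x = C.[t].
Proof.
move=> [A [B [kA kB nB ->]]] hx.
have [n] := ubnP (size B); elim: n A B kA kB nB hx => // n IH A B kA kB nB hx szn.
have [sz1|sz1] := leqP (size B) 1.
  have BE : B.[t] = B`_0 by rewrite [in LHS](size1_polyC sz1) hornerC.
  exists ((B`_0)^-1 *: A); last by rewrite hornerZ BE mulrC.
  by rewrite -mul_polyC; apply: poly_overM => //; apply: poly_overC => //; apply: subfieldV.
have [a ka ra] := Fpbar_closed kB sz1.
have [B1 kB1 BE] := poly_over_factor kB ka ra.
have [v hv xv] := hx a ka; have vv : valuation v := hv.1.
have ta0 : t - a != 0.
  by apply: contraNneq nB => ta; rewrite BE hornerM hornerXsubC ta mulr0.
have hut : uniformizer p t (t - a) by left; exists a.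
have B10 : B1.[t] != 0 by apply: contraNneq nB => e; rewrite BE hornerM e mul0r.
have integ C : poly_over k C -> val_ge v 0 C.[t].
  move=> kC; rewrite horner_coef; apply: val_ge_sum => // i _.
  rewrite -[0]addr0; apply: val_geM => //; first exact: (val_ge_const hp hv).
  have := val_geX vv i (_ : val_ge v 0 t); rewrite mulr0; apply.
  rewrite -(subrK a t); apply: val_geD => //; last exact: (val_ge_const hp hv).
  by rewrite val_geN0 // hv.2.
(* The quotient is integral at this place, so a root of the denominator is a root of the numerator;
   the common factor is cancelled. *)
have rA : root A a.
  have kAa : k A.[a] by apply: subfield_horner.
  apply/eqP; apply/eqP; apply: contraT => nA.
  have vA : val_gt v 0 A.[t].
    have -> : A.[t] = B.[t] * (A.[t] / B.[t]) by rewrite mulrC divfK.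
    rewrite -[0]addr0; apply: val_gtM => //; rewrite BE hornerM hornerXsubC mulrC.
    rewrite -[0]addr0; apply: val_gtM => //; last exact: integ.
    by rewrite val_gtN0 // hv.2.
  have dvd : val_gt v 0 (A.[t] - A.[a]).
    have kA' : poly_over k (A - A.[a]%:P) by apply: poly_overB => //; apply: poly_overC.
    have [|A1 kA1 A1E] := poly_over_factor kA' ka.
      by rewrite /root !hornerE subrr.
    have -> : A.[t] - A.[a] = (t - a) * A1.[t].
      by have := congr1 (fun C => C.[t]) A1E; rewrite !hornerE mulrC.
    rewrite -[0]addr0; apply: val_gtM => //; last exact: integ.
    by rewrite val_gtN0 // hv.2.
  have : val_gt v 0 A.[a].
    have -> : A.[a] = A.[t] - (A.[t] - A.[a]) by rewrite opprB addrC subrK.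
    exact: val_gtB.
  by rewrite val_gtN0 // (val_const hp hv).
have [A1 kA1 AE] := poly_over_factor kA ka rA.
have xE : A.[t] / B.[t] = A1.[t] / B1.[t].
  by rewrite AE BE !hornerM !hornerXsubC; field; rewrite B10 ta0.
rewrite xE; apply: IH => //; first by move=> b kb; have [w hw xw] := hx b kb; exists w; rewrite -?xE.
rewrite -ltnS (leq_trans _ szn) // BE size_mul ?polyXsubC_eq0 ?size_XsubC ?addn2 //.
by apply: contraNneq B10 => ->; rewrite horner0.
Qed.

Lemma integral_equation (v : Om -> rat) (z : Om) (n : nat) (b : nat -> Om) :
  valuation v -> (forall i, (i < n)%N -> val_ge v 0 (b i)) ->
  z ^+ n = \sum_(i < n) b i * z ^+ i -> val_ge v 0 z.
Proof.
move=> vv hb e; have [->|z0] := eqVneq z 0; first exact: val_ge0.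
rewrite val_geN0 // leNgt; apply/negP => lt.
case: n hb e => [|n] hb e.
  by move: e; rewrite big_ord0 expr0 => /eqP; rewrite oner_eq0.
have : val_ge v (n%:R * v z) (z ^+ n.+1).
  rewrite e; apply: val_ge_sum => // i _; rewrite -[_ * v z]add0r.
  apply: val_geM => //; first exact: hb.
  rewrite val_geN0 ?expf_neq0 // valX //; apply: ler_wnM2r; first exact: ltW.
  by rewrite ler_nat -ltnS ltn_ord.
rewrite val_geN0 ?expf_neq0 // valX // -natr1; lra.
Qed.

(** [q] is the leading coefficient of a polynomial over Fpbar[t] with root [x]; q(t) times any
    conjugate of [x] is then integral over Fpbar[t]. *)
Lemma clear_denominators x : exists q, [/\ poly_over k q, q != 0 &
  forall v a, k a -> place_over (t - a) v -> forall s, Gal s -> val_ge v 0 (s (q.[t] * x))].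
Proof.
have [f [sf rf fs [g fg]]] := separable_poly_of hOm x.
have f0 := separable_poly_neq0 sf.
have kg i : poly_over k (map_poly intr g`_i).
  move=> j; rewrite coef_map /=; case: ((g`_i)`_j) => n.
    by rewrite -pmulrn; apply: subfield_nat.
  by rewrite NegzE mulrNz; apply: subfieldN => //; rewrite -pmulrn; apply: subfield_nat.
have fi i : f`_i = (map_poly intr g`_i).[t].
  by rewrite fg /eval_at coef_map_id0 ?rmorph0 ?horner0.
pose d := (size f).-1.
have l0 : f`_d != 0 by rewrite -/(lead_coef f) lead_coef_eq0.
have szf : size f = d.+1 by rewrite prednK // size_poly_gt0.
exists (map_poly intr g`_d); split=> //.
  by apply: contraNneq l0 => e; rewrite fi e horner0.
move=> v a ka hv s Gs; have vv : valuation v := hv.1.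
have integ C : poly_over k C -> val_ge v 0 C.[t].
  move=> kC; rewrite horner_coef; apply: val_ge_sum => // i _.
  rewrite -[0]addr0; apply: val_geM => //; first exact: (val_ge_const hp hv).
  have := val_geX vv i (_ : val_ge v 0 t); rewrite mulr0; apply.
  rewrite -(subrK a t); apply: val_geD => //; last exact: (val_ge_const hp hv).
  by have := val_ge_id v (t - a); rewrite hv.2; apply: val_ge_le.
have d0 : (0 < d)%N.
  rewrite lt0n; apply/eqP => d0; move: rf; rewrite /root horner_coef szf d0 big_ord1.
  by rewrite expr0 mulr1; have := l0; rewrite d0 => /negPf->.
pose l := f`_d; rewrite -fi -/l.
have fsi i : s f`_i = f`_i by rewrite -coef_map fs.
apply: (@integral_equation v _ d (fun i => - (f`_i * l ^+ (d.-1 - i)))) => // [i lt|].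
  rewrite val_geN // fi -[0]addr0; apply: val_geM => //; first exact: integ.
  have := val_geX vv (d.-1 - i) (_ : val_ge v 0 l); rewrite mulr0; apply.
  by rewrite /l fi; apply: integ.
have rsx : f.[s x] = 0 by rewrite -(fs s Gs) horner_map (eqP rf) rmorph0.
move: rsx; rewrite horner_coef szf big_ord_recr /= -/l => /eqP.
rewrite addrC addr_eq0 => /eqP e.
rewrite rmorphM fsi -/l.
have -> : (l * s x) ^+ d = l ^+ d.-1 * (l * s x ^+ d).
  by rewrite exprMn mulrA -exprSr prednK.
rewrite e mulrN big_distrr /= -sumrN; apply: eq_bigr => i _.
rewrite mulNr; congr (- _).
have le : (i <= d.-1)%N by rewrite -ltnS prednK.
by rewrite -[in l ^+ d.-1](subnK le) exprD exprMn; ring.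
Qed.

Section Infinity.
Variable v : Om -> rat.
Hypothesis hv : place_over t^-1 v.
Let vv : valuation v := hv.1.

Lemma val_infty_t : v t = -1.
Proof.
have t0 : t != 0.
  by have := uniformizer_neq0 hp hOm (or_intror (erefl _) : uniformizer p t t^-1); rewrite invr_eq0.
by have := hv.2; rewrite valV // => h; lra.
Qed.

Lemma val_infty_poly C : poly_over k C -> C != 0 ->
  C.[t] != 0 /\ v C.[t] = - (size C).-1%:R.
Proof.
move=> kC C0.
have t0 : t != 0.
  by have := uniformizer_neq0 hp hOm (or_intror (erefl _) : uniformizer p t t^-1); rewrite invr_eq0.
have lt0 : ((size C).-1 < size C)%N by rewrite prednK // size_poly_gt0.
have l0 : C`_(size C).-1 != 0 by rewrite -/(lead_coef C) lead_coef_eq0.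
have vt i c : k c -> c != 0 -> c * t ^+ i != 0 /\ v (c * t ^+ i) = - i%:R.
  move=> kc c0; rewrite mulf_neq0 ?expf_neq0 // valM ?expf_neq0 // valX //.
  by rewrite (val_const hp hv) // val_infty_t add0r mulrN1.
rewrite horner_coef; have [n1 <-] := vt (size C).-1 _ (kC _) l0.
apply: (@val_sum_eq _ v vv _ (fun i : 'I_(size C) => C`_i * t ^+ i) (Ordinal lt0)) => // i ni.
have [e|ci] := eqVneq C`_i 0; first by rewrite e mul0r val_gt0.
have [n2 v2] := vt i _ (kC i) ci; have [_ v1] := vt (size C).-1 _ (kC _) l0.
rewrite val_gtN0 // v2 v1 ltrN2 ltr_nat.
have : i != (size C).-1 :> nat by apply: contraNneq ni => e; apply/eqP/val_inj.
have lt := ltn_ord i; move=> ne.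
by rewrite ltn_neqAle ne -ltnS (ltn_predK lt).
Qed.

(** Let [c] be the residue of [x] at [v0]. The norm of x - c is a polynomial in [t] without pole at
    oo, hence a constant; it vanishes at [v0], so it is 0 and x = c. *)
Lemma integral_const x v0 : place_over t v0 ->
  (forall a, k a -> exists2 w, place_over (t - a) w &
     forall s, Gal s -> val_ge w 0 (s x)) ->
  (forall s, Gal s -> val_ge v0 0 (s x)) ->
  (forall s, Gal s -> val_ge v 0 (s x)) -> k x.
Proof.
move=> hv0 xfin x0 xinf; have vv0 : valuation v0 := hv0.1.
have ut : uniformizer p t t by left; exists 0; [apply: subfield0|rewrite subr0].
have [c kc hc] := residue hp hOm ut hv0 (x0 _ (gal_id p t)).
pose N := \prod_(y <- orb Gal x) (y - c).
have sc s : Gal s -> s c = c by move=> Gs; apply: Gs.2.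
have Nfix s : Gal s -> s N = N.
  move=> Gs; apply: (orb_prod_fixed hOm oG (f := fun y => y - c)) => // y.
  by rewrite rmorphB /= sc.
have Nint w u : place_over u w -> (forall s, Gal s -> val_ge w 0 (s x)) -> val_ge w 0 N.
  move=> hw xw; rewrite /N big_seq; apply: (val_ge_prod hw.1) => y /(orbP hOm oG)[s Gs <-].
  by apply: (val_geB hw.1); [apply: xw|apply: (val_ge_const hp hw)].
have [|C kC NE] := ratfun_polynomial (ratfun_fixed hp hOm Nfix).
  by move=> a ka; have [w hw xw] := xfin a ka; exists w => //; apply: Nint hw xw.
have szC : (size C <= 1)%N.
  have [->|C0] := eqVneq C 0; first by rewrite size_poly0.
  have [Ct0 vC] := val_infty_poly kC C0.
  have := Nint v _ hv xinf; rewrite NE val_geN0 // vC oppr_ge0 lern0.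
  by case: (size C) => [|[]].
have kN : k N by rewrite NE (size1_polyC szC) hornerC.
have N0 : N = 0.
  apply/eqP; apply: contraT => nN.
  have : val_gt v0 0 N.
    rewrite /N (big_rem x) ?(orb_id hOm oG) //= -[0]addr0.
    apply: (val_gtM vv0) => //; rewrite big_seq; apply: (val_ge_prod vv0) => y.
    move=> /mem_rem /(orbP hOm oG)[s Gs <-].
    by apply: (val_geB vv0); [apply: x0|apply: (val_ge_const hp hv0)].
  by rewrite val_gtN0 // (val_const hp hv0).
move/eqP: N0; rewrite prodf_seq_eq0 => /hasP[y /(orbP hOm oG)[s Gs <-]] /=.
by rewrite subr_eq0 -(sc s Gs) => /eqP/fmorph_inj->.
Qed.

End Infinity.
End IntegralFunctions.

(** * Iterates of an inertia element *)

Section InertiaIterates.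
Variables (p : nat) (Om : fieldType) (t : Om).
Hypothesis hp : prime p.
Hypothesis hOm : is_sepclosure_Fpt p t.
Local Notation k := (@Fpbar p Om).
Let ksub : is_subfield k := Fpbar_subfield hp (Om_pchar hOm).
Variables (v : Om -> rat) (u : Om).
Hypothesis hu : uniformizer p t u.
Hypothesis hv : place_over u v.
Local Notation J := (inertia_gal p t v).

Lemma inertia_iter s i : J s -> exists2 r : {rmorphism Om -> Om}, J r & r =1 iter i s.
Proof.
have oJ := inertia_subgroup hp hOm hu hv.
move=> Js; elim: i => [|i [r Jr rE]]; first by exists idfun => //; apply: (subgroup_id oJ).
by exists (s \o r); [apply: (subgroup_comp oJ)|move=> x /=; rewrite rE].
Qed.

(* [s |-> s x / x] is multiplicative modulo the maximal ideal, since inertia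
   fixes the residues. *)
Lemma inertia_residue s x : J s -> x != 0 -> exists c,
  [/\ k c, c != 0 & forall i, val_gt v 0 (iter i s x / x - c ^+ i)].
Proof.
move=> Js x0; have vv := hv.1.
have vx0 : s x / x != 0 by rewrite mulf_neq0 ?invr_eq0 ?fmorph_eq0.
have vx : v (s x / x) = 0.
  by rewrite val_div ?fmorph_eq0 // (val_inertia hp hOm hu hv Js) // subrr.
have xge : val_ge v 0 (s x / x) by rewrite val_geN0 // vx.
have [c kc hc] := residue hp hOm hu hv xge.
exists c; split=> //.
  by apply: contraTneq hc => ->; rewrite subr0 val_gtN0 // vx.
elim=> [|i IH]; first by rewrite /= divff // expr0 subrr val_gt0.
have -> : iter i.+1 s x / x - c ^+ i.+1 =
    s (iter i s x / x - c ^+ i) * (s x / x) + c ^+ i * (s x / x - c).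
  have sc : s c = c by case: Js => -[_ ->].
  rewrite /= rmorphB rmorphXn sc fmorph_div exprSr.
  field; by rewrite fmorph_eq0 x0.
apply: (val_gtD vv).
  by rewrite -[0]addr0; apply: (val_gtM vv) => //; rewrite (val_gt_inertia hp hOm hu hv).
rewrite mulrC -[0]addr0; apply: (val_gtM vv) => //; apply: (val_ge_const hp hv).
exact: subfieldX.
Qed.

End InertiaIterates.

(** * Covers of the line with upper ramification less than 1 at infinity *)

Section UnramifiedCovers.
Variables (p : nat) (Om : fieldType) (t : Om).
Hypothesis hp : prime p.
Hypothesis hOm : is_sepclosure_Fpt p t.
Local Notation k := (@Fpbar p Om).
Local Notation Gal := (Defs.gal t k).
Local Notation ratfun := (@ratfun p Om t).

Let hch : p \in [pchar Om] := Om_pchar hOm.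
Let ksub : is_subfield k := Fpbar_subfield hp hch.
Let oG := subgroup_Gal hOm.

Variable v : Om -> rat.
Hypothesis hv : place_over t^-1 v.
Let vv : valuation v := hv.1.
Let hu : uniformizer p t t^-1 := or_intror erefl.
Local Notation J := (@inertia_gal p Om t v).
Let oJ := inertia_subgroup hp hOm hu hv.
Local Notation D := (ddt p t).
Let hD := ddt_derivation hp hOm.

Let JG s : J s -> Gal s. Proof. by case. Qed.

Variable H : {rmorphism Om -> Om} -> Prop.
Hypothesis oH : subgroup p t H.
Hypothesis Hext : forall s s' : {rmorphism Om -> Om}, Gal s' -> s =1 s' -> H s -> H s'.
Hypothesis Hnorm : forall g g' s : {rmorphism Om -> Om}, Gal g -> Gal g' ->
  cancel g g' -> cancel g' g -> H s -> H (g \o (s \o g')).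
Hypothesis Hopen : exists ys : seq Om, forall s : {rmorphism Om -> Om}, Gal s ->
  {in ys, forall y, s y = y} -> H s.
Hypothesis Hfin : forall a, k a -> exists2 w, place_over (t - a) w &
  forall s, inertia_gal p t w s -> H s.
(** Wildness accompanies the upper index because the tame part of the sheaf at oo is known to be
    fixed by wild inertia, the other part by the groups of large upper index. *)
Hypothesis Hinf : forall (U : rat) s, 1 <= U -> upper_ramification p t v U s ->
  wild_inertia v s -> H s.

Let HG s : H s -> Gal s. Proof. exact: (subgroup_gal oH). Qed.

Definition fixed_by x := forall s, H s -> s x = x.

Lemma fixed_by_subfield : is_subfield fixed_by.
Proof.
split=> [s _|x y hx hy s Hs|x y hx hy s Hs|x hx s Hs].
- exact: rmorph1.
- by rewrite rmorphB hx ?hy.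
- by rewrite rmorphM hx ?hy.
- by rewrite fmorphV hx.
Qed.
Let fsub := fixed_by_subfield.

Lemma fixed_by_gal g x : Gal g -> fixed_by x -> fixed_by (g x).
Proof.
move=> Gg hx s Hs; have [g' [Gg' gg' g'g]] := gal_inv hOm Gg.
have := hx _ (Hnorm Gg' Gg g'g gg' Hs); rewrite /= => e.
by rewrite -{2}e g'g.
Qed.

Lemma fixed_by_ratfun x : ratfun x -> fixed_by x.
Proof. by move=> rx s /HG Gs; apply: (gal_ratfun Gs rx). Qed.

(** [E] holds the conjugates of the coefficients of [f], whose roots are the H-orbit of a primitive
    element [th]. If [s] fixes them, it maps [th] to h(th) for some [h] in [H]; then h^-1 s fixes
    [ys0], so it lies in [H]. *)
Lemma fixed_by_list : exists E : seq Om,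
  [/\ forall s, Gal s -> {in E, forall y, s y \in E},
      forall y, y \in E -> fixed_by y &
      forall s, Gal s -> {in E, forall y, s y = y} -> H s].
Proof.
have [ys0 hys0] := Hopen.
have [th hth] := primitive_element hp hOm ys0.
pose f : {poly Om} := \prod_(y <- orb H th) ('X - y%:P).
have fH s : H s -> map_poly s f = f by apply: (orb_poly_fixed hOm oH).
pose o := flatten [seq orb Gal y | y <- (f : seq Om)].
have [E' [subE' stE' memE']] : exists E' : seq Om, [/\ {subset (f : seq Om) <= E'},
    forall s, Gal s -> {in E', forall z, s z \in E'} &
    forall z, z \in E' -> exists2 s, Gal s & exists2 c, c \in (f : seq Om) & s c = z].
  exists o; split.
  - by move=> y yl; apply/flatten_mapP; exists y => //; apply: (orb_id hOm oG).
  - move=> s Gs z /flatten_mapP[y yl /(orbP hOm oG)[s' Gs' <-]].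
    apply/flatten_mapP; exists y => //; apply/(orbP hOm oG).
    by exists (s \o s') => //; apply: gal_comp.
  - by move=> z /flatten_mapP[y yl /(orbP hOm oG)[s Gs <-]]; exists s => //; exists y.
exists E'; split=> //.
  move=> z /memE'[s Gs [c cf <-]]; apply: fixed_by_gal => // r Hr.
  by have /(nthP 0)[i _ <-] := cf; rewrite -[in RHS](fH r Hr) coef_map.
move=> s Gs fs; have sf : map_poly s f = f.
  apply/polyP => i; rewrite coef_map /=; have [lt|ge] := ltnP i (size f).
    by apply/fs/subE'/mem_nth.
  by rewrite nth_default // raddf0.
have : root f (s th).
  by rewrite -sf fmorph_root root_prod_XsubC (orb_id hOm oH).
rewrite root_prod_XsubC => /(orbP hOm oH)[h Hh hE].
have [h' [Hh' hh' h'h]] := subgroup_inv oH Hh.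
have Hc : H (h' \o s).
  apply: hys0; first by apply: gal_comp => //; apply: HG.
  move=> y yl /=; have := (hth s h Gs (HG Hh)).1 (esym hE) y yl => ->.
  exact: hh'.
by apply: Hext (subgroup_comp oH Hh Hc) => // x /=; rewrite h'h.
Qed.

Lemma infinity_layer : exists E n (tau : 'I_n -> {rmorphism Om -> Om}) pi,
  [/\ galois_layer p t v E tau pi, forall y, y \in E -> fixed_by y &
      forall s, Gal s -> {in E, forall y, s y = y} -> H s].
Proof.
have [E [stE fE hE]] := fixed_by_list.
have [n [tau [pi hl]]] := layer_exists hp hOm hu hv stE.
by exists E, n, tau, pi.
Qed.

(** The lift of [s] to the whole group is wild and lies in I^(U) with U >= 1, so [Hinf] applies to
    it. *)
Lemma upper_number_trivial ys n (tau : 'I_n -> {rmorphism Om -> Om}) pi s :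
  galois_layer p t v ys tau pi -> J s -> s pi != pi ->
  1 <= upper_number v tau pi s ->
  exists s' : {rmorphism Om -> Om}, H s' /\ {in ys, s' =1 s}.
Proof.
move=> hl Js spi U1; have [s' [Js' e hU]] := ramification_lift hp hOm hu hv hl Js spi.
exists s'; split=> //; apply: (Hinf U1).
  exact: (upper_number_mem hp hOm hu hv Js' hU).
apply: (upper_number_gt0_wild hp hOm hu hv Js') => zs m tau' pi' hl' spi'.
by apply: lt_le_trans (hU _ _ _ _ hl' spi'); lra.
Qed.

(** Choose s = tau i with w = v (s pi - pi) largest. No minimum in Serre's formula is then cut off,
    and the upper number of [s] is delta + w - 1, where w >= 1 / n. If it were at least 1, [s] would
    act on [E] like an element of [H], that is, trivially. *)
Lemma different_bound E n (tau : 'I_n -> {rmorphism Om -> Om}) pi :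
  galois_layer p t v E tau pi -> (forall y, y \in E -> fixed_by y) ->
  different_exponent v tau pi + n%:R^-1 < 2.
Proof.
move=> hl fE; set dl := different_exponent _ _ _.
have n0 : (0 < n)%N := layer_n_gt0 hp hOm hu hv hl.
have n0' : 0 < n%:R :> rat by rewrite ltr0n.
have [[i1 h1]|triv] := boolp.pselect (exists i, tau i pi != pi); last first.
  have -> : dl = 0.
    by rewrite /dl /different_exponent big1 // => i hi; case: triv; exists i.
  rewrite add0r; apply: (@le_lt_trans _ _ 1) => //.
  by rewrite invf_le1 // ler1n.
pose P i := tau i pi != pi.
case: (@Order.TotalTheory.arg_maxP _ _ _ i1 P (fun j => v (tau j pi - pi)) h1) => i Pi maxi.
set w := v (tau i pi - pi) in maxi.
rewrite ltNge; apply/negP => ge2.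
have [i0 hi0] := layer_rep hl (subgroup_id oJ).
have pi_i0 : tau i0 pi = pi.
  by rewrite -(layer_agree_pi hOm hl (gal_id p t) (JG (layer_Jtau hl i0)) hi0).
have iE j : (tau j pi != pi) = (j != i0).
  apply/idP/idP; apply: contraNneq; first by move=> ->; rewrite pi_i0.
  by move=> e; apply/eqP/(tau_pi_inj hp hOm hu hv hl); rewrite e pi_i0.
have Ji := layer_Jtau hl i.
have wn : n%:R^-1 <= w.
  have pi0 := layer_pi_neq0 hl; have vpi := layer_pi_val hp hOm hu hv hl.
  rewrite /w -val_geN0 ?subr_eq0 //; apply: val_geB => //.
    by rewrite val_geN0 ?fmorph_eq0 // (val_spi hp hOm hu hv hl).
  by rewrite val_geN0 // vpi.
have UE : upper_number v tau pi (tau i) = dl + w - 1.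
  rewrite /upper_number herbrandE subrK (bigD1 i0) //= {1}/cut pi_i0 eqxx -/w.
  rewrite (eq_bigr (fun j => n%:R * v (tau j pi - pi))); last first.
    move=> j; rewrite -iE => nj; rewrite /cut (negPf nj) -/w; apply/min_idPl.
    by rewrite ler_pM2l //; apply: maxi.
  rewrite -mulr_sumr /dl /different_exponent (eq_bigl _ _ iE) mulrDr !mulrA mulVf ?mul1r.
    by rewrite [w + _]addrC.
  by rewrite lt0r_neq0.
have U1 : 1 <= upper_number v tau pi (tau i) by rewrite UE; lra.
have [s [Hs e]] := upper_number_trivial hl Ji Pi U1.
case/negP: Pi; apply/eqP; apply: (in_layer_pi hl) => [|y yE]; first exact: JG.
by rewrite -e // fE.
Qed.

(** The derivative -1/t^2 of 1/t gains 2, while d/d(1/t) loses at most the larger of 1 and 1 / n +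
    delta, both less than 2. *)
Lemma ddt_infinity x : fixed_by x -> x != 0 -> val_gt v (v x) (D x).
Proof.
move=> fx x0; have [E [n [tau [pi [hl fE hE]]]]] := infinity_layer.
have bnd := different_bound hl fE.
have n0 : (0 < n)%N := layer_n_gt0 hp hOm hu hv hl.
have hx r : layer_group p t v E r -> r x = x.
  by move=> [Jr fr]; apply: fx; apply: hE => //; apply: JG.
have := layer_ddu hp hOm hu hv hl hx (val_ge_id v x).
have t0 : t != 0 by have := uniformizer_neq0 hp hOm hu; rewrite invr_eq0.
have Dt : D t^-1 = - (t^-1) ^+ 2.
  by rewrite (derV hD) // (ddt_t hp hOm) exprVn mulNr div1r.
have d0 : D t^-1 != 0 by apply: (ddt_u_neq0 hp hOm hu).
have -> : D x = D t^-1 * ddu p t t^-1 x by rewrite /ddu mulrA divff // mul1r.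
move=> h; have hDt : val_ge v 2 (D t^-1).
  rewrite Dt val_geN // val_geN0 ?expf_neq0 ?invr_eq0 // valX ?invr_eq0 // hv.2.
  by rewrite mulr1.
apply: (val_ge_gt _ (val_geM vv hDt h)).
rewrite addrC -ltrBlDr lt_min; apply/andP; split; lra.
Qed.

(* Integrality at all the places over [a], which are conjugate to [w]. *)
Definition integral x := forall a w, k a -> place_over (t - a) w ->
  (forall s, inertia_gal p t w s -> H s) -> forall s, Gal s -> val_ge w 0 (s x).

Lemma integralD x y : integral x -> integral y -> integral (x + y).
Proof.
move=> hx hy a w ka hw Iw s Gs; rewrite rmorphD.
by apply: (val_geD hw.1); [apply: hx hw Iw s Gs|apply: hy hw Iw s Gs].
Qed.

Lemma integralM x y : integral x -> integral y -> integral (x * y).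
Proof.
move=> hx hy a w ka hw Iw s Gs; rewrite rmorphM -[0]addr0.
by apply: (val_geM hw.1); [apply: hx hw Iw s Gs|apply: hy hw Iw s Gs].
Qed.

Lemma integral_gal g x : Gal g -> integral x -> integral (g x).
Proof. by move=> Gg hx a w ka hw Iw s Gs; apply: (hx a w ka hw Iw (s \o g)); apply: gal_comp. Qed.

Lemma integral_poly C : poly_over k C -> integral C.[t].
Proof.
move=> kC a w ka hw Iw s Gs; rewrite (gal_ratfun Gs (ratfun_poly hp hOm kC)).
rewrite horner_coef; apply: (val_ge_sum hw.1) => i _.
rewrite -[0]addr0; apply: (val_geM hw.1); first exact: (val_ge_const hp hw).
have := val_geX hw.1 i (_ : val_ge w 0 t); rewrite mulr0; apply.
rewrite -(subrK a t); apply: (val_geD hw.1); last exact: (val_ge_const hp hw).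
by apply: (val_ge_le _ (val_ge_id w (t - a))); rewrite hw.2.
Qed.

Lemma integralN x : integral x -> integral (- x).
Proof.
move=> hx; rewrite -mulN1r; apply: integralM => //.
rewrite -(hornerC (-1) t); apply: integral_poly; apply: poly_overC => //.
by apply: subfieldN => //; apply: subfield1.
Qed.

Lemma integralB x y : integral x -> integral y -> integral (x - y).
Proof. by move=> hx hy; apply: integralD => //; apply: integralN. Qed.

Lemma integral_root x n : (0 < n)%N -> integral (x ^+ n) -> integral x.
Proof.
move=> n0 hx a w ka hw Iw s Gs; have := hx a w ka hw Iw s Gs; rewrite rmorphXn.
have [->|sx0] := eqVneq (s x) 0; first by move=> _; apply: val_ge0.
by rewrite !val_geN0 ?expf_neq0 // (valX hw.1) // pmulr_rge0 // ltr0n.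
Qed.

Lemma integral_ddt x : fixed_by x -> integral x -> integral (D x).
Proof.
move=> fx hx a w ka hw Iw s Gs; rewrite -(ddt_gal hp hOm) //.
have ua : uniformizer p t (t - a) by left; exists a.
have Dua : D (t - a) = 1.
  by rewrite (derB hD) (ddt_t hp hOm) (ddt_const hp hOm ka) subr0.
have -> : D (s x) = ddu p t (t - a) (s x) by rewrite /ddu Dua invr1 mul1r.
apply: (inertia_fixed_ddu_integral hp hOm ua hw); last exact: hx hw Iw s Gs.
by move=> r /Iw; apply: fixed_by_gal.
Qed.

Lemma integral_rational x : integral x -> (forall s, Gal s -> s x = x) ->
  exists2 C, poly_over k C & x = C.[t].
Proof.
move=> hx fx; apply: (ratfun_polynomial hp hOm (ratfun_fixed hp hOm fx)) => a ka.
have [w hw Iw] := Hfin ka; exists w => //.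
exact: (hx a w ka hw Iw idfun (gal_id p t)).
Qed.

Lemma integral_constant x : integral x ->
  (forall s, Gal s -> val_ge v 0 (s x)) -> k x.
Proof.
move=> hx xinf; have k0 : k 0 by apply: subfield0.
have [v0 hv0 I0] := Hfin k0.
have hv0' : place_over t v0 by move: hv0; rewrite subr0.
apply: (integral_const hp hOm hv hv0') => //.
  move=> a ka; have [w hw Iw] := Hfin ka; exists w => // s Gs.
  exact: hx hw Iw s Gs.
by move=> s Gs; apply: (hx 0 v0 k0 hv0 I0 s Gs).
Qed.

(** Since (d/dt)^p = 0, the derivative of order p - 1 of [h] vanishes, so [h] has no term t^i with p
    dividing i + 1 and can be integrated term by term. *)
Lemma ddt_antiderivative (h : {poly Om}) y : poly_over k h -> D y = h.[t] ->
  exists Q : {poly Om}, [/\ poly_over k Q, Q^`() = h &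
    forall i, (p %| i)%N -> Q`_i = 0].
Proof.
move=> kh Dy.
have h0 : h^`(p.-1) = 0.
  apply: (Fpbar_transcendental hp hOm).
    elim: p.-1 => [|n IH]; first by rewrite derivn0.
    exact: (poly_over_deriv ksub IH).
  rewrite -(ddt_iter hp hOm) => [|i]; last exact: (pth_const hp hOm (kh i)).
  rewrite -Dy -iterSr prednK ?prime_gt0 //; exact: (ddt_iter_pchar hp hOm).
have ph i : (p %| i.+1)%N -> h`_i = 0.
  case/dvdnP => -[//|j] iE.
  have := congr1 (fun C : {poly Om} => C`_(j * p)) h0; rewrite coef_derivn coef0.
  have -> : (p.-1 + j * p)%N = i.
    by apply: succn_inj; rewrite iE mulSn -addSn prednK // prime_gt0.
  rewrite -mulr_natr => /eqP; rewrite mulf_eq0 => /orP[/eqP//|].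
  rewrite -(dvdn_pcharf hch) => dv; exfalso.
  have : forall m, (m <= p.-1)%N -> ~~ (p %| i ^_ m)%N.
    elim=> [_|m IH lt]; first by rewrite ffactn0 dvdn1; apply: contraL hp => /eqP->.
    rewrite ffactnSr Euclid_dvdM // negb_or IH 1?ltnW //=.
    have iE' : i = (j * p + p.-1)%N.
      by apply: succn_inj; rewrite iE mulSn -addnS prednK ?prime_gt0 // addnC.
    rewrite iE' -addnBA 1?ltnW // dvdn_addr ?dvdn_mull //.
    rewrite gtnNdvd //; first by rewrite subn_gt0.
    by rewrite (leq_ltn_trans (leq_subr _ _)) // prednK // prime_gt0.
  by move/(_ p.-1 (leqnn _)); rewrite dv.
(* Where p divides [i] the coefficient is 0, because 0^-1 = 0. *)
pose Q := \poly_(i < (size h).+1) (h`_i.-1 / i%:R).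
have Qi i : Q`_i = h`_i.-1 / i%:R.
  rewrite coef_poly; case: ltnP => // ge; rewrite nth_default ?mul0r //.
  by rewrite -ltnS; apply: leq_trans ge (leqSpred i).
exists Q; split.
- move=> i; rewrite Qi; apply: subfield_div => //; exact: subfield_nat.
- apply/polyP => i; rewrite coef_deriv -mulr_natr Qi /=.
  have [e|ne] := eqVneq (i.+1%:R : Om) 0; last by rewrite divfK.
  by rewrite e invr0 !mulr0 ph // (dvdn_pcharf hch) e.
- by move=> i; rewrite (dvdn_pcharf hch) => /eqP e; rewrite Qi e invr0 mulr0.
Qed.

Lemma layer_fraction E n (tau : 'I_n -> {rmorphism Om -> Om}) pi x :
  galois_layer p t v E tau pi ->
  (forall s, Gal s -> {in E, forall y, s y = y} -> H s) -> fixed_by x -> x != 0 ->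
  exists m : int, n%:R * v x = m%:~R.
Proof.
move=> hl hE fx; apply: (layer_val_frac hp hOm hu hv hl) => r [Jr fr].
by apply: fx; apply: hE => //; apply: JG.
Qed.

(* The function of least pole order among the functions of the cover that do
   not come from the base has constant derivative, whence additive conjugates. *)
Lemma additive_element g0 : Gal g0 -> ~ H g0 -> exists y,
  [/\ fixed_by y, integral y, exists2 g, Gal g & g y != y &
      forall g, Gal g -> k (g y - y)].
Proof.
move=> Gg0 nHg0; have [E [n [tau [pi [hl fE hE]]]]] := infinity_layer.
have n0 : 0 < n%:R :> rat by rewrite ltr0n (layer_n_gt0 hp hOm hu hv hl).
have frac x := @layer_fraction E n tau pi x hl hE.
have p0 : 0 < p%:R :> rat by rewrite ltr0n prime_gt0.
have p2 : 2 <= p%:R :> rat by rewrite (ler_nat _ 2) prime_gt1.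
(* The conjugates of [y] at [v] stand for [y] at all places above oo. Pole orders are multiples of 1
   / n, so there is a least bound m / n. *)
pose A m := boolp.asbool (exists y, [/\ fixed_by y, integral y,
  exists2 g, Gal g & g y != y &
  forall g, Gal g -> val_ge v (- (m%:R / n%:R)) (g y)]).
have exA : exists m, A m.
  have [x xE gx] : exists2 x, x \in E & g0 x != x.
    apply: boolp.contrapT => h; apply: nHg0; apply: hE => // y yE.
    by apply/eqP; apply: contraT => gy; case: h; exists y.
  have [q [kq q0 hq]] := clear_denominators hp hOm x.
  have qt0 : q.[t] != 0 by apply: contraNneq q0 => /(Fpbar_transcendental hp hOm kq)->.
  have rq := ratfun_poly hp hOm kq.
  have [B hB] := val_ge_lower v (orb Gal (q.[t] * x)).
  exists (Num.truncn (n%:R * - B)).+1; apply/boolp.asboolP; exists (q.[t] * x); split.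
  - by apply: (subfieldM fsub); [apply: fixed_by_ratfun|apply: fE].
  - by move=> a w ka hw _ s Gs; apply: hq ka hw s Gs.
  - exists g0 => //; rewrite rmorphM (gal_ratfun Gg0 rq).
    by apply: contraNneq gx => /(mulfI qt0)->.
  - move=> g Gg; apply: (@val_ge_le _ _ _ B); last by apply: hB; apply/(orbP hOm oG); exists g.
    rewrite lerNl ler_pdivlMr // mulrC; apply/ltW/Num.Theory.truncnS_gt.
case: (ex_minnP exA) => m /boolp.asboolP[y [fy iy [g1 Gg1 g1y] by_]] minm.
set c := m%:R / n%:R in by_.
have m0 : (0 < m)%N.
  rewrite lt0n; apply: contraNneq g1y => m0.
  have ky : k y.
    by apply: integral_constant => // s Gs; have := by_ s Gs; rewrite /c m0 mul0r oppr0.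
  by rewrite Gg1.2.
have c0 : 0 < c by rewrite divr_gt0 // ltr0n.
(* By minimality of [m], an integral function with smaller poles comes from the base. *)
have small z : fixed_by z -> integral z -> (forall g, Gal g -> val_gt v (- c) (g z)) ->
    forall g, Gal g -> g z = z.
  move=> fz iz bz g Gg; apply/eqP; apply: contraT => gz.
  have /minm : A m.-1.
    apply/boolp.asboolP; exists z; split=> //; first by exists g.
    move=> r Gr; have [->|rz0] := eqVneq (r z) 0; first exact: val_ge0.
    have [a ha] := frac (r z) (fixed_by_gal Gr fz) rz0.
    have := bz r Gr; rewrite val_gtN0 // val_geN0 // /c.
    rewrite ltrNl ltr_pdivlMr // lerNl ler_pdivlMr // mulNr mulrC ha -mulrNz.
    by rewrite !pmulrn ltr_int ler_int; move: m0; clear; lia.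
  by rewrite leqNgt ltn_predL m0.
have y0 : y != 0 by apply: contraNneq g1y => ->; rewrite rmorph0.
have vy g : Gal g -> g y != 0 /\ - c <= v (g y).
  by move=> Gg; rewrite fmorph_eq0; split=> //; have := by_ g Gg; rewrite val_geN0 ?fmorph_eq0.
have Dfix g : Gal g -> g (D y) = D y.
  apply: small.
  - by move=> s Hs; rewrite -(ddt_gal hp hOm _ (HG Hs)) fy.
  - exact: integral_ddt.
  - move=> r Gr; rewrite -(ddt_gal hp hOm _ Gr); have [gy0 vgy] := vy r Gr.
    apply: (val_gt_le vgy); apply: ddt_infinity => //.
    exact: fixed_by_gal.
have [h kh Dyh] := integral_rational (integral_ddt fy iy) Dfix.
have [Q [kQ Qh Qp]] := ddt_antiderivative kh Dyh.
have rQ : ratfun Q.[t] := ratfun_poly hp hOm kQ.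
have gQ g : Gal g -> g Q.[t] = Q.[t] by move=> Gg; apply: (gal_ratfun Gg rQ).
have [y1 y1p] : pth p (y - Q.[t]).
  apply: (ddt_ker hp hOm); rewrite (derB hD) Dyh (ddt_kpoly hp hOm kQ) Qh subrr.
  by [].
have fy1 : fixed_by y1.
  move=> s Hs; apply: (Frob1_inj hp hch).
  by rewrite -rmorphXn y1p rmorphB fy // gQ //; apply: HG.
have iy1 : integral y1.
  apply: (integral_root (prime_gt0 hp)); rewrite y1p.
  by apply: integralB => //; apply: integral_poly.
have my1 : exists2 g, Gal g & g y1 != y1.
  exists g1 => //; apply: contraNneq g1y => e.
  by rewrite -[y](subrK Q.[t]) rmorphD gQ // -y1p rmorphXn /= e.
have gy1 g : Gal g -> g y1 ^+ p = g y - Q.[t].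
  by move=> Gg; rewrite -rmorphXn y1p rmorphB gQ.
have root_val z (b : rat) : val_ge v b (z ^+ p) -> val_ge v (b / p%:R) z.
  have [->|z0] := eqVneq z 0; first by move=> _; apply: val_ge0.
  by rewrite !val_geN0 ?expf_neq0 // valX // ler_pdivrMr // mulrC.
have cp : - c < - c / p%:R by rewrite mulNr ltrN2 ltr_pdivrMr //; nra.
(* If the pole of Q(t) had order at most [c], the p-th root [y1] of y - Q(t) would have poles of
   order at most c / p, and so would come from the base. *)
have Qbig : ~~ val_ge v (- c) Q.[t].
  apply/negP => hQ; case: my1 => g Gg /eqP; apply.
  apply: small => // r Gr; apply: (val_ge_gt cp); apply: root_val.
  by rewrite gy1 //; apply: val_geB => //; apply: by_.
have Qt0 : Q.[t] != 0 by apply: contraNneq Qbig => ->; apply: val_ge0.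
have Q0 : Q != 0 by apply: contraNneq Qt0 => ->; rewrite horner0.
have [_ vQ] := val_infty_poly hp hOm hv kQ Q0.
set d := (size Q).-1 in vQ.
have cd : c < d%:R by move: Qbig; rewrite val_geN0 // vQ lerN2 -ltNge.
have vy1 g : Gal g -> g y1 != 0 /\ p%:R * v (g y1) = - d%:R.
  move=> Gg; have [gy0 vgy] := vy g Gg.
  have [n1 v1] : - Q.[t] + g y != 0 /\ v (- Q.[t] + g y) = v (- Q.[t]).
    apply: valD_eq; rewrite ?oppr_eq0 // val_gtN0 // valN // vQ.
    by apply: lt_le_trans vgy; rewrite ltrN2.
  rewrite addrC -gy1 // valN // vQ in v1; rewrite addrC -gy1 // in n1.
  have gy10 : g y1 != 0 by apply: contraNneq n1 => ->; rewrite expr0n eqn0Ngt prime_gt0.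
  by split=> //; rewrite -valX.
have cdp : c <= d%:R / p%:R.
  rewrite leNgt; apply/negP => lt; case: my1 => g Gg /eqP; apply.
  apply: small => // r Gr; have [n1 v1] := vy1 r Gr; rewrite val_gtN0 //.
  have -> : v (r y1) = - (d%:R / p%:R) by apply: (mulfI (lt0r_neq0 p0)); rewrite v1; field; apply: lt0r_neq0.
  by rewrite ltrN2.
have Qd : Q`_d != 0 by rewrite -/(lead_coef Q) lead_coef_eq0.
have d0 : (0 < d)%N by rewrite -(ltr_nat rat); apply: lt_trans cd.
have ndp : ~~ (p %| d)%N by apply: contra Qd => /Qp->.
have hd : h`_d.-1 != 0.
  by rewrite -Qh coef_deriv prednK // -mulr_natr mulf_neq0 // -(dvdn_pcharf hch).
have szh : (d <= size h)%N.
  by rewrite -(prednK d0) ltnNge; apply: contraNN hd => ge; rewrite nth_default.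
have h0 : h != 0 by apply: contraNneq hd => ->; rewrite coef0.
have [ht0 vh] := val_infty_poly hp hOm hv kh h0.
(* [h] has degree d - 1, as p does not divide [d], and differentiation lowers the pole of [y]; so d
   - 1 < c <= d / p. *)
have d1 : d = 1%N.
  have := ddt_infinity fy y0; rewrite Dyh val_gtN0 // vh => lt1.
  have [_ le1] := vy idfun (gal_id p t); rewrite /= in le1.
  have : (d.-1)%:R < d%:R / p%:R :> rat.
    have : (d.-1)%:R <= (size h).-1%:R :> rat by rewrite ler_nat -!subn1 leq_sub2r.
    by move=> le2; lra.
  rewrite ltr_pdivlMr // -natrM ltr_nat => lt2.
  have := prime_gt1 hp; move: lt2 d0; clear; case: d => [|[|d]] //= lt _ lt1.
  by move: lt lt1; clear; nia.
(* The p-th power of [z] is g y - y, so [z] has poles of order at most c / p < c. Hence it is a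
   polynomial in [t], and its degree is less than 1 because c <= 1 / p. *)
exists y1; split=> // g Gg; set z := g y1 - y1.
have zp : z ^+ p = g y - y.
  have := FrobB hp hch 1 (g y1) y1; rewrite expn1 => ->.
  by rewrite gy1 // y1p opprB addrA subrK.
have bz r : Gal r -> val_ge v (- c / p%:R) (r z).
  move=> Gr; apply: root_val; rewrite -rmorphXn zp rmorphB; apply: val_geB => //.
    by apply: (by_ (r \o g)); apply: gal_comp.
  exact: by_.
have zfix r : Gal r -> r z = z.
  move=> Gr; apply: small Gr.
  - by apply: (subfieldB fsub) => //; apply: fixed_by_gal.
  - by apply: integralB => //; apply: integral_gal.
  - by move=> r' Gr'; apply: (val_ge_gt cp); apply: bz.
have [|C kC zC] := integral_rational _ zfix.
  by apply: integralB => //; apply: integral_gal.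
have szC : (size C <= 1)%N.
  have [->|C0] := eqVneq C 0; first by rewrite size_poly0.
  have [Ct0 vC] := val_infty_poly hp hOm hv kC C0.
  have := bz idfun (gal_id p t); rewrite /= zC val_geN0 // vC => le.
  have lt1 : (size C).-1%:R < 1 :> rat.
    have c1 : c / p%:R < 1.
      rewrite ltr_pdivrMr // mul1r; apply: (le_lt_trans cdp).
      by rewrite d1 ltr_pdivrMr //; nra.
    by move: le; rewrite mulNr lerN2 => le; apply: le_lt_trans le c1.
  by move: lt1; rewrite ltrn1; case: (size C) => [|[]].
by rewrite zC (size1_polyC szC) hornerC.
Qed.

Lemma fin_trace_Fp f (x : Om) : Fq p f x -> Fq p 1 (fin_trace p f x).
Proof.
move=> hx; rewrite /Fq /fin_trace; case: f hx => [|f] hx.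
  by rewrite big_ord0 expr0n expn1 eqn0Ngt prime_gt0.
rewrite (big_morph (fun z : Om => z ^+ (p ^ 1)) (FrobD hp hch 1) (_ : 0 ^+ (p ^ 1) = 0)).
  rewrite big_ord_recr big_ord_recl /= -exprM -expnD addn1 hx expn0 expr1 addrC.
  by congr (_ + _); apply: eq_bigr => i _; rewrite -exprM -expnD addn1.
by rewrite expr0n expn1 eqn0Ngt prime_gt0.
Qed.

(** The trace is a nonzero polynomial of degree p^(f-1), too small to vanish at all p^f elements. *)
Lemma fin_trace_neq0 f : (0 < f)%N -> exists2 b : Om, Fq p f b & fin_trace p f b != 0.
Proof.
move=> f0; set q := (p ^ f)%N.
have q1 : (1 < q)%N by rewrite -(exp1n f) ltn_exp2r ?prime_gt1.
have cq : coprime p q.-1 := coprime_pred_pexp hp f0.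
have q0 : (0 < q.-1)%N by move: q1; case: (q) => [|[]].
have [rs [rsE urs krs]] := unity_splits hp hOm cq q0.
have rsroot b : b \in rs -> b ^+ q.-1 = 1.
  by move=> brs; apply/eqP; rewrite -subr_eq0 -hornerXn -(hornerC 1 b) -hornerN -hornerD rsE -rootE root_prod_XsubC.
have szrs : size rs = q.-1.
  by have := congr1 (fun C : {poly Om} => size C) rsE; rewrite size_XnsubC // size_prod_XsubC => -[].
pose P : {poly Om} := \sum_(i < f) 'X^(p ^ i).
have PE b : P.[b] = fin_trace p f b.
  by rewrite horner_sum; apply: eq_bigr => i _; rewrite hornerXn.
have szP : (size P <= (p ^ f.-1).+1)%N.
  apply: (leq_trans (size_sum _ _ _)); apply/bigmax_leqP => i _.
  by rewrite size_polyXn ltnS leq_exp2l ?prime_gt1 // -ltnS prednK.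
have P0 : P != 0.
  apply/negP => /eqP P0; have /eqP := oner_neq0 Om; apply.
  have := congr1 (fun C : {poly Om} => C`_1) P0; rewrite coef_sum coef0.
  case: (f) f0 => // f' _; rewrite big_ord_recl coefXn expn0 eqxx big1 ?addr0 => [//|i _].
  rewrite coefXn; case: eqP => // e; exfalso.
  have : (1 < p ^ bump 0 i)%N by rewrite -(exp1n (bump 0 i)) ltn_exp2r ?prime_gt1.
  by rewrite -e.
have u0 : uniq (0 :: rs).
  rewrite /= urs andbT; apply/negP => /rsroot; rewrite expr0n eqn0Ngt q0.
  by move/eqP; rewrite eq_sym oner_eq0.
have /allPn[b bl nb] : ~~ all (root P) (0 :: rs).
  apply/negP => ar; have := max_poly_roots P0 ar u0; rewrite /= szrs (prednK (ltnW q1)).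
  move=> lt; have := leq_trans lt szP; rewrite ltnS leq_exp2l ?prime_gt1 //.
  by rewrite -ltnS prednK // ltnn.
exists b; last by rewrite -PE -rootE.
move: bl; rewrite inE => /orP[/eqP->|/rsroot e].
  by rewrite /Fq expr0n eqn0Ngt ltnW.
by rewrite /Fq -/q -(prednK (ltnW q1)) exprS e mulr1.
Qed.

(** The differences g y - y lie in the field with p^f elements for some [f]. Taking the trace of c y
    brings them into F_p, and [c] is chosen to make the one for [g1] nonzero. *)
Lemma Artin_Schreier_element g0 : Gal g0 -> ~ H g0 -> exists y,
  [/\ fixed_by y, integral y, exists2 g, Gal g & g y != y &
      forall g, Gal g -> Fq p 1 (g y - y)].
Proof.
move=> Gg0 nHg0; have [y [fy iy [g1 Gg1 g1y] ky]] := additive_element Gg0 nHg0.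
have kV d : d \in [seq z - y | z <- orb Gal y] -> k d.
  by move=> /mapP[z /(orbP hOm oG)[g Gg <-] ->]; apply: ky.
have [f f0 hf] := Fpbar_common kV.
have gf g : Gal g -> Fq p f (g y - y).
  by move=> Gg; apply: hf; apply/map_f/(orbP hOm oG); exists g.
have [b fb Tb] := fin_trace_neq0 f0.
have Fs := Fq_subfield hp hch f.
set c := b / (g1 y - y).
have fc : Fq p f c by apply: (subfield_div Fs) => //; apply: gf.
have kc : k c by exists f.
have trE g : Gal g -> g (fin_trace p f (c * y)) - fin_trace p f (c * y) =
    fin_trace p f (c * (g y - y)).
  move=> Gg; rewrite mulrBr -[c * g y](subrK (c * y)) addrK.
  rewrite [fin_trace p f (_ - _)]/fin_trace /fin_trace rmorph_sum -sumrB /=.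
  apply: eq_bigr => i _; rewrite rmorphXn rmorphM Gg.2 //=.
  by rewrite FrobB // subrK.
exists (fin_trace p f (c * y)); split.
- apply: (subfield_sum fsub) => i _; apply: (subfieldX fsub); apply: (subfieldM fsub) => //.
  by apply: fixed_by_ratfun; apply: ratfunC.
- rewrite /fin_trace; elim/big_rec: _ => [|i x _ ix].
    rewrite -(hornerC 0 t); apply: integral_poly; apply: poly_overC => //.
    exact: subfield0.
  apply: integralD => //; elim: (p ^ i)%N => [|j IH].
    by rewrite expr0 -(hornerC 1 t); apply: integral_poly; apply: (poly_over1 ksub).
  rewrite exprS; apply: integralM => //; apply: integralM => //.
  by rewrite -(hornerC c t); apply: integral_poly; apply: poly_overC.
- exists g1 => //; rewrite -subr_eq0 trE // /c divfK ?subr_eq0 //.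
- move=> g Gg; rewrite trE //; apply: fin_trace_Fp.
  by apply: (subfieldM Fs) => //; apply: gf.
Qed.

(* The residue of [s pi / pi] is a p-th root of unity, hence 1. *)
Lemma order_p_wild ys n (tau : 'I_n -> {rmorphism Om -> Om}) pi s :
  galois_layer p t v ys tau pi -> J s -> {in ys, iter p s =1 id} -> s pi != pi ->
  2 <= n%:R * v (s pi - pi).
Proof.
move=> hl Js sp spi.
have pi0 := layer_pi_neq0 hl.
have vpi := layer_pi_val hp hOm hu hv hl.
have n0 : 0 < n%:R :> rat by rewrite ltr0n (layer_n_gt0 hp hOm hu hv hl).
have [c [kc _ hi]] := inertia_residue hp hOm hu hv Js pi0.
have hc := hi 1%N; rewrite /= expr1 in hc.
have [r Jr rE] := inertia_iter hp hOm hu hv p Js.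
have ppi : iter p s pi = pi.
  rewrite -rE; apply: (layer_agree_pi hOm hl (JG Jr) (gal_id p t)) => y yl.
  by rewrite rE sp.
have c1 : c = 1.
  apply: (Frob1_inj hp hch); rewrite expr1n; apply/eqP.
  have := hi p; rewrite ppi divff //.
  have [/eqP|ne] := eqVneq (1 - c ^+ p) 0; first by rewrite subr_eq0 eq_sym.
  rewrite val_gtN0 // (val_const hp hv) ?ltxx //.
  by apply: (subfieldB ksub); [apply: (subfield1 ksub)|apply: subfieldX].
have lt : n%:R^-1 < v (s pi - pi).
  have -> : s pi - pi = (s pi / pi - 1) * pi by rewrite mulrBl divfK // mul1r.
  rewrite c1 in hc; have ne : s pi / pi - 1 != 0.
    by rewrite subr_eq0; apply: contraNneq spi => e; rewrite -[X in X == _](divfK pi0) e mul1r.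
  by rewrite val_gtN0 // in hc; rewrite valM // vpi ltrDr.
have [r' JLr'||m mE] := layer_val_frac hp hOm hu hv hl (_ : forall r', layer_group p t v ys r' -> r' (s pi - pi) = s pi - pi).
- have [Jr' fr'] := JLr'; rewrite rmorphB (layer_group_pi hl JLr'); congr (_ - _).
  apply: (layer_agree_pi hOm hl (JG (subgroup_comp oJ Jr' Js)) (JG Js)) => y yl /=.
  by apply: fr'; apply: (layer_stable hl) => //; apply: JG.
- by rewrite subr_eq0.
- move: lt; rewrite -(ltr_pM2l n0) divff ?lt0r_neq0 // mE.
  by rewrite (ltr_int _ 1) (ler_int _ 2); lia.
Qed.

Theorem unramified_cover_trivial g : Gal g -> H g.
Proof.
move=> Gg; apply: boolp.contrapT => nHg.
(* The size of [G] is taken minimal in order to make its degree prime to p. *)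
pose A m := boolp.asbool (exists y (G : {poly Om}), [/\
  [/\ fixed_by y, integral y, exists2 g, Gal g & g y != y &
      forall g, Gal g -> Fq p 1 (g y - y)],
  poly_over k G, y ^+ p - y = G.[t] & size G = m]).
have exA : exists m, A m.
  have [y [fy iy my Fy]] := Artin_Schreier_element Gg nHg.
  have [||G kG GE] := @integral_rational (y ^+ p - y).
  - apply: integralB => //; elim: (p) => [|j IH]; last by rewrite exprS; apply: integralM.
    by rewrite expr0 -(hornerC 1 t); apply: integral_poly; apply: (poly_over1 ksub).
  - move=> s Gs; have := Fy s Gs; rewrite /Fq FrobB // expn1 => e.
    by rewrite rmorphB rmorphXn /= -(subrK (y ^+ p) (s y ^+ p)) e; ring.
  - by exists (size G); apply/boolp.asboolP; exists y, G.
case: (ex_minnP exA) => m /boolp.asboolP[y [G [[fy iy [g1 Gg1 g1y] Fy] kG GE szG]]] minm.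
have Fpk a : Fq p 1 a -> k a by exists 1%N.
(* For constant [G] the equation has a root in Fpbar, from which [y] differs by an element of F_p,
   so [y] would be a constant. *)
have [m1|m1] := leqP m 1.
  have G0E : G.[t] = G`_0 by rewrite (size1_polyC (_ : (size G <= 1)%N)) ?szG // hornerC coefC.
  pose Q : {poly Om} := 'X^p - 'X - (G`_0)%:P.
  have szQ : size Q = p.+1.
    rewrite /Q -addrA size_polyDl ?size_polyXn //.
    rewrite -opprD size_polyN (leq_ltn_trans (size_polyD _ _)) // gtn_max size_polyX.
    by rewrite !ltnS prime_gt1 // (leq_trans (size_polyC_leq1 _)) // prime_gt0.
  have [||r kr rr] := @Fpbar_closed p Om t hp hOm Q.
  - apply: (poly_overB ksub); last by apply: poly_overC.
    apply: (poly_overB ksub); last exact: (poly_overX ksub).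
    by apply: (poly_overXn ksub); apply: (poly_overX ksub).
  - by rewrite szQ ltnS prime_gt0.
  have ky : k y.
    rewrite -(subrK r y); apply: (subfieldD ksub) => //; apply: Fpk.
    rewrite /Fq FrobB // expn1; move: rr; rewrite /root /Q !hornerE -G0E -GE => /eqP e.
    by apply/eqP; rewrite -subr_eq0 -oppr_eq0 -e; apply/eqP; ring.
  by move/eqP: g1y; apply; apply: Gg1.2.
set d := m.-1; have dm : m = d.+1 by rewrite prednK // ltnW.
have d0 : (0 < d)%N by rewrite -ltnS -dm.
have G0 : G != 0 by rewrite -size_poly_gt0 szG dm.
have [Gt0 vG] := val_infty_poly hp hOm hv kG G0; rewrite szG -/d in vG.
(* Subtracting b t^j from [y] trades a leading term b^p t^(p j) for b t^j. *)
have ndp : ~~ (p %| d)%N.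
  apply/negP => /dvdnP[j dE].
  have [b kb bp] := Fpbar_root hp hch (kG d).
  have j0 : (0 < j)%N by move: d0; rewrite dE muln_gt0 => /andP[].
  pose y1 := y - b * t ^+ j; pose G1 : {poly Om} := G - (b ^+ p)%:P * 'X^d + b%:P * 'X^j.
  have rb : ratfun (b * t ^+ j).
    have rs := ratfun_subfield hp hOm.
    by apply: (subfieldM rs); [apply: ratfunC|apply: (subfieldX rs); apply: ratfunt].
  have gb g' : Gal g' -> g' (b * t ^+ j) = b * t ^+ j by move=> Gg'; apply: (gal_ratfun Gg' rb).
  have szG1 : (size G1 <= d)%N.
    apply/leq_sizeP => i; rewrite leq_eqVlt => /orP[/eqP<-|lt].
      rewrite /G1 coefD coefB !coefCM !coefXn eqxx -bp mulr1 subrr add0r.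
      by rewrite gtn_eqF ?mulr0 // dE ltn_Pmulr // prime_gt1.
    rewrite /G1 coefD coefB !coefCM !coefXn nth_default ?szG ?dm //.
    have jd : (j <= d)%N by rewrite dE leq_pmulr // prime_gt0.
    by rewrite !gtn_eqF ?mulr0 ?subrr ?addr0 // (leq_ltn_trans jd).
  have /minm : A (size G1).
    apply/boolp.asboolP; exists y1, G1; split=> //.
    - split.
      + by apply: (subfieldB fsub) => //; apply: fixed_by_ratfun.
      + apply: integralB => //.
        have -> : b * t ^+ j = (b%:P * 'X^j).[t] by rewrite !hornerE.
        apply: integral_poly; apply: (poly_overM ksub); first exact: poly_overC.
        by apply: (poly_overXn ksub); apply: (poly_overX ksub).
      + exists g1 => //; apply: contraNneq g1y.
        rewrite /y1 rmorphB gb //.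
        move=> e; apply/eqP; apply: (addIr _ e).
      + move=> g' Gg'; rewrite rmorphB gb //.
        have -> : g' y - b * t ^+ j - y1 = g' y - y by rewrite /y1; ring.
        exact: Fy.
    - apply: (poly_overD ksub).
        apply: (poly_overB ksub) => //; apply: (poly_overM ksub).
          by apply: (poly_overC ksub); apply: (subfieldX ksub).
        by apply: (poly_overXn ksub); apply: (poly_overX ksub).
      apply: (poly_overM ksub); first exact: poly_overC.
      by apply: (poly_overXn ksub); apply: (poly_overX ksub).
    - rewrite /G1 !hornerE -GE /y1.
      have := FrobB hp hch 1 y (b * t ^+ j); rewrite expn1 => ->.
      by rewrite exprMn -exprM -dE; ring.
  by rewrite leqNgt dm ltnS szG1.
have p0 : 0 < p%:R :> rat by rewrite ltr0n prime_gt0.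
have p1 : 1 < p%:R :> rat by rewrite (ltr_nat _ 1) prime_gt1.
have d0' : 0 < d%:R :> rat by rewrite ltr0n.
have y0 : y != 0 by apply: contraNneq g1y => ->; rewrite rmorph0.
have vy0 : v y < 0.
  rewrite ltNge; apply/negP => ge; have : val_ge v 0 (y ^+ p - y).
    apply: (val_geB vv); last by rewrite val_geN0.
    by rewrite val_geN0 ?expf_neq0 // valX // mulr_ge0 // ltW.
  by rewrite GE val_geN0 // vG; lra.
have vy : p%:R * v y = - d%:R.
  rewrite -vG -GE -(valX vv) //; apply/esym; apply: (valD_eq vv (expf_neq0 _ y0) _).2.
  by rewrite (val_gtN vv) val_gtN0 // valX //; nra.
(* v y = - d / p is not an integer, so [y] is not fixed by the inertia group. *)
have [s Js sy] : exists2 s, J s & s y != y.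
  apply: boolp.contrapT => h; have fJ s : J s -> s y = y.
    by move=> Js; apply/eqP; apply: contraT => sy; case: h; exists s.
  have [a ha] := inertia_fixed_val hp hOm hu hv fJ y0.
  have e : p%:Z * a = - d%:Z.
    by apply/eqP; rewrite -(eqr_int rat) intrM mulrNz -!pmulrn -ha vy.
  case/negP: ndp; rewrite -[d]/(`|d%:Z|%N) -[d%:Z]opprK -e.
  by rewrite abszN abszM dvdn_mulr.
set zs := orb Gal y.
have stz s' : Gal s' -> {in zs, forall z, s' z \in zs}.
  move=> Gs' z /(orbP hOm oG)[g' Gg' <-]; apply/(orbP hOm oG).
  by exists (s' \o g') => //; apply: gal_comp.
have [n [tau [pi hl]]] := layer_exists hp hOm hu hv stz.
have yz : y \in zs by apply: (orb_id hOm oG).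
(* The conjugates of [y] are y + a with [a] in F_p, so every [s'] acts on the layer with order
   dividing p, and [order_p_wild] applies. *)
have agree (s' : {rmorphism Om -> Om}) : J s' -> {in zs, iter p s' =1 id}.
  move=> Js' z /(orbP hOm oG)[g' Gg' <-].
  have it i : iter i s' y = y + (s' y - y) *+ i.
    elim: i => [|i IH]; first by rewrite mulr0n addr0.
    rewrite /= IH rmorphD rmorphMn (_ : s' (s' y - y) = s' y - y); last first.
      by apply: (JG Js').2; apply: Fpk; apply: Fy; apply: JG.
    by rewrite mulrS; ring.
  have it' i z' : iter i s' (y + z') = iter i s' y + iter i s' z'.
    by elim: i => //= i ->; rewrite rmorphD.
  rewrite -[g' y](subrK y) addrC it' it -mulr_natr (pcharf0 hch) mulr0 addr0.
  congr (_ + _); elim: p => //= i ->; apply: (JG Js').2; apply: Fpk; exact: Fy.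
have wild s' : J s' -> s' pi != pi -> 2 <= n%:R * v (s' pi - pi).
  by move=> Js'; apply: (order_p_wild hl Js' (agree s' Js')).
have spi : s pi != pi.
  apply: contraNneq sy => e.
  by rewrite (layer_pi_agree hp hOm hu hv hl Js (subgroup_id oJ) e).
have n0 : 0 < n%:R :> rat by rewrite ltr0n (layer_n_gt0 hp hOm hu hv hl).
have [|s' [Hs' e]] := upper_number_trivial hl Js spi.
  (* Every term of Serre's sum is at least 2, so the upper number is at least 2 - 1. *)
  rewrite /upper_number herbrandE subrK lerBrDr.
  have le2 i : 2 <= cut v n pi (tau i pi) (n%:R * v (s pi - pi)).
    rewrite /cut; case: eqP => [_|/eqP ne]; first exact: wild.
    by rewrite le_min !wild //; apply: (layer_Jtau hl).
  rewrite mulrC ler_pdivlMr // [leLHS](_ : _ = \sum_(i < n) 2%:R).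
    by apply: ler_sum => i _; apply: le2.
  by rewrite sumr_const card_ord -mulr_natl mulrC; ring.
by move: sy; rewrite -e // fy ?eqxx.
Qed.

End UnramifiedCovers.

(** * Zariski closures *)

Section PolynomialFunctions.
Variables (F : fieldType) (D : nat).
Implicit Types (f g : 'M[F]_D -> F).

(** Induction on polynomial expressions. The property [K] will be polynomiality, polynomiality up to
    a power of the determinant, and continuity at a point. *)
Lemma meval_ind (n : nat) (T : Type) (x : T -> 'I_n -> F) (K : (T -> F) -> Prop) :
  (forall f g : T -> F, f =1 g -> K f -> K g) -> (forall c, K (fun=> c)) ->
  (forall i, K (x^~ i)) ->
  (forall f g : T -> F, K f -> K g -> K (fun u => f u + g u)) ->
  (forall f g : T -> F, K f -> K g -> K (fun u => f u * g u)) ->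
  forall P : {mpoly F[n]}, K (fun u => P.@[x u]).
Proof.
move=> Ke Kc Kx KD KM P.
have Ksum (I : Type) (s : seq I) (f : I -> T -> F) :
    (forall i, K (f i)) -> K (fun u => \sum_(i <- s) f i u).
  move=> hf; elim: s => [|i s IH]; first by apply: Ke (Kc 0) => u; rewrite big_nil.
  by apply: Ke (KD _ _ (hf i) IH) => u; rewrite big_cons.
have Kprod (I : Type) (s : seq I) (f : I -> T -> F) :
    (forall i, K (f i)) -> K (fun u => \prod_(i <- s) f i u).
  move=> hf; elim: s => [|i s IH]; first by apply: Ke (Kc 1) => u; rewrite big_nil.
  by apply: Ke (KM _ _ (hf i) IH) => u; rewrite big_cons.
have KX (f : T -> F) e : K f -> K (fun u => f u ^+ e).
  move=> hf; elim: e => [|e IH]; first by apply: Ke (Kc 1) => u; rewrite expr0.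
  by apply: Ke (KM _ _ hf IH) => u; rewrite exprS.
apply: Ke (Ksum _ (msupp P) (fun m u => P@_m * \prod_(i < n) x u i ^+ m i) _) => [u|m].
  by rewrite mevalE.
by apply: KM (Kc _) _; apply: Kprod => i; apply: KX.
Qed.

Definition polyfun f := exists P : {mpoly F[D * D]},
  forall M, f M = P.@[fun i => mxvec M 0 i].

Lemma polyfun_ext f g : f =1 g -> polyfun f -> polyfun g.
Proof. by move=> e [P hP]; exists P => M; rewrite -e. Qed.

Lemma polyfunC c : polyfun (fun=> c).
Proof. by exists c%:MP => M; rewrite mevalC. Qed.

Lemma polyfun_entry i j : polyfun (fun M => M i j).
Proof. by exists 'X_(mxvec_index i j) => M; rewrite mevalXU mxvecE. Qed.

Lemma polyfunD f g : polyfun f -> polyfun g -> polyfun (fun M => f M + g M).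
Proof. by move=> [P hP] [Q hQ]; exists (P + Q) => M; rewrite mevalD hP hQ. Qed.

Lemma polyfunM f g : polyfun f -> polyfun g -> polyfun (fun M => f M * g M).
Proof. by move=> [P hP] [Q hQ]; exists (P * Q) => M; rewrite mevalM hP hQ. Qed.

Lemma polyfun_sum (I : Type) (s : seq I) (f : I -> 'M[F]_D -> F) :
  (forall i, polyfun (f i)) -> polyfun (fun M => \sum_(i <- s) f i M).
Proof.
move=> hf; elim: s => [|i s IH].
  by apply: polyfun_ext (polyfunC 0) => M; rewrite big_nil.
by apply: polyfun_ext (polyfunD (hf i) IH) => M; rewrite big_cons.
Qed.

Lemma polyfun_prod (I : Type) (s : seq I) (f : I -> 'M[F]_D -> F) :
  (forall i, polyfun (f i)) -> polyfun (fun M => \prod_(i <- s) f i M).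
Proof.
move=> hf; elim: s => [|i s IH].
  by apply: polyfun_ext (polyfunC 1) => M; rewrite big_nil.
by apply: polyfun_ext (polyfunM (hf i) IH) => M; rewrite big_cons.
Qed.

Lemma polyfunX f n : polyfun f -> polyfun (fun M => f M ^+ n).
Proof.
move=> hf; elim: n => [|n IH].
  by apply: polyfun_ext (polyfunC 1) => M; rewrite expr0.
by apply: polyfun_ext (polyfunM hf IH) => M; rewrite exprS.
Qed.

Lemma polyfun_det n (A : 'M[F]_D -> 'M[F]_n) :
  (forall i j, polyfun (fun M => A M i j)) -> polyfun (fun M => \det (A M)).
Proof.
move=> hA; apply: polyfun_sum => s; apply: polyfunM; first exact: polyfunC.
by apply: polyfun_prod => i; apply: hA.
Qed.

Lemma polyfun_adj i j : polyfun (fun M => (\adj M) i j).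
Proof.
apply: (@polyfun_ext (fun M => cofactor M j i)) => [M|]; first by rewrite mxE.
apply: polyfunM; first exact: polyfunC.
apply: polyfun_det => a b.
by apply: polyfun_ext (polyfun_entry (lift j a) (lift i b)) => M; rewrite !mxE.
Qed.

Lemma polyfun_comp f (phi : 'M[F]_D -> 'M[F]_D) :
  (forall i j, polyfun (fun M => phi M i j)) -> polyfun f ->
  polyfun (fun M => f (phi M)).
Proof.
move=> hphi [P hP]; apply: (@polyfun_ext (fun M => P.@[fun i => mxvec (phi M) 0 i])).
  by move=> M; rewrite hP.
apply: (meval_ind (x := fun M i => mxvec (phi M) 0 i) (K := polyfun)).
- exact: polyfun_ext.
- exact: polyfunC.
- by move=> i; case/mxvec_indexP: i => i j; apply: polyfun_ext (hphi i j) => M; rewrite mxvecE.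
- exact: polyfunD.
- exact: polyfunM.
Qed.

(** By Cramer's rule the entries of M^-1 have denominator det M; [d] is the exponent of a common
    denominator. *)
Lemma polyfun_inv f : polyfun f -> exists (d : nat) g, polyfun g /\
  (forall M, M \in unitmx -> \det M ^+ d * f (invmx M) = g M).
Proof.
move=> [P hP]; pose K (h : 'M[F]_D -> F) := exists d g, polyfun g /\
  forall M, M \in unitmx -> \det M ^+ d * h M = g M.
have detp : polyfun (fun M => \det M) by apply: polyfun_det; apply: polyfun_entry.
suff [d [g [pg hg]]] : K (fun M => P.@[fun i => mxvec (invmx M) 0 i]).
  by exists d, g; split=> // M uM; rewrite hP hg.
apply: (meval_ind (x := fun M i => mxvec (invmx M) 0 i) (K := K)).
- by move=> h1 h2 e [d [g [pg hg]]]; exists d, g; split=> // M uM; rewrite -e hg.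
- by move=> c; exists 0%N, (fun=> c); split=> [|M _]; [apply: polyfunC|rewrite expr0 mul1r].
- move=> i; case/mxvec_indexP: i => i j; exists 1%N, (fun M => (\adj M) i j).
  split; first exact: polyfun_adj.
  move=> M uM; rewrite mxvecE expr1 /invmx uM mxE mulrA divff ?mul1r //.
  by rewrite unitmxE unitfE in uM.
- move=> h1 h2 [d1 [g1 [pg1 hg1]]] [d2 [g2 [pg2 hg2]]].
  exists (d1 + d2)%N, (fun M => \det M ^+ d2 * g1 M + \det M ^+ d1 * g2 M).
  split=> [|M uM]; last by rewrite -hg1 // -hg2 // exprD; ring.
  by apply: polyfunD; apply: polyfunM => //; apply: polyfunX.
- move=> h1 h2 [d1 [g1 [pg1 hg1]]] [d2 [g2 [pg2 hg2]]].
  exists (d1 + d2)%N, (fun M => g1 M * g2 M).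
  split=> [|M uM]; last by rewrite -hg1 // -hg2 // exprD; ring.
  exact: polyfunM.
Qed.

Section ZariskiClosure.
Variable S : 'M[F]_D -> Prop.
Hypothesis S_unit : forall M, S M -> M \in unitmx.

Lemma zariski_polyfun M f : zariski_closure S M -> polyfun f ->
  (forall N, S N -> f N = 0) -> f M = 0.
Proof. by move=> [_ hM] [P hP] h; rewrite hP; apply: hM => N SN; rewrite -hP h. Qed.

Lemma zariski_mem M : S M -> zariski_closure S M.
Proof. by move=> SM; split=> [|P hP]; [apply: S_unit|apply: hP]. Qed.

(** One factor at a time: f(A X) with [A] in [S], and then f(X N) with [N] in the closure, vanish on
    [S] and therefore on its closure. *)
Lemma zariskiM M N : (forall M N, S M -> S N -> S (M *m N)) ->
  zariski_closure S M -> zariski_closure S N -> zariski_closure S (M *m N).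
Proof.
move=> SM hM hN; split=> [|P hP]; first by rewrite unitmx_mul hM.1 hN.1.
pose f M := P.@[fun i => mxvec M 0 i].
have pf : polyfun f by exists P.
have left A : S A -> f (A *m N) = 0.
  move=> SA; apply: (zariski_polyfun (f := fun X => f (A *m X)) hN) => [|X SX]; last exact: hP (SM _ _ SA SX).
  apply: polyfun_comp pf => i j.
  apply: (@polyfun_ext (fun X => \sum_k A i k * X k j)) => [X|]; first by rewrite mxE.
  by apply: polyfun_sum => k; apply: polyfunM; [apply: polyfunC|apply: polyfun_entry].
apply: (zariski_polyfun (f := fun X => f (X *m N)) hM) => [|X SX]; last exact: left.
apply: polyfun_comp pf => i j.
apply: (@polyfun_ext (fun X => \sum_k X i k * N k j)) => [X|]; first by rewrite mxE.
by apply: polyfun_sum => k; apply: polyfunM; [apply: polyfun_entry|apply: polyfunC].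
Qed.

Lemma zariskiV M : (forall M, S M -> S (invmx M)) ->
  zariski_closure S M -> zariski_closure S (invmx M).
Proof.
move=> SV hM; split=> [|P hP]; first by rewrite unitmx_inv hM.1.
have [d [g [pg hg]]] := polyfun_inv (ex_intro _ P (fun M => erefl) : polyfun (fun M => P.@[fun i => mxvec M 0 i])).
have g0 : g M = 0.
  by apply: (zariski_polyfun hM pg) => N SN; rewrite -hg ?S_unit // hP ?mulr0 //; apply: SV.
have := hg M hM.1; rewrite g0 => /eqP; rewrite mulf_eq0 expf_eq0.
by have := hM.1; rewrite unitmxE unitfE => /negPf->; rewrite andbF => /eqP.
Qed.

(** For each member of [l] other than [M], some entry minus a constant vanishes there but not at
    [M]; the product of these separates [M] from [S]. *)
Lemma zariski_finite M (l : seq 'M[F]_D) : (forall N, S N -> N \in l) ->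
  zariski_closure S M -> S M.
Proof.
move=> hl hM; apply: boolp.contrapT => nS.
have /boolp.choice[f hf] (A : 'M[F]_D) : exists f, polyfun f /\ f A = 0 /\ (A != M -> f M != 0).
  have [->|ne] := eqVneq A M; first by exists (fun=> 0); split; first exact: polyfunC.
  have /existsP[i /existsP[j nij]] : [exists i, exists j, A i j != M i j].
    apply: contraNT ne; rewrite negb_exists => /forallP h; apply/eqP/matrixP => i j.
    by have := h i; rewrite negb_exists => /forallP/(_ j); rewrite negbK => /eqP.
  exists (fun X => X i j + - A i j); rewrite subrr; split.
    by apply: polyfunD; [apply: polyfun_entry|apply: polyfunC].
  by split=> // _; rewrite subr_eq0 eq_sym.
have := zariski_polyfun (f := fun X => \prod_(A <- l | A != M) f A X) hM.
rewrite /=; move=> h; have /eqP : \prod_(A <- l | A != M) f A M = 0.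
  apply: h => [|N SN].
    apply: (@polyfun_ext (fun X => \prod_(A <- [seq A <- l | A != M]) f A X)).
      by move=> X; rewrite big_filter.
    by apply: polyfun_prod => A; have [] := hf A.
  have NM : N != M by apply: contraPneq nS => <-.
  apply/eqP; rewrite prodf_seq_eq0; apply/hasP; exists N; first exact: hl.
  by rewrite NM /= (hf N).2.1.
rewrite prodf_seq_eq0 => /hasP[A _ /andP[ne]].
by rewrite (negPf ((hf A).2.2 ne)).
Qed.

End ZariskiClosure.
End PolynomialFunctions.

(** * Density in the topology of a valuation *)

Section Continuity.
Variables (F : fieldType) (D : nat) (w : F -> rat).
Hypothesis hw : valuation w.

Lemma val_ge_lower_bound (x : F) : exists2 c : rat, 0 <= c & val_ge w (- c) x.
Proof.
exists `|w x|; first exact: normr_ge0.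
by apply: (val_ge_le _ (val_ge_id w x)); rewrite lerNl -normrN ler_norm.
Qed.

Lemma meval_continuous (P : {mpoly F[D * D]}) (X : 'M[F]_D) : exists C : rat,
  forall N : nat, forall Y : 'M[F]_D, (forall i j, val_ge w N%:R ((Y - X) i j)) ->
  val_ge w (N%:R - C) (P.@[fun i => mxvec Y 0 i] - P.@[fun i => mxvec X 0 i]).
Proof.
pose K (f : 'M[F]_D -> F) := exists2 C : rat, 0 <= C & forall (N : nat) Y,
  (forall i j, val_ge w N%:R ((Y - X) i j)) -> val_ge w (N%:R - C) (f Y - f X).
suff [C _ hC] : K (fun Y => P.@[fun i => mxvec Y 0 i]) by exists C.
apply: (meval_ind (x := fun Y i => mxvec Y 0 i) (K := K)).
- by move=> f g e [C C0 hC]; exists C => // N Y hY; rewrite -!e; apply: hC.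
- by move=> c; exists 0 => // N Y _; rewrite subrr val_ge0.
- move=> i; case/mxvec_indexP: i => i j; exists 0 => // N Y hY.
  by have := hY i j; rewrite subr0 !mxvecE !mxE.
- move=> f g [C C0 hC] [C' C'0 hC']; exists (C + C') => [|N Y hY]; first lra.
  have -> : f Y + g Y - (f X + g X) = (f Y - f X) + (g Y - g X) by ring.
  apply: (val_geD hw).
    by apply: (val_ge_le _ (hC N Y hY)); lra.
  by apply: (val_ge_le _ (hC' N Y hY)); lra.
- move=> f g [C C0 hC] [C' C'0 hC'].
  have [a a0 ha] := val_ge_lower_bound (f X); have [b b0 hb] := val_ge_lower_bound (g X).
  exists (C + C' + a + b) => [|N Y hY]; first lra.
  have hf := hC N Y hY; have hg := hC' N Y hY.
  have -> : f Y * g Y - f X * g X =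
      (f Y - f X) * g X + (g Y - g X) * f X + (f Y - f X) * (g Y - g X) by ring.
  apply: (val_geD hw); first apply: (val_geD hw).
  - by apply: (val_ge_le _ (val_geM hw hf hb)); lra.
  - by apply: (val_ge_le _ (val_geM hw hg ha)); lra.
  (* The quadratic term has valuation at least 2 N - C - C', which suffices as N >= 0. *)
  - apply: (val_ge_le _ (val_geM hw hf hg)).
    have : 0 <= N%:R :> rat by rewrite ler0n.
    by lra.
Qed.

Lemma zariski_dense (S : 'M[F]_D -> Prop) (M : 'M[F]_D) : M \in unitmx ->
  (forall N : nat, exists2 A, S A & forall i j, val_ge w N%:R ((A - M) i j)) ->
  zariski_closure S M.
Proof.
move=> uM dM; split=> // P hP; have [C hC] := meval_continuous P M.
apply: (val_small_eq0 (v := w)) => n; have [A SA hA] := dM (n + (Num.truncn `|C|).+1)%N.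
have := hC _ _ hA; rewrite hP // sub0r (val_geN hw); apply: val_ge_le.
have lt := Num.Theory.truncnS_gt `|C|; have le := ler_norm C; rewrite natrD.
by lra.
Qed.

End Continuity.

(** * The monodromy group *)

Section Monodromy.
Variables (p : nat) (Om : fieldType) (t : Om).
Hypothesis hp : prime p.
Hypothesis hOm : is_sepclosure_Fpt p t.
Local Notation k := (@Fpbar p Om).
Local Notation Gal := (Defs.gal t k).
Let hch : p \in [pchar Om] := Om_pchar hOm.
Let ksub : is_subfield k := Fpbar_subfield hp hch.
Let oG := subgroup_Gal hOm.

Variables (F : closedFieldType) (w : F -> rat) (D : nat).
Hypothesis hw : valuation w.
Variable r : {rmorphism Om -> Om} -> 'M[F]_D.
Hypothesis r_unit : forall s, Gal s -> r s \in unitmx.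
Hypothesis r_mul : forall s1 s2 s3, Gal s1 -> Gal s2 -> Gal s3 ->
  s3 =1 s1 \o s2 -> r s3 = r s1 *m r s2.
Hypothesis r_cont : forall N : nat, exists ys : seq Om, forall s, Gal s ->
  {in ys, forall y, s y = y} -> forall i j, val_ge w N%:R ((r s - 1%:M) i j).
Hypothesis r_unram : forall a, k a -> a != 0 -> forall v, place_over (t - a) v ->
  forall s, Gal s -> inertia v s -> r s = 1%:M.
Hypothesis r_tame : forall v, place_over t v -> forall s, Gal s ->
  wild_inertia v s -> r s = 1%:M.
Hypothesis r_infty : forall v, place_over t^-1 v -> forall (U : rat) s, 1 <= U ->
  upper_ramification p t v U s -> wild_inertia v s -> r s = 1%:M.

Variable v0 : Om -> rat.
Hypothesis hv0 : place_over t v0.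
Let hu0 : uniformizer p t t.
Proof. by left; exists 0; [apply: subfield0|rewrite subr0]. Qed.

Local Notation image := (fun M => exists2 s, Gal s & M = r s).
Local Notation G := (Ggeom p t r).
Local Notation N := (inertia_normal_closure p t v0 r).
Local Notation I0 := (inertia_gal p t v0).

Lemma rep_id (s : {rmorphism Om -> Om}) : Gal s -> s =1 idfun -> r s = 1%:M.
Proof.
move=> Gs e; have : r s = r s *m r s by apply: r_mul => // x /=; rewrite e.
by move/(congr1 (mulmx (invmx (r s)))); rewrite mulmxA mulVmx ?r_unit // mul1mx.
Qed.

Lemma rep_ext (s s' : {rmorphism Om -> Om}) : Gal s -> Gal s' -> s =1 s' -> r s = r s'.
Proof.
move=> Gs Gs' e; rewrite (r_mul (gal_id p t) Gs' Gs) => [|x] //.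
by rewrite (rep_id (gal_id p t)) // mul1mx.
Qed.

Lemma rep_comp s1 s2 : Gal s1 -> Gal s2 -> r (s1 \o s2) = r s1 *m r s2.
Proof. by move=> G1 G2; apply: r_mul => //; apply: gal_comp. Qed.

Lemma rep_inv (s s' : {rmorphism Om -> Om}) : Gal s -> Gal s' -> cancel s' s ->
  r s' = invmx (r s).
Proof.
move=> Gs Gs' e; have := rep_id (gal_comp Gs Gs') e; rewrite rep_comp //.
by move=> h; rewrite -[LHS]mul1mx -(mulVmx (r_unit Gs)) -mulmxA h mulmx1.
Qed.

Let image_unit M : image M -> M \in unitmx.
Proof. by move=> [s Gs ->]; apply: r_unit. Qed.

Lemma Ggeom_mem s : Gal s -> G (r s).
Proof. by move=> Gs; apply: (zariski_mem image_unit); exists s. Qed.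

Lemma Ggeom_mul A B : G A -> G B -> G (A *m B).
Proof.
apply: zariskiM => _ _ [s Gs ->] [s' Gs' ->].
by exists (s \o s'); [apply: gal_comp|rewrite rep_comp].
Qed.

Lemma Ggeom_inv A : G A -> G (invmx A).
Proof.
apply: (zariskiV image_unit) => _ [s Gs ->]; have [s' [Gs' _ c]] := gal_inv hOm Gs.
by exists s' => //; rewrite (rep_inv Gs Gs' _) => // x; have := c x.
Qed.

Lemma Ggeom_one : G 1%:M.
Proof. by rewrite -(rep_id (gal_id p t)) //; apply: Ggeom_mem; apply: gal_id. Qed.

Lemma generated_sub (S : 'M[F]_D -> Prop) A : (forall A, S A -> G A) ->
  generated S A -> G A.
Proof.
move=> hS; elim=> [|B /hS//|B C _ GB _ GC|B _ GB]; first exact: Ggeom_one.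
  exact: Ggeom_mul.
exact: Ggeom_inv.
Qed.

Lemma normal_closure_sub A : N A -> G A.
Proof.
apply: generated_sub => _ [g [_ [Gg [s [Gs _ ->]] ->]]].
by apply: Ggeom_mul (Ggeom_inv Gg); apply: Ggeom_mul (Ggeom_mem Gs).
Qed.

Lemma normal_closure_conj g A : G g -> N A -> N (g *m A *m invmx g).
Proof.
move=> Gg; have ug : g \in unitmx by case: Gg.
elim=> [|B [h [x [Gh hx ->]]]|B C _ NB _ NC|B NB0 NB].
- by rewrite mulmx1 mulmxV //; apply: generated_one.
- apply: generated_mem; exists (g *m h), x; split=> //; first exact: Ggeom_mul.
  have uh : h \in unitmx by case: Gh.
  have -> : invmx (g *m h) = invmx h *m invmx g.
    have ugh : g *m h \in unitmx by rewrite unitmx_mul ug.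
    rewrite -[RHS]mul1mx -(mulVmx ugh) -!mulmxA (mulmxA h) mulmxV // mul1mx.
    by rewrite mulmxV // mulmx1.
  by rewrite !mulmxA.
- have -> : g *m (B *m C) *m invmx g = (g *m B *m invmx g) *m (g *m C *m invmx g).
    by rewrite !mulmxA mulmxKV.
  exact: generated_mul.
- have uB : B \in unitmx by case: (normal_closure_sub NB0).
  have -> : g *m invmx B *m invmx g = invmx (g *m B *m invmx g).
    have uc : g *m B *m invmx g \in unitmx by rewrite !unitmx_mul ug uB unitmx_inv.
    rewrite -[LHS]mul1mx -(mulVmx uc) -!mulmxA (mulmxA (invmx g) g) mulVmx //.
    by rewrite mul1mx (mulmxA B) mulmxV // mul1mx mulmxV // mulmx1.
  exact: generated_inv.
Qed.

Lemma inertia_normal_mem s : I0 s -> N (r s).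
Proof.
move=> [Gs Is]; apply: generated_mem; exists 1%:M, (r s); split.
- exact: Ggeom_one.
- by exists s.
- by rewrite mul1mx invmx1 mulmx1.
Qed.

(* The elements [s] with [r s] in [N * r(Delta)], for a normal open subgroup
   [Delta], form a group to which [unramified_cover_trivial] applies. *)
Lemma normal_closure_open (ys : seq Om) g : Gal g ->
  exists A d, [/\ N A, Gal d, {in ys, forall y, d y = y} & r g = A *m r d].
Proof.
have [zs [sub st]] := stable_closure hOm oG ys.
pose Delta (d : {rmorphism Om -> Om}) := Gal d /\ {in zs, forall z, d z = z}.
pose H (s : {rmorphism Om -> Om}) := Gal s /\ exists A d, [/\ N A, Delta d & r s = A *m r d].
suff : Gal g -> H g.
  move=> h /h[_ [A [d [NA [Gd fd] e]]]]; exists A, d; split=> // y /sub; exact: fd.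
have oD : subgroup p t Delta := subgroup_fix zs oG.
have uD d : Delta d -> r d \in unitmx by move=> [Gd _]; apply: r_unit.
have Dconj g1 g2 d : Gal g1 -> Gal g2 -> cancel g1 g2 -> cancel g2 g1 -> Delta d ->
    Delta (g1 \o (d \o g2)).
  move=> G1 G2 c1 c2 [Gd fd]; split; first by do 2![apply: gal_comp => //].
  by move=> z zz /=; rewrite fd ?c2 //; apply: st.
have triv s : Gal s -> r s = 1%:M -> H s.
  move=> Gs rs; split=> //; exists 1%:M, idfun; split; first exact: generated_one.
    exact: (subgroup_id oD).
  by rewrite rs (rep_id (gal_id p t)) // mul1mx.
have [fin [v hv]] := place_exists hp hOm hv0.
apply: (unramified_cover_trivial hp hOm hv (H := H)).
- split=> [s []//||s1 s2 [G1 [A1 [d1 [N1 D1 e1]]]] [G2 [A2 [d2 [N2 D2 e2]]]]|s [Gs [A [d [NA Dd e]]]]].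
  + apply: triv; [exact: gal_id|exact: rep_id (gal_id p t) _].
  + split; first exact: gal_comp.
    (* [N] is normal, so [r d1] can be moved past [A2] at the cost of a conjugation. *)
    exists (A1 *m (r d1 *m A2 *m invmx (r d1))), (d1 \o d2); split.
    * by apply: generated_mul => //; apply: normal_closure_conj => //; apply: Ggeom_mem; case: D1.
    * exact: (subgroup_comp oD).
    * rewrite rep_comp // e1 e2 (rep_comp D1.1 D2.1) !mulmxA.
      by rewrite mulmxKV // uD.
  + have [s' [Gs' c1 c2]] := gal_inv hOm Gs; exists s'; split=> //; split=> //.
    have [d' [Dd' cd1 cd2]] := subgroup_inv oD Dd.
    exists (r d' *m invmx A *m invmx (r d')), d'; split=> //.
      apply: normal_closure_conj; first by apply: Ggeom_mem; case: Dd'.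
      exact: generated_inv.
    have uA : A \in unitmx by case: (normal_closure_sub NA).
    rewrite mulmxKV ?uD // (rep_inv Gs Gs' c2) (rep_inv Dd.1 Dd'.1 cd2) e.
    have uAd : A *m r d \in unitmx by rewrite unitmx_mul uA uD.
    rewrite -[RHS]mul1mx -(mulVmx uAd) -!mulmxA (mulmxA (r d)) mulmxV ?uD //.
    by rewrite mul1mx mulmxV // mulmx1.
- move=> s s' Gs' e [Gs [A [d [NA Dd rE]]]]; split=> //; exists A, d.
  by rewrite -(rep_ext Gs Gs' e).
- move=> g1 g2 s G1 G2 c1 c2 [Gs [A [d [NA Dd e]]]].
  split; first by do 2![apply: gal_comp => //].
  have Ggd := (Dconj _ _ _ G1 G2 c1 c2 Dd).
  exists (r g1 *m A *m invmx (r g1)), (g1 \o (d \o g2)); split=> //.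
    by apply: normal_closure_conj => //; apply: Ggeom_mem.
  rewrite !rep_comp ?e //; try by [apply: gal_comp|case: Dd].
    by rewrite !mulmxA mulmxKV // r_unit.
  by apply: gal_comp => //; case: Dd.
- exists zs => s Gs fs; split=> //; exists 1%:M, s; split=> //; first exact: generated_one.
  by rewrite mul1mx.
(* Above 0 the inertia group maps into [N] by construction; above the other points it acts
   trivially. *)
- move=> a ka; have [->|a0] := eqVneq a 0.
    exists v0; first by rewrite subr0.
    move=> s Is; split; first by case: Is.
    exists (r s), idfun; split; first exact: inertia_normal_mem.
      exact: (subgroup_id oD).
    by rewrite (rep_id (gal_id p t)) // mulmx1.
  have [v1 hv1] := fin a ka; exists v1 => // s [Gs Is].
  by apply: triv => //; apply: r_unram hv1 _ _ _.
- move=> U s U1 hs ws; apply: triv; first by case: hs.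
  exact: r_infty hv _ _ U1 hs ws.
Qed.

Lemma normal_closure_dense g : Gal g -> zariski_closure N (r g).
Proof.
move=> Gg; apply: (zariski_dense hw (r_unit Gg)) => n.
(* Since A - r g is [r g] times r(d^-1) - 1, the precision asked of [d] exceeds [n] by a bound [B]
   for the denominators of [r g]. *)
have [B hB] : exists B : nat, forall i j, val_ge w (- B%:R) (r g i j).
  exists (\sum_i \sum_j (Num.truncn `|w (r g i j)|).+1)%N => i j.
  apply: (val_ge_le _ (val_ge_id w _)); rewrite lerNl.
  apply: (@le_trans _ _ (Num.truncn `|w (r g i j)|).+1%:R).
    apply/ltW/(le_lt_trans _ (Num.Theory.truncnS_gt _)).
    by rewrite -normrN ler_norm.
  rewrite ler_nat (bigD1 i) //= (bigD1 j) //= -!addnA; exact: leq_addr.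
have [ys hys] := r_cont (n + B).
have [A [d [NA Gd fd e]]] := normal_closure_open ys Gg.
have [d' [Gd' c1 c2]] := gal_inv hOm Gd.
exists A => // i j.
have -> : A - r g = r g *m (r d' - 1%:M).
  rewrite mulmxBr mulmx1 e -mulmxA -rep_comp // (rep_id (gal_comp Gd Gd') c2).
  by rewrite mulmx1.
rewrite mxE; apply: (val_ge_sum hw) => l _.
have h := hys d' Gd' _ l j; rewrite -[n%:R](addKr B%:R).
apply: (val_geM hw) => //.
rewrite -natrD addnC; apply: h => y yl.
by rewrite -{1}(fd y yl) c1.
Qed.

Lemma Ggeom_closure M : zariski_closure N M <-> G M.
Proof.
split=> -[uM hM]; split=> // P hP; apply: hM => A.
  by case/normal_closure_sub => _ h; apply: h.
by case=> s Gs ->; case: (normal_closure_dense Gs) => _ h; apply: h.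
Qed.

Section Finite.
Hypothesis G_finite : finite_set G.

(** A finite set of matrices is discrete: beyond some precision, 1 is its only element close to
    1. *)
Lemma finite_image_kernel : exists ys : seq Om, forall s, Gal s ->
  {in ys, forall y, s y = y} -> r s = 1%:M.
Proof.
have [l hl] := G_finite.
have /boolp.choice[n hn] (A : 'M[F]_D) : exists n : nat,
    (forall i j, val_ge w n%:R ((A - 1%:M) i j)) -> A = 1%:M.
  have [[n hn]|h] := boolp.pselect (exists n : nat, ~ forall i j, val_ge w n%:R ((A - 1%:M) i j)).
    by exists n => /hn.
  exists 0%N => _; apply/eqP; rewrite -subr_eq0; apply/eqP/matrixP => i j.
  rewrite [RHS]mxE; apply: (val_small_eq0 (v := w)) => n.
  by apply: contraT => nv; case: h; exists n => /(_ i j) hv; rewrite hv in nv.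
have [ys hys] := r_cont (\max_(A <- l) n A); exists ys => s Gs fs.
apply: hn => i j; apply: val_ge_le (hys s Gs fs i j); rewrite ler_nat.
by apply: leq_bigmax_seq => //; apply/hl/Ggeom_mem.
Qed.

Lemma rep_iter s n : I0 s -> exists s' : {rmorphism Om -> Om},
  [/\ I0 s', s' =1 iter n s & r s' = r s ^+ n].
Proof.
have oI := inertia_subgroup hp hOm hu0 hv0.
move=> Is; elim: n => [|n [s' [Is' e rE]]].
  exists idfun; split=> //; first exact: (subgroup_id oI).
  exact: (rep_id (gal_id p t)).
exists (s \o s'); split; first exact: (subgroup_comp oI).
  by move=> x /=; rewrite e.
by rewrite rep_comp ?rE ?exprS //; [case: Is|case: Is'].
Qed.

(* Powers of [s] with exponents congruent to 1 modulo p ^ a and divisible by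
   the orders of residues accumulate at a wild inertia element. *)
Lemma inertia_p_element s a : I0 s -> r s ^+ (p ^ a) = 1 -> r s = 1%:M.
Proof.
move=> Is rs; have [ys hys] := finite_image_kernel.
(* [None] preserves the matrix in the limit: [s'] need only agree on [ys] with some [s''] having the
   matrix of [s]. The other conditions express wildness. *)
pose C (i : option Om) (s' : {rmorphism Om -> Om}) :=
  if i is Some x then x != 0 -> val_gt v0 0 (s' x / x - 1)
  else exists s'' : {rmorphism Om -> Om}, [/\ Gal s'', {in ys, s'' =1 s'} & r s'' = r s].
pose supp (i : option Om) := if i is Some x then [:: x] else ys.
have [||s' Gs' hs'] := @gal_compact p Om t hOm _ C supp.
- case=> [x|] s1 s2 /= e.
    by move=> h x0; rewrite -e ?mem_head // h.
  by move=> [s'' [G1 e1 e2]]; exists s''; split=> // y yl; rewrite e1 // e.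
- move=> l.
  have /boolp.choice[e he] (i : option Om) : exists e, coprime p e /\
      (if i is Some x then x != 0 -> forall n, (e %| n)%N -> val_gt v0 0 (iter n s x / x - 1)
       else True).
    case: i => [x|]; last by exists 1%N; rewrite coprimen1.
    have [->|x0] := eqVneq x 0; first by exists 1%N; rewrite coprimen1.
    have [c [[f f0 fc] c0 hc]] := inertia_residue hp hOm hu0 hv0 Is x0.
    have q1 : (1 < p ^ f)%N by rewrite -(exp1n f) ltn_exp2r ?prime_gt1.
    (* The residue of s x / x lies in the field with p^f elements, so its order divides p^f - 1. *)
    exists (p ^ f).-1; split; first exact: coprime_pred_pexp.
    move=> _ n /dvdnP[j nE]; have := hc n; suff -> : c ^+ n = 1 by [].
    rewrite nE mulnC exprM (_ : c ^+ _ = 1) ?expr1n //.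
    by apply: (mulfI c0); rewrite mulr1 -exprS prednK // ltnW.
  pose E := (\prod_(i <- l) e i)%N.
  have cE : coprime (p ^ a) E.
    rewrite coprimeXl // /E; elim/big_rec: _ => [|i x _ cx]; first by rewrite coprimen1.
    by rewrite coprimeMr (he i).1.
  pose n := chinese (p ^ a) E 1 0.
  have [s' [Is' s'E rE]] := rep_iter n Is; exists s'; first by case: Is'.
  apply/forall_in_mem => -[x|] il /=.
    move=> x0; rewrite s'E; apply: (he (Some x)).2 => //.
    apply: (@dvdn_trans E); first by rewrite /E (big_rem _ il) /= dvdn_mulr.
    by apply/eqP; rewrite (chinese_modr cE) mod0n.
  exists s'; split=> //; first by case: Is'.
  by rewrite rE -(expr_mod _ rs) (chinese_modl cE) (expr_mod _ rs) expr1.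
have [s'' [Gs'' e rE]] := hs' None.
have [s1 [Gs1 c1 c2]] := gal_inv hOm Gs''.
have d1 : r (s1 \o s') = 1%:M.
  by apply: hys; [apply: gal_comp|move=> y yl /=; rewrite -e].
rewrite -rE -[LHS]mulmx1 -{1}d1 -rep_comp //; last exact: gal_comp.
rewrite (rep_ext (s' := s')) //; last by move=> x /=; rewrite c2.
  by apply: (r_tame hv0 Gs') => x; apply: (hs' (Some x)).
by do 2![apply: gal_comp => //].
Qed.

(** Let [m] be the part prime to p of an exponent killing [r s]: the matrix of s^m has p-power
    order, so it is trivial by [inertia_p_element]. *)
Lemma inertia_order s : I0 s -> exists2 n, coprime p n & r s ^+ n = 1.
Proof.
move=> Is; have [l hl] := G_finite.
have [n n0 rn] : exists2 n, (0 < n)%N & r s ^+ n = 1.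
  pose f i := r s ^+ i.
  have lf i : f i \in l.
    by apply: hl; have [s' [[Gs' _] _ rE]] := rep_iter i Is; rewrite /f -rE; apply: Ggeom_mem.
  have sub : {subset [seq f i | i <- iota 0 (size l).+1] <= l}.
    by move=> _ /mapP[i _ ->].
  have /(uniqPn 0)[i [j []]] : ~~ uniq [seq f i | i <- iota 0 (size l).+1].
    apply/negP => u; have := uniq_leq_size u sub.
    by rewrite size_map size_iota ltnn.
  rewrite size_map size_iota => ij jl.
  rewrite !(nth_map 0%N) ?size_iota // ?(ltn_trans ij jl) // !nth_iota ?(ltn_trans ij jl) //.
  rewrite !add0n /f => e; exists (j - i)%N; first by rewrite subn_gt0.
  have [s' [[Gs' _] _ rE]] := rep_iter i Is.
  have uf : r s ^+ i \in unitmx by rewrite -rE r_unit.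
  have : r s ^+ i *m r s ^+ (j - i) = r s ^+ i by rewrite {2}e mulmxE -exprD subnKC // ltnW.
  by move/(congr1 (mulmx (invmx (r s ^+ i)))); rewrite mulmxA mulVmx // mul1mx.
have [m cm nE] := pfactor_coprime hp n0.
exists m => //; have [s' [Is' _ rE]] := rep_iter m Is.
by rewrite -rE (inertia_p_element (a := logn p n) Is') // rE -exprM -nE.
Qed.

Lemma finite_closure M : (G M <-> N M) /\ (G M <-> Op_residual p G M).
Proof.
have [l hl] := G_finite.
have GN A : G A -> N A.
  move=> /Ggeom_closure; apply: (zariski_finite (l := l)) => B /normal_closure_sub.
  exact: hl.
split; first by split=> [/GN|/normal_closure_sub].
split; last by apply: generated_sub => A [].
move/GN; elim=> [|B [g [_ [Gg [s [Gs Is ->]] ->]]]|B C _ hB _ hC|B _ hB].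
- exact: generated_one.
- apply: generated_mem; split.
    by apply: Ggeom_mul (Ggeom_inv Gg); apply: Ggeom_mul (Ggeom_mem Gs).
  have [n cn rn] := inertia_order (conj Gs Is); exists n => //.
  have ug : g \in unitmx by case: Gg.
  have -> : (g *m r s *m invmx g) ^+ n = g *m r s ^+ n *m invmx g.
    elim: (n) => [|m IH]; first by rewrite !expr0 mulmx1 mulmxV.
    by rewrite !exprS IH -!mulmxE !mulmxA mulmxKV.
  by rewrite rn mulmx1 mulmxV.
- exact: generated_mul.
- exact: generated_inv.
Qed.

End Finite.
End Monodromy.

Theorem theorem4p1 (p l : nat) (hp : prime p) (hl : prime l) (hpl : p <> l)
    (Om : fieldType) (t : Om) (hOm : is_sepclosure_Fpt p t)
    (F : closedFieldType) (w : F -> rat) (hF : is_Qlbar l w)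
    (D m : nat) (hmD : (m < D)%N) (hW : (2 <= D - m)%N)
    (r : {rmorphism Om -> Om} -> 'M[F]_D)
    (hyp : hypergeometric p t w m r)
    (irr : irreducible t (@Fpbar p Om) r)
    (v0 : Om -> rat) (hv0 : place_over t v0) :
  let G := Ggeom p t r in
  let N := inertia_normal_closure p t v0 r in
  let G0 := zariski_closure N in
  (forall M, G0 M <-> G M) /\
  (finite_set G ->
     (forall M, G M <-> N M) /\ (forall M, G M <-> Op_residual p G M)).
Proof.
case: hyp => f [psi [chi [rho [R [f0 _ _ [lis _ tame0 inf] rR]]]]].
have Gf s : Defs.gal t (@Fpbar p Om) s -> Defs.gal t (@Fq p f Om) s.
  by move=> [st sk]; split=> // x hx; apply: sk; exists f.
have hw := Qlbar_val hF.
have r_unit s : Defs.gal t (@Fpbar p Om) s -> r s \in unitmx.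
  by move=> Gs; rewrite rR //; apply: (lisse_unit lis); apply: Gf.
have r_mul s1 s2 s3 : Defs.gal t (@Fpbar p Om) s1 -> Defs.gal t (@Fpbar p Om) s2 ->
    Defs.gal t (@Fpbar p Om) s3 -> s3 =1 s1 \o s2 -> r s3 = r s1 *m r s2.
  by move=> G1 G2 G3 e; rewrite !rR //; apply: (lisse_mul lis) e; apply: Gf.
have r_cont n : exists ys : seq Om, forall s, Defs.gal t (@Fpbar p Om) s ->
    {in ys, forall y, s y = y} -> forall i j, val_ge w n%:R ((r s - 1%:M) i j).
  have [ys h] := lisse_continuous lis n; exists ys => s Gs fs.
  by rewrite rR //; apply: h fs; apply: Gf.
have r_unram a : Fpbar p a -> a != 0 -> forall v, place_over (t - a) v ->
    forall s, Defs.gal t (@Fpbar p Om) s -> inertia v s -> r s = 1%:M.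
  by move=> ka a0 v hv s Gs; rewrite rR //; apply: (lisse_unramified lis ka a0 hv); apply: Gf.
have r_tame v : place_over t v -> forall s, Defs.gal t (@Fpbar p Om) s ->
    wild_inertia v s -> r s = 1%:M.
  by move=> hv s Gs; rewrite rR //; apply: (tame0 v hv); apply: Gf.
have r_infty v : place_over t^-1 v -> forall (U : rat) s, 1 <= U ->
    upper_ramification p t v U s -> wild_inertia v s -> r s = 1%:M.
  move=> hv U s U1 hs ws; have [T [W [[_ _ full] _ hT hWb _]]] := inf v hv.
  (* The breaks 1 / (D - m) are at most 1 / 2, hence below [U]. So [T] is fixed because [s] is wild,
     and [W] because of the upper index of [s]. *)
  have [Gs _ _] := hs; have bU : (D - m)%:R^-1 < U.
    apply: lt_le_trans U1; rewrite invf_lt1 ?ltr0n ?(ltr_nat _ 1) //.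
    exact: ltn_trans hW.
  have /sub_addsmxP[[a b] /= e] : (1%:M <= T + W)%MS by apply: submx_full.
  rewrite rR //; apply: trmx_inj; rewrite trmx1 -[LHS]mul1mx e mulmxDl -!mulmxA.
  by rewrite (hT s Gs ws) (hWb U s bU hs).
split.
  exact: (Ggeom_closure hp hOm hw r_unit r_mul r_cont r_unram r_infty hv0).
move=> fin; have h := finite_closure hp hOm hw r_unit r_mul r_cont r_unram r_tame r_infty hv0 fin.
by split=> M; have [] := h M.
Qed.
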